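(* Fix $1\le p_0<q<q_0\le\infty$ and $\mathbb B\in O(p_0,q_0)$. Let $f\in L^{p_0}_{loc}(\mathbb R^n)$ and let $a$ be a functional such that $(\fint_{2^kQ}|B_Qf|^{p_0}dx)^{1/p_0}\le a(2^kQ)$ for every integer $k\ge0$ and every cube $Q$. Let $w\in RH_{(q_0/q)'}$ (with $RH_1:=A_\infty$, so that when $q_0=\infty$ this means $w\in A_\infty$). There is a constant $C_0>0$ depending only on $n,p_0,C_{p_0},(\alpha_k),(\beta_k)$ such that if $\tilde\gamma_k\ge C_0m_k$ for all $k\ge1$, $\tilde a(Q)=\sum_{k\ge1}\tilde\gamma_ka(2^kQ)$, and $\tilde a\in D_q(w)$, then for every cube $Q$, $$\|B_Qf\|_{L^{q,\infty}(w),Q}\le C\,\tilde a(2Q),$$ with $C$ independent of $Q$ and $f$.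
   Context: Cubes $Q=\prod_i[a_i,a_i+\ell(Q))$; $\lambda Q$ is the concentric cube of sidelength $\lambda\ell(Q)$; $\mathcal Q$ is the set of all cubes; $\fint_Eg=|E|^{-1}\int_Eg$. A weight is a nonnegative locally integrable $w$, $w(E)=\int_Ew$; $\|g\|_{L^{q,\infty}(w),Q}=\sup_{t>0}t\,(w(\{x\in Q:|g(x)|>t\})/w(Q))^{1/q}$. $w\in RH_p$ ($1<p<\infty$) if $(\fint_Qw^p)^{1/p}\le C\fint_Qw$ for all cubes; $A_\infty=\bigcup_{p\ge1}A_p$ is the Muckenhoupt class. A functional is a map $\mathcal Q\to[0,\infty)$; $a\in D_q(w)$ means there is $C\ge1$ with $\sum_ia(Q_i)^qw(Q_i)\le C^qa(Q)^qw(Q)$ for every cube $Q$ and pairwise disjoint cubes $Q_i\subset Q$. $\mathbb B=(B_Q)$ are linear operators on $L^{p_0}_{loc}(\mathbb R^n)$, $A_Q=I-B_Q$; $\mathbb B\in O(p_0,q_0)$ means: (a) $B_QB_R=B_RB_Q$ for all $Q,R$; (b) $\|B_Qf\|_{L^{p_0}(\mathbb R^n)}\le C_{p_0}\|f\|_{L^{p_0}(\mathbb R^n)}$ for all $Q$; (c) there are $\alpha_k\ge0$ ($k\ge2$) with $\sum_k2^{kn/p_0}\alpha_k<\infty$ such that $(\fint_{2Q}|A_Q(f\chi_{4Q})|^{q_0})^{1/q_0}\le\alpha_2(\fint_{4Q}|f|^{p_0})^{1/p_0}$ and, for $j\ge1$, $(\fint_{2^jQ}|A_Q(f\chi_{\mathbb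 R^n\setminus2^{j+1}Q})|^{q_0})^{1/q_0}\le\sum_{k\ge2}\alpha_{k+j}(\fint_{2^{k+j}Q}|f|^{p_0})^{1/p_0}$; (d) there are $\beta_k\ge0$ with $\sum\beta_k<\infty$ such that for cubes $R\subset Q$, $(\fint_{2R}|B_RA_Qf|^{q_0})^{1/q_0}\le\sum_{k\ge1}\beta_{k+1}(\fint_{2^{k+1}Q}|f|^{p_0})^{1/p_0}$ (essential suprema when $q_0=\infty$). The numbers $m_k$: $m_1=1$, $m_2=\max\{1,\alpha_2,\alpha_3\}$, $m_3=\max\{\alpha_2,\alpha_3,\alpha_4\}$, $m_4=\max\{\alpha_3,\alpha_4,\alpha_5,\beta_2\}$, $m_k=\max\{\alpha_{k-2},2^{kn/p_0}\alpha_{k-1},2^{kn/p_0}\alpha_k,\alpha_{k+1},\beta_{k-3},\beta_{k-2}\}$ for $k\ge5$. *)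

(* Defs.v *)
From HB Require Import structures.
From mathcomp Require Import all_boot all_order all_algebra.
From mathcomp Require Import all_classical all_reals all_analysis.

Set Implicit Arguments.
Unset Strict Implicit.
Unset Printing Implicit Defensive.

Import Order.TTheory GRing.Theory Num.Theory.
Import numFieldNormedType.Exports.

Local Open Scope classical_set_scope.
Local Open Scope ring_scope.

Notation RnB R n := (g_sigma_algebraType (@open 'rV[R]_n)).

Record cube (R : realType) (n : nat) := Cube {
  corner : 'rV[R]_n;
  side : R;
  side_gt0 : 0 < side }.

Definition cubeset (R : realType) (n : nat) (Q : cube R n) : set (RnB R n) :=
  [set x : 'rV[R]_n | forall i : 'I_n,
     corner Q 0 i <= x 0 i /\ x 0 i < corner Q 0 i + side Q].

(* the concentric dilate 2^k Q, of side 2^k l(Q) *)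
Lemma dil2_side_gt0 (R : realType) (n : nat) (k : nat) (Q : cube R n) :
  0 < 2 ^+ k * side Q.
Proof. by rewrite mulr_gt0 ?exprn_gt0 ?ltr0n ?side_gt0. Qed.

Definition dil2 (R : realType) (n : nat) (k : nat) (Q : cube R n) : cube R n :=
  @Cube R n (corner Q + const_mx (((1 - 2 ^+ k) / 2) * side Q))
    (2 ^+ k * side Q) (dil2_side_gt0 k Q).

(* The n-dimensional Lebesgue measure (on Borel sets) is the unique
   measure giving each cube Q the volume l(Q)^n. *)
Definition lebesgue_on_cubes (R : realType) (n : nat)
  (mu : {measure set (RnB R n) -> \bar R}) : Prop :=
  forall Q : cube R n, mu (cubeset Q) = ((side Q) ^+ n)%:E.

Section Analysis.
Variables (R : realType) (n : nat) (mu : {measure set (RnB R n) -> \bar R}).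
Local Notation T := (RnB R n).
Local Notation cube := (cube R n).

Definition aeeq (f g : T -> R) : Prop := {ae mu, forall x, f x = g x}.

Definition pavg (p : R) (E : set T) (g : T -> R) : \bar R :=
  ((mu E)^-1 * \int[mu]_(x in E) ((`|g x| `^ p)%:E))%E.

Definition esssup_on (E : set T) (g : T -> R) : \bar R :=
  ereal_inf [set t : \bar R | mu (E `&` [set x | (t < (`|g x|)%:E)%E]) = 0%E].

Definition normavg (p : \bar R) (E : set T) (g : T -> R) : \bar R :=
  match p with
  | r%:E => poweR (pavg r E g) r^-1
  | +oo%E => esssup_on E g
  | -oo%E => 0%E
  end.

Definition Lpnorm (p : R) (g : T -> R) : \bar R :=
  poweR (\int[mu]_x ((`|g x| `^ p)%:E)) p^-1.

Definition locLp (p : R) (f : T -> R) : Prop :=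
  measurable_fun setT f /\
  forall Q : cube, (\int[mu]_(x in cubeset Q) ((`|f x| `^ p)%:E) < +oo)%E.

Definition restr (f : T -> R) (E : set T) : T -> R := fun x => f x * \1_E x.

Definition opA (B : cube -> (T -> R) -> (T -> R)) (Q : cube) (g : T -> R) :
  T -> R := fun x => g x - B Q g x.

Definition linear_on_Lloc (p0 : R) (B : cube -> (T -> R) -> (T -> R)) : Prop :=
  forall Q : cube,
    (forall f, locLp p0 f -> locLp p0 (B Q f)) /\
    (forall f g, locLp p0 f -> locLp p0 g -> aeeq f g -> aeeq (B Q f) (B Q g)) /\
    (forall f g (c : R), locLp p0 f -> locLp p0 g ->
       aeeq (B Q (fun x => f x + c * g x)) (fun x => B Q f x + c * B Q g x)).

Definition alpha_adm (p0 : R) (alpha : nat -> R) : Prop :=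
  (forall k, (2 <= k)%N -> 0 <= alpha k) /\
  (\sum_(2 <= k <oo) ((2 `^ (k%:R * n%:R / p0) * alpha k)%:E) < +oo)%E.

Definition beta_adm (beta : nat -> R) : Prop :=
  (forall k, 0 <= beta k) /\ (\sum_(0 <= k <oo) ((beta k)%:E) < +oo)%E.

Definition classO (p0 : R) (q0 : \bar R) (B : cube -> (T -> R) -> (T -> R))
  (Cp0 : R) (alpha beta : nat -> R) : Prop :=
  [/\ linear_on_Lloc p0 B,
    (forall Q R' f, locLp p0 f -> aeeq (B Q (B R' f)) (B R' (B Q f))),
    (forall Q f, locLp p0 f -> (Lpnorm p0 (B Q f) <= Cp0%:E * Lpnorm p0 f)%E),
    alpha_adm p0 alpha /\
    (forall Q f, locLp p0 f ->
      (normavg q0 (cubeset (dil2 1 Q)) (opA B Q (restr f (cubeset (dil2 2 Q))))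
        <= (alpha 2)%:E * normavg p0%:E (cubeset (dil2 2 Q)) f)%E /\
      (forall j, (1 <= j)%N ->
        (normavg q0 (cubeset (dil2 j Q))
            (opA B Q (restr f (~` cubeset (dil2 j.+1 Q))))
         <= \sum_(2 <= k <oo) ((alpha (k + j))%:E
                 * normavg p0%:E (cubeset (dil2 (k + j) Q)) f))%E)) &
    beta_adm beta /\
    (forall Q R' f, cubeset R' `<=` cubeset Q -> locLp p0 f ->
      (normavg q0 (cubeset (dil2 1 R')) (B R' (opA B Q f))
        <= \sum_(1 <= k <oo) ((beta k.+1)%:E
               * normavg p0%:E (cubeset (dil2 k.+1 Q)) f))%E)].

Definition weight (w : T -> R) : Prop := (forall x, 0 <= w x) /\ locLp 1 w.

Definition wmeas (w : T -> R) (E : set T) : \bar R := \int[mu]_(x in E) (w x)%:E.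

Definition wavg (w : T -> R) (E : set T) : \bar R := ((mu E)^-1 * wmeas w E)%E.

Definition RH (p : R) (w : T -> R) : Prop :=
  exists C : R, forall Q : cube,
    (normavg p%:E (cubeset Q) w <= C%:E * wavg w (cubeset Q))%E.

Definition essinf_on (E : set T) (g : T -> R) : \bar R :=
  ereal_sup [set t : \bar R | mu (E `&` [set x | ((g x)%:E < t)%E]) = 0%E].

Definition A1 (w : T -> R) : Prop :=
  exists C : R, forall Q : cube,
    (wavg w (cubeset Q) <= C%:E * essinf_on (cubeset Q) w)%E.

(* w^{1-p'} = w^{-1/(p-1)}, equal to +oo where w = 0 *)
Definition wpowneg (w : T -> R) (s : R) : T -> \bar R :=
  fun x => if w x == 0 then +oo%E else ((w x) `^ (- s))%:E.

Definition Ap_gt1 (p : R) (w : T -> R) : Prop :=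
  exists C : R, forall Q : cube,
    (wavg w (cubeset Q) *
      poweR ((mu (cubeset Q))^-1 *
             \int[mu]_(x in cubeset Q) wpowneg w (p - 1)^-1 x) (p - 1)
     <= C%:E)%E.

Definition Ap (p : R) (w : T -> R) : Prop :=
  (p = 1 /\ A1 w) \/ (1 < p /\ Ap_gt1 p w).

Definition Ainfty (w : T -> R) : Prop := exists p : R, 1 <= p /\ Ap p w.

(* w in RH_{(q0/q)'}, with RH_1 := A_oo (the case q0 = oo) *)
Definition RH_conj (q : R) (q0 : \bar R) (w : T -> R) : Prop :=
  match q0 with
  | r%:E => let s := r / q in RH (s / (s - 1)) w
  | +oo%E => Ainfty w
  | -oo%E => False
  end.

Definition Dq_with (q : R) (w : T -> R) (a : cube -> \bar R) (C : R) : Prop :=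
  (forall Q, (0 <= a Q)%E /\ (a Q < +oo)%E) /\ 1 <= C /\
  forall (Q : cube) (J : set nat) (Qi : nat -> cube),
    (forall i, J i -> cubeset (Qi i) `<=` cubeset Q) ->
    (forall i j, J i -> J j -> i <> j -> cubeset (Qi i) `&` cubeset (Qi j) = set0) ->
    (\esum_(i in J) (poweR (a (Qi i)) q * wmeas w (cubeset (Qi i)))
      <= (C `^ q)%:E * poweR (a Q) q * wmeas w (cubeset Q))%E.

Definition Dq (q : R) (w : T -> R) (a : cube -> \bar R) : Prop :=
  exists C : R, Dq_with q w a C.

Definition weaknorm (w : T -> R) (q : R) (Q : cube) (g : T -> R) : \bar R :=
  ereal_sup [set (t%:E * poweR (wmeas w (cubeset Q `&` [set x | (t < `|g x|)%R])
                                 / wmeas w (cubeset Q)) q^-1)%E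
            | t in [set t : R | 0 < t]].

End Analysis.

Definition mseq (R : realType) (n : nat) (p0 : R) (alpha beta : nat -> R)
  (k : nat) : R :=
  match k with
  | 0 => 0
  | 1 => 1
  | 2 => Num.max 1 (Num.max (alpha 2) (alpha 3))
  | 3 => Num.max (alpha 2) (Num.max (alpha 3) (alpha 4))
  | 4 => Num.max (alpha 3) (Num.max (alpha 4) (Num.max (alpha 5) (beta 2)))
  | _ =>
      let c := 2 `^ (k%:R * n%:R / p0) in
      Num.max (alpha (k - 2)%N) (Num.max (c * alpha (k - 1)%N)
        (Num.max (c * alpha k) (Num.max (alpha k.+1)
          (Num.max (beta (k - 3)%N) (beta (k - 2)%N)))))
  end.

Definition atilde (R : realType) (n : nat) (gamma : nat -> R)
  (a : cube R n -> R) : cube R n -> \bar R :=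
  fun Q => (\sum_(1 <= k <oo) ((gamma k * a (dil2 k Q))%:E))%E.

(* Main.v *)
Require Import Defs.
From HB Require Import structures.
From mathcomp Require Import all_boot all_order all_algebra.
From mathcomp Require Import all_classical all_reals all_analysis.
From mathcomp Require Import measurable_realfun.
From mathcomp Require Import ring lra zify.
Import Order.TTheory GRing.Theory Num.Theory.
Import numFieldNormedType.Exports.
Set Implicit Arguments.
Unset Strict Implicit.
Unset Printing Implicit Defensive.
Local Open Scope classical_set_scope.
Local Open Scope ring_scope.

(** Let T be a cube of side 3/2 l(Q) whose centre is close to that of Q, and let
    h = B_T f.  Commutation gives B_Q f = h + A_T B_Q f - A_Q h, and the
    off-diagonal bounds control the last two terms in L^{q0}(Q) by a~(2Q); the
    reverse Hoelder property turns this into a weak L^q(w) bound.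

    The term h is treated by a good-lambda inequality over the dyadic cells of Q.
    If P is a maximal cell such that the average of |h|^{p0} over 3P exceeds
    t^{p0}, then on 2P

      h = (2 A_P - A_P^2) h - B_P A_T B_P f + B_P B_P f,

    where the first two terms are O(t) in L^{q0} and the third is O(a~(P)) in
    L^{p0}.  The part of P where h is bad at level 2^m t has small w-measure: on
    average over 1 <= m <= L for the two L^{q0} terms, and by A_oo for the third
    one if a~(P) is at most a small multiple of t; the remaining cells P are
    summed by D_q.  By the pigeonhole principle some m satisfies
    phi(2^m t) <= phi(t) / 2 + O(a~(2Q)^q w(Q)), with phi(t) = t^q w(Omega_t).

    In the first term, averages of h over cubes 2^l P larger than Q are bounded by
    a(2^l T_d), where T_d is T shrunk by 2^d about its centre.  The factor
    2^{kn/p0} in m_k makes this harmless as soon as a~(T_d) = O(2^{dn/p0} a~(2Q))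
    for all d, and by D_q and Borel-Cantelli some centre near that of Q has this
    property. *)

(** Moving [T]: [D_q] compares a~(T_d) with a~(2Q) only through the ratio (w(2Q) / w(T_d))^(1/q),
    and around an exceptional centre, possibly that of [Q], this ratio can outgrow 2^(dn/p0). On
    disjoint families [D_q] acts as a Chebyshev inequality, so such centres cannot fill a cell: the
    centre is selected, not prescribed.

    Averaging over m: for finite q0 and the exponent (q0/q)', an L^{q0} bound on 2P makes the bad
    part of P at level 2^m t of measure O(2^(-mq)) w(P). The factor 2^(mq) in phi consumes this
    decay entirely, so enlarging m alone does not contract phi. What helps is the strong L^{q0}
    bound of the maximal function: the layer-cake sum over all m is O(1), so its average over L
    levels is small.

    Finiteness: sup phi is not known to be finite, so nothing is absorbed into it. The levels are
    climbed from one where phi is at most lambda^q w(Q); each pigeonhole step has bounded length and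
    keeps phi under a fixed bound, and monotonicity fills the gaps. *)

Section MeasureGeneralities.
Context (d : measure_display) (T : measurableType d) (R : realType).
Implicit Types m : {measure set T -> \bar R}.

(** Makes [w dmu] and [|u|^p dmu] measures, so that the decompositions into cells below apply to
    them exactly as to [mu]. *)
Lemma density_measure m (g : T -> \bar R) : measurable_fun setT g ->
  (forall x, (0 <= g x)%E) ->
  exists nu : {measure set T -> \bar R},
    forall E, nu E = (\int[m]_(x in E) g x)%E.
Proof.
move=> mg g0.
pose F E := (\int[m]_(x in E) g x)%E.
have F0 : F set0 = 0%E by rewrite /F integral_set0.
have Fge0 E : (0 <= F E)%E by apply: integral_ge0.
have Fsa : semi_sigma_additive F.
  move=> /= A mA tA mUA; rewrite /F; apply: cvg_toP.
    apply: ereal_nondecreasing_is_cvgn => i j ij.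
    by apply: lee_sum_nneg_natr => // k _ _; exact: integral_ge0.
  by rewrite ge0_integral_bigcup//=; exact: measurable_funTS.
pose M := isMeasure.Build _ _ _ F F0 Fge0 Fsa.
pose nu : {measure set T -> \bar R} := HB.pack F M.
by exists nu.
Qed.

Lemma disjoint_esum m (I : countType) (S : set I) (F : I -> set T) :
  (forall i, S i -> measurable (F i)) -> trivIset S F ->
  m (\bigcup_(i in S) F i) = \esum_(i in S) m (F i).
Proof.
move=> mF tF.
pose J := pickle @` S.
pose G k := if unpickle k is Some i then F i else set0.
have GE i : G (pickle i) = F i by rewrite /G pickleK.
have -> : \bigcup_(i in S) F i = \bigcup_(k in J) G k.
  apply/seteqP; split=> x.
    by move=> [i Si Fx]; exists (pickle i); [exists i|rewrite GE].
  by move=> [_ [i Si <-]]; rewrite GE => Fx; exists i.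
rewrite measure_bigcup//; last 2 first.
- by move=> _ [i Si <-]; rewrite GE; exact: mF.
- move=> _ _ [i Si <-] [j Sj <-]; rewrite !GE => ne.
  by rewrite (tF i j).
rewrite nneseries_esum// set_mem_set.
rewrite esum_image; last by move=> i j _ _; exact: (pcan_inj pickleK).
by apply: eq_esum => i Si; rewrite GE.
Qed.

Lemma cover_esum m (I : countType) (S : set I) (G : I -> set T) (A : set T) :
  (forall i, S i -> measurable (G i)) -> measurable A ->
  A `<=` \bigcup_(i in S) G i ->
  (m A <= \esum_(i in S) m (G i))%E.
Proof.
move=> mG mA AG.
(* [pickle_inv] rather than [unpickle]: it is [None] off the image of [pickle], so that no [G i] is
   counted twice. *)
pose H k := if pickle_inv k is Some i then
              (if `[< S i >] then G i else set0) else set0.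
have HE i : S i -> H (pickle i) = G i.
  by move=> Si; rewrite /H pickleK_inv asboolT.
have mH k : measurable (H k).
  by rewrite /H; case: pickle_inv => // i; case: asboolP => // /mG.
have AH : A `<=` \bigcup_k H k.
  by move=> x /AG[i Si Gx]; exists (pickle i) => //; rewrite HE.
apply: (le_trans (measure_sigma_subadditive m mH mA AH)).
rewrite nneseries_esumT// (esumID (pickle @` S)) // addeC esum1 ?add0e.
  rewrite setTI esum_image; last by move=> i j _ _; exact: (pcan_inj pickleK).
  by apply: le_esum => i Si; rewrite HE.
move=> k [_ nS]; rewrite /H.
have := @pickle_invK I k; case: pickle_inv => [i /= ik|_]; last exact: measure0.
case: asboolP => Si; last exact: measure0.
by case: nS; exists i.
Qed.

(** The Vitali pattern: the disjoint [F i] carry the mass, while larger sets [G i], for instance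
    tripled cells, do the covering. *)
Lemma cover_le m1 m2 (I : countType) (S : set I) (F G : I -> set T)
    (A : set T) (c : R) :
  0 <= c ->
  (forall i, S i -> measurable (F i)) -> trivIset S F ->
  (forall i, S i -> measurable (G i)) -> measurable A ->
  A `<=` \bigcup_(i in S) G i ->
  (forall i, S i -> m1 (G i) <= c%:E * m2 (F i))%E ->
  (m1 A <= c%:E * m2 (\bigcup_(i in S) F i))%E.
Proof.
move=> c0 mF tF mG mA AG GF.
apply: (le_trans (cover_esum m1 mG mA AG)).
rewrite -[leRHS]/(mscale (NngNum c0) m2 _) disjoint_esum//.
by apply: le_esum => i Si; exact: GF.
Qed.

(** Turns an estimate on each stopping cell into a global one; [m1] and [m2] vary with the use
    (restrictions, densities, sums over levels). *)
Lemma local_le m1 m2 (I : countType) (S : set I) (F : I -> set T)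
    (A : set T) (c : R) :
  0 <= c ->
  (forall i, S i -> measurable (F i)) -> trivIset S F -> measurable A ->
  A `<=` \bigcup_(i in S) F i ->
  (forall i, S i -> m1 (A `&` F i) <= c%:E * m2 (F i))%E ->
  (m1 A <= c%:E * m2 (\bigcup_(i in S) F i))%E.
Proof.
move=> c0 mF tF mA AF h.
apply: (@cover_le m1 m2 I S F (fun i => A `&` F i)) => //.
- by move=> i Si; apply: measurableI => //; exact: mF.
- by move=> x Ax; have [i Si Fx] := AF _ Ax; exists i.
Qed.

Lemma measure_setD m (A B : set T) : measurable A -> measurable B ->
  A `<=` B -> (m B < +oo)%E -> m (B `\` A) = (m B - m A)%E.
Proof. by move=> mA mB AB fB; rewrite measureD// (setIidr AB). Qed.

Lemma measure_mono m (A B : set T) : measurable A -> measurable B ->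
  A `<=` B -> (m A <= m B)%E.
Proof. by move=> mA mB AB; rewrite le_measure ?inE. Qed.

Lemma measure_DI m (A B : set T) : measurable A -> measurable B ->
  m A = (m (A `\` B) + m (A `&` B))%E.
Proof. exact: measureDI. Qed.

End MeasureGeneralities.

(** * Cubes and dyadic cells *)

Section Cubes.
Context (R : realType) (n : nat).
Implicit Types (Q P : cube R n) (x y : 'rV[R]_n).

Lemma cube_eq Q P : corner Q = corner P -> side Q = side P -> Q = P.
Proof.
case: Q P => [c s s0] [c' s' s0'] /= -> ss'; move: s0'; rewrite -ss' => s0'.
by rewrite (bool_irrelevance s0 s0').
Qed.

Lemma dil2_corner k Q i :
  corner (dil2 k Q) 0 i = corner Q 0 i + (1 - 2 ^+ k) / 2 * side Q.
Proof. by rewrite /= !mxE. Qed.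

Lemma dil2_dil2 k j Q : dil2 k (dil2 j Q) = dil2 (k + j) Q.
Proof.
apply: cube_eq => /=; last by rewrite exprD mulrA.
by apply/rowP => i; rewrite !mxE exprD; field.
Qed.

Lemma cubeset_sub Q P :
  (forall i, corner P 0 i <= corner Q 0 i) ->
  (forall i, corner Q 0 i + side Q <= corner P 0 i + side P) ->
  cubeset Q `<=` cubeset P.
Proof.
move=> h1 h2 x Qx i; have [a b] := Qx i.
by split; [exact: le_trans (h1 i) a|exact: lt_le_trans b (h2 i)].
Qed.

Lemma measurable_cubeset Q : measurable (cubeset Q).
Proof.
have -> : cubeset Q = \bigcap_(i in [set: 'I_n])
    ([set x : 'rV[R]_n | corner Q 0 i <= x 0 i] `&`
     ~` [set x : 'rV[R]_n | corner Q 0 i + side Q <= x 0 i]).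
  apply/seteqP; split => x.
    move=> Qx i _; have [a b] := Qx i; split => //= ab.
    by move: b; rewrite ltNge ab.
  by move=> h i; have [a /= /negP b] := h i I; split=> //; rewrite ltNge.
have mc (c : R) (i : 'I_n) :
    measurable ([set x : 'rV[R]_n | c <= x 0 i] : set (RnB R n)).
  rewrite -[X in measurable X]setCK; apply: measurableC.
  apply: sub_sigma_algebra; rewrite (_ : ~` _ = (fun x : 'rV[R]_n => x 0 i) @^-1` [set y | y < c]).
    by apply: open_comp => [x _|]; [exact: coord_continuous|exact: open_lt].
  by apply/seteqP; split => x /=; rewrite ltNge => /negP.
by apply: fin_bigcap_measurable => // i _; apply: measurableI => //; exact: measurableC.
Qed.

Definition tri Q : cube R n :=
  @Cube R n (corner Q - const_mx (side Q)) (3 * side Q)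
    (mulr_gt0 (ltr0n _ 3) (side_gt0 Q)).

Lemma tri_corner Q i : corner (tri Q) 0 i = corner Q 0 i - side Q.
Proof. by rewrite /= !mxE. Qed.

(** The grid generated by [Q] fills the whole space, [k] being any integer vector: the cubes 2P and
    3P of cells [P] of [Q] stick out of [Q]. *)
Definition dcell Q (d : nat) (k : 'rV[int]_n) : cube R n :=
  @Cube R n (corner Q + \row_i (side Q / 2 ^+ d * (k 0 i)%:~R)) (side Q / 2 ^+ d)
    (divr_gt0 (side_gt0 Q) (exprn_gt0 d (ltr0n _ 2))).

Lemma dcell_corner Q d k i :
  corner (dcell Q d k) 0 i = corner Q 0 i + side Q / 2 ^+ d * (k 0 i)%:~R.
Proof. by rewrite /= !mxE. Qed.

(** With indices of cells in place of cells, nesting and disjointness become equations between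
    integer vectors. *)
Definition didx Q (d : nat) x : 'rV[int]_n :=
  \row_i Num.floor ((x 0 i - corner Q 0 i) / (side Q / 2 ^+ d)).

Lemma dcellP Q d k x : cubeset (dcell Q d k) x <-> didx Q d x = k.
Proof.
have s0 : 0 < side Q / 2 ^+ d by exact: side_gt0 (dcell Q d k).
split=> [Dx|<- i].
  apply/rowP => i; rewrite mxE; apply: floor_def.
  have [] := Dx i; rewrite dcell_corner /= => a b.
  by rewrite ler_pdivlMr// ltr_pdivrMr// intrD; apply/andP; split; nra.
rewrite dcell_corner mxE /=.
have := floor_itv ((x 0 i - corner Q 0 i) / (side Q / 2 ^+ d)).
rewrite ler_pdivlMr// ltr_pdivrMr// intrD => /andP[a b].
by split; nra.
Qed.

Lemma dcell_self Q d x : cubeset (dcell Q d (didx Q d x)) x.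
Proof. exact/dcellP. Qed.

Lemma didx_S Q d x y : didx Q d.+1 x = didx Q d.+1 y -> didx Q d x = didx Q d y.
Proof.
move=> /rowP h; apply/rowP => i; move: (h i); rewrite !mxE.
have s0 : 0 < side Q by exact: side_gt0.
have E (z : R) : z / (side Q / 2 ^+ d.+1) = 2 * (z / (side Q / 2 ^+ d)).
  by rewrite exprS; field; rewrite gt_eqF//= gt_eqF// exprn_gt0.
rewrite !E; set a := (x 0 i - _) / _; set b := (y 0 i - _) / _ => ab.
(* [floor (2u)] determines [floor u], because [2 * floor u <= floor (2u) = floor (2v) <= 2v]. *)
have aux (u v : R) : Num.floor (2 * u) = Num.floor (2 * v) ->
    Num.floor u <= Num.floor v.
  move=> uv; rewrite floor_ge_int.
  have := floor_le u => h1.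
  have : (2 * Num.floor u <= Num.floor (2 * u)).
    by rewrite floor_ge_int intrM; lra.
  by rewrite uv floor_ge_int intrM; lra.
by apply/eqP; rewrite eq_le !aux.
Qed.

Lemma didx_le Q d e x y : (d <= e)%N ->
  didx Q e x = didx Q e y -> didx Q d x = didx Q d y.
Proof.
move=> /subnKC <-; elim: (e - d)%N => [|k IH]; first by rewrite addn0.
by rewrite addnS => /didx_S.
Qed.

Lemma dcell_nest Q d e x y : (d <= e)%N -> cubeset (dcell Q e (didx Q e x)) y ->
  didx Q d y = didx Q d x.
Proof. by move=> de /dcellP /(didx_le de). Qed.

Lemma dcell_subset Q d e x : (d <= e)%N ->
  cubeset (dcell Q e (didx Q e x)) `<=` cubeset (dcell Q d (didx Q d x)).
Proof. by move=> de y /(dcell_nest de) /dcellP. Qed.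

Lemma dcell0 Q : dcell Q 0 0 = Q.
Proof.
apply: cube_eq => /=; last by rewrite expr0 divr1.
by apply/rowP => i; rewrite !mxE mulr0 addr0.
Qed.

Lemma didx0P Q x : cubeset Q x <-> didx Q 0 x = 0.
Proof. by rewrite -[in cubeset Q](dcell0 Q); exact: dcellP. Qed.

Definition nbr (k k' : 'rV[int]_n) := forall i, `|k 0 i - k' 0 i| <= 1.

(** The triple of a cell is the exact union of its neighbours, with no boundary to discard, because
    cubes are half-open. *)
Lemma triP Q d k x : cubeset (tri (dcell Q d k)) x <-> nbr (didx Q d x) k.
Proof.
have s0 : 0 < side Q / 2 ^+ d by exact: side_gt0 (dcell Q d k).
have := dcell_self Q d x.
set j := didx Q d x => jx; split=> [tx|jk] i.
  have [] := jx i; have [] := tx i; rewrite tri_corner !dcell_corner /= => a b a' b'.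
  have h1 : (k 0 i)%:~R - 1 < (j 0 i)%:~R + 1 :> R by nra.
  have h2 : (j 0 i)%:~R < (k 0 i)%:~R + 2 :> R by nra.
  rewrite -[1]/(1%:~R) -[2]/(2%:~R) -?intrD -?intrB !ltr_int in h1 h2.
  by rewrite ler_norml; lia.
have [] := jx i; rewrite tri_corner !dcell_corner /= => a b.
have := jk i; rewrite ler_norml => /andP[h1 h2].
have {}h1 : (k 0 i)%:~R - 1 <= (j 0 i)%:~R :> R.
  by rewrite -[1]/(1%:~R) -intrB ler_int; lia.
have {}h2 : (j 0 i)%:~R <= (k 0 i)%:~R + 1 :> R.
  by rewrite -[1]/(1%:~R) -intrD ler_int; lia.
by split; nra.
Qed.

Lemma nbr_sym k k' : nbr k k' -> nbr k' k.
Proof. by move=> h i; rewrite distrC. Qed.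

Lemma nbr_refl k : nbr k k.
Proof. by move=> i; rewrite subrr normr0. Qed.

(** A strictly finer neighbour of a subcell of [P] sticks out of [P] by at most half the side of
    [P], which is the margin of [2P]. *)
Lemma nbr_dil2 Q d e (k : 'rV[int]_n) j j' : (d < e)%N -> nbr j j' ->
  cubeset (dcell Q e j') `<=` cubeset (dcell Q d k) ->
  cubeset (dcell Q e j) `<=` cubeset (dil2 1 (dcell Q d k)).
Proof.
move=> de jj' sub y jy i.
have se0 : 0 < side Q / 2 ^+ e by exact: side_gt0 (dcell Q e k).
(* A translation by [j' - j] cells carries [y] into the neighbour that lies inside the coarse
   cell. *)
pose x : 'rV[R]_n := y + \row_i (side Q / 2 ^+ e * (j' 0 i - j 0 i)%:~R).
have /sub /(_ i) : cubeset (dcell Q e j') x.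
  move=> l; have [] := jy l; rewrite !dcell_corner /x !mxE /= intrB => a b.
  by split; nra.
rewrite dil2_corner !dcell_corner /x !mxE /= => -[a b].
have h : 2 * (side Q / 2 ^+ e) <= side Q / 2 ^+ d.
  rewrite -(subnKC de) exprD exprS mulrA.
  have -> : 2 * side Q / (2 * 2 ^+ d * 2 ^+ (e - d.+1)) =
     side Q / 2 ^+ d / 2 ^+ (e - d.+1) :> R.
    by field; rewrite !gt_eqF ?exprn_gt0.
  rewrite ler_pdivrMr ?exprn_gt0// ler_peMr//; first by rewrite divr_ge0// ltW// side_gt0.
  by rewrite exprn_ege1// ler1n.
have := jj' i; rewrite ler_norml => /andP[h1 h2].
have h1' : -1 <= (j' 0 i - j 0 i)%:~R :> R.
  by rewrite (_ : -1 = (-1)%:~R :> R) ?ler_int; [lia|].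
have h2' : (j' 0 i - j 0 i)%:~R <= 1 :> R.
  by rewrite -[1]/(1%:~R) ler_int; lia.
rewrite expr1; split; nra.
Qed.

Lemma dcell_disj Q d (S : set 'rV[int]_n) :
  trivIset S (fun k => cubeset (dcell Q d k)).
Proof. by move=> k k' _ _ [x [/dcellP <- /dcellP <-]]. Qed.

(** The topology generated by the cells of [Q]. Sets defined by dyadic stopping conditions are open
    in it, hence countable unions of cells, and points of an open set need no density theorem. *)
Definition dopen Q (U : set 'rV[R]_n) :=
  forall x, U x -> exists d, cubeset (dcell Q d (didx Q d x)) `<=` U.

Definition cells Q (p : nat * 'rV[int]_n) := cubeset (dcell Q p.1 p.2).

Lemma measurable_cells Q p : measurable (cells Q p : set (RnB R n)).
Proof. exact: measurable_cubeset. Qed.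

Lemma countable_bigcup_measurable (I : countType) (S : set I)
    (F : I -> set (RnB R n)) :
  (forall i, S i -> measurable (F i)) -> measurable (\bigcup_(i in S) F i).
Proof.
move=> mF; pose H k := if pickle_inv k is Some i then
              (if `[< S i >] then F i else set0) else set0.
have -> : \bigcup_(i in S) F i = \bigcup_k H k.
  apply/seteqP; split => x.
    by move=> [i Si Fx]; exists (pickle i) => //; rewrite /H pickleK_inv asboolT.
  move=> [k _]; rewrite /H; case: pickle_inv => // i; case: asboolP => // Si Fx.
  by exists i.
apply: bigcupT_measurable => k; rewrite /H.
by case: pickle_inv => // i; case: asboolP => // /mF.
Qed.

Lemma dopen_measurable Q U : dopen Q U -> measurable (U : set (RnB R n)).
Proof.
move=> oU.
have -> : U = \bigcup_(p in [set p | cells Q p `<=` U]) cells Q p.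
  apply/seteqP; split => x; last by move=> [p /= pU /pU].
  move=> /oU[d dU]; exists (d, didx Q d x) => //=.
  exact: dcell_self.
by apply: countable_bigcup_measurable => p _; exact: measurable_cells.
Qed.

Lemma dopen_cell Q d k : dopen Q (cubeset (dcell Q d k)).
Proof. by move=> x /dcellP <-; exists d. Qed.

Lemma dopen_cellC Q d k : dopen Q (~` cubeset (dcell Q d k)).
Proof.
move=> x /= nx; exists d => y /dcellP yx /dcellP yk; apply: nx.
by apply/dcellP; rewrite -yx.
Qed.

Lemma dopen_bigcup Q (I : Type) (S : set I) (F : I -> set 'rV[R]_n) :
  (forall i, S i -> dopen Q (F i)) -> dopen Q (\bigcup_(i in S) F i).
Proof.
move=> oF x [i Si Fx]; have [d dF] := oF i Si x Fx.
by exists d => y /dF Fy; exists i.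
Qed.

Lemma dopenI Q U V : dopen Q U -> dopen Q V -> dopen Q (U `&` V).
Proof.
move=> oU oV x [Ux Vx]; have [d dU] := oU _ Ux; have [e eV] := oV _ Vx.
exists (maxn d e) => y yx; split; [apply: dU|apply: eV].
  by apply: dcell_subset yx; exact: leq_maxl.
by apply: dcell_subset yx; exact: leq_maxr.
Qed.

Section MaximalCells.
Variables (Q : cube R n) (d0 : nat) (p : nat -> 'rV[int]_n -> Prop).

(** The ancestors of a cell are reached through its points: [didx Q e x] with [e < dk.1] is the same
    for every [x] in the cell. *)
Definition maxcells : set (nat * 'rV[int]_n) :=
  [set dk | [/\ (d0 <= dk.1)%N, p dk.1 dk.2 &
    forall x, cells Q dk x -> forall e, (d0 <= e < dk.1)%N -> ~ p e (didx Q e x)]].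

Lemma maxcells_triv : trivIset maxcells (cells Q).
Proof.
move=> [d k] [e j] [/= d0d pd hd] [/= d0e pe he] [x [/= xd xe]].
have xd' := xd; have xe' := xe.
move: xd xe => /dcellP /= xd /dcellP /= xe.
case: (ltngtP d e) => de.
- by case: (he x _ d) => //; rewrite ?d0d ?de ?xd.
- by case: (hd x _ e) => //; rewrite ?d0e ?de ?xe.
by subst e; rewrite -xd -xe.
Qed.

Lemma maxcells_cover d x : (d0 <= d)%N -> p d (didx Q d x) ->
  exists2 e, (d0 <= e <= d)%N & maxcells (e, didx Q e x).
Proof.
move=> d0d pd.
pose b e := (d0 <= e)%N && `[< p e (didx Q e x) >].
have ex : exists e, b e by exists d; rewrite /b d0d asboolT.
case: (ex_minnP ex) => e /andP[d0e /asboolP pe] emin.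
exists e; first by rewrite d0e; apply: emin; rewrite /b d0d asboolT.
split => //= y yx f /andP[d0f fe] pf.
have /emin : b f; last by rewrite leqNgt fe.
rewrite /b d0f asboolT//; move: pf; rewrite (_ : didx Q f y = didx Q f x)//.
by apply: dcell_nest yx; exact: ltnW.
Qed.

End MaximalCells.
End Cubes.

(** * Volumes of cells, doubling, and the A_infinity condition on cells *)

Section CubeMeasure.
Context (R : realType) (n : nat) (mu : {measure set (RnB R n) -> \bar R}).
Hypothesis hmu : lebesgue_on_cubes mu.
Hypothesis n0 : (0 < n)%N.
Implicit Types (Q P : cube R n).

Lemma mu_cell Q d k : mu (cells Q (d, k)) = ((side Q / 2 ^+ d) ^+ n)%:E.
Proof. exact: (hmu (dcell Q d k)). Qed.

Lemma mu_cube_gt0 Q : (0 < mu (cubeset Q))%E.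
Proof. by rewrite hmu lte_fin exprn_gt0// side_gt0. Qed.

Lemma mu_cell_pred Q d j k :
  mu (cells Q (d, j)) = ((2 ^+ n)%:E * mu (cells Q (d.+1, k)))%E.
Proof.
rewrite !mu_cell -EFinM -exprMn; congr (_ ^+ n)%:E.
by rewrite exprS; field; rewrite gt_eqF// exprn_gt0.
Qed.

Lemma mu_tri Q : mu (cubeset (tri Q)) = ((3 ^+ n)%:E * mu (cubeset Q))%E.
Proof. by rewrite !hmu /= exprMn EFinM. Qed.

Lemma cell_nonempty Q p : exists x, cells Q p x.
Proof.
exists (corner (dcell Q p.1 p.2)) => i; split => //.
by rewrite ltrDl; exact: side_gt0.
Qed.

Section AinftyMeasure.
Variables (nu : {measure set (RnB R n) -> \bar R}) (a b : R).
Hypothesis nuoo : forall Q, (nu (cubeset Q) < +oo)%E.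
Hypotheses (a0 : 0 < a) (a1 : a < 1) (b0 : 0 <= b) (b1 : b < 1).
Hypothesis small : forall Q (E : set (RnB R n)), measurable E ->
  E `<=` cubeset Q -> (mu E <= a%:E * mu (cubeset Q))%E ->
  (nu E <= b%:E * nu (cubeset Q))%E.

Lemma nu_fin Q : nu (cubeset Q) \is a fin_num.
Proof. by rewrite ge0_fin_numE. Qed.

(** [small] is applied to the complement of [Q] in [P]; the resulting term [b * nu P] is finite and
    is absorbed on the left. *)
Lemma doubling_step Q P : cubeset Q `<=` cubeset P ->
  (1 - a) * side P ^+ n <= side Q ^+ n ->
  (nu (cubeset P) <= ((1 - b)^-1)%:E * nu (cubeset Q))%E.
Proof.
move=> QP sQP; have mP := measurable_cubeset P; have mQ := measurable_cubeset Q.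
have h : (nu (cubeset P `\` cubeset Q) <= b%:E * nu (cubeset P))%E.
  apply: small; [exact: measurableD|by move=> x []|].
  rewrite (measure_setD mQ mP QP) ?hmu ?ltry//.
  by rewrite -EFinB -EFinM lee_fin; lra.
rewrite lee_pdivlMl ?subr_gt0//.
move: h; rewrite (measure_setD mQ mP QP)// -(fineK (nu_fin Q)) -(fineK (nu_fin P)).
by rewrite -EFinB -!EFinM !lee_fin; lra.
Qed.

(* Enlarging a cube little by little, each step adds a proportion at most [a]
   of the volume. *)
Lemma doubling (K : R) : exists2 C : R, 1 <= C &
  forall Q P,
    (forall i, corner P 0 i <= corner Q 0 i) ->
    (forall i, corner Q 0 i + side Q <= corner P 0 i + side P) ->
    side P <= K * side Q ->
    (nu (cubeset P) <= C%:E * nu (cubeset Q))%E.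
Proof.
(* In [N] steps each relative gain of side is at most [(K - 1) / N], and [n] times this is at most
   [a]. *)
pose N := (Num.trunc (n%:R * `|K - 1| / a)).+1.
have hN : n%:R * (K - 1) <= a * N%:R.
  have h0 : 0 <= n%:R * `|K - 1| / a by rewrite divr_ge0 ?mulr_ge0// ltW.
  have /truncn_itv/andP[_ /ltW] := h0.
  rewrite ler_pdivrMr// => h; rewrite mulrC [leRHS]mulrC (le_trans _ h)// mulrC.
  by rewrite ler_wpM2l// ler_norm.
have c1 : 1 <= (1 - b)^-1 by rewrite invf_ge1 ?subr_gt0// lerBlDr lerDl.
exists (((1 - b)^-1) ^+ N); first exact: exprn_ege1.
move=> Q P h1 h2 hK.
have sQ := side_gt0 Q; have sP := side_gt0 P.
have Npos : 0 < N%:R :> R by rewrite ltr0n.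
pose t (i : nat) : R := i%:R / N%:R.
have t0 i : 0 <= t i by rewrite divr_ge0.
have tS i : t i.+1 = t i + N%:R^-1 by rewrite /t -natr1 mulrDl mul1r.
have tN : t N = 1 by rewrite /t divff// gt_eqF.
have sPQ : side Q <= side P.
  by have := h1 (Ordinal n0); have := h2 (Ordinal n0); lra.
pose s i := side Q + t i * (side P - side Q).
have s0 i : 0 < s i by rewrite ltr_wpDr// mulr_ge0// subr_ge0.
pose F i := Cube (corner Q + t i *: (corner P - corner Q)) (s0 i).
have F0 : F 0%N = Q.
  by apply: cube_eq => /=; rewrite /s /t mul0r ?scale0r ?mul0r addr0.
have FN : F N = P.
  by apply: cube_eq => /=; rewrite /s tN ?scale1r ?mul1r addrC subrK.
have step i : (nu (cubeset (F i.+1)) <= ((1 - b)^-1)%:E * nu (cubeset (F i)))%E.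
  have Nv : 0 < N%:R^-1 :> R by rewrite invr_gt0.
  apply: doubling_step.
    have aux (x y tj : R) : x <= y -> tj = t i + N%:R^-1 ->
        y + t i * (x - y) >= y + tj * (x - y).
      by move=> xy ->; nra.
    have aux' (x y tj : R) : x <= y -> tj = t i + N%:R^-1 ->
        x + t i * (y - x) <= x + tj * (y - x).
      by move=> xy ->; nra.
    apply: cubeset_sub => l; rewrite /= !mxE /s.
      exact: (aux _ _ _ (h1 l) (tS i)).
    have := aux' _ _ _ (h2 l) (tS i); lra.
  rewrite /= -[s i](mulfVK (lt0r_neq0 (s0 i.+1))) exprMn.
  rewrite ler_wpM2r ?exprn_ge0 ?(ltW (s0 _))//.
  pose x := (side P - side Q) / N%:R / s i.+1.
  have x0 : 0 <= x by rewrite !divr_ge0 ?subr_ge0// ltW.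
  have xa : n%:R * x <= a.
    rewrite /x !mulrA ler_pdivrMr// ler_pdivrMr//.
    apply: (@le_trans _ _ (n%:R * (K - 1) * side Q)).
      by rewrite -mulrA ler_wpM2l//; lra.
    apply: (@le_trans _ _ (a * N%:R * side Q)); first by rewrite ler_wpM2r// ltW.
    rewrite mulrAC ler_wpM2r// ler_wpM2l//; first exact: ltW.
    by rewrite /s ler_wpDr// mulr_ge0// subr_ge0.
  have -> : s i / s i.+1 = 1 - x.
    have -> : s i = s i.+1 - (side P - side Q) / N%:R by rewrite /s tS; ring.
    by rewrite mulrBl divff// gt_eqF.
  have x1 : x <= 1.
    apply: le_trans (ltW (le_lt_trans xa a1)).
    by rewrite ler_peMl// ler1n.
  apply: le_trans (_ : 1 - n%:R * x <= _); first by rewrite lerB.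
  (* Bernoulli's inequality [1 - n x <= (1 - x)^n]. *)
  elim: (n) => [|m IH]; first by rewrite mul0r subr0 expr0.
  rewrite exprSr -natr1.
  have y0 : 0 <= 1 - x by rewrite subr_ge0.
  have := ler_wpM2r y0 IH; apply: le_trans.
  have : 0 <= m%:R * (x * x) by rewrite mulr_ge0// mulr_ge0.
  nra.
suff H i : (nu (cubeset (F i)) <= ((1 - b)^-1 ^+ i)%:E * nu (cubeset Q))%E.
  by have := H N; rewrite FN.
elim: i => [|i IH]; first by rewrite F0 expr0 mul1e.
apply: (le_trans (step i)); rewrite exprS EFinM -muleA lee_wpmul2l// lee_fin.
by rewrite (le_trans ler01).
Qed.

(** Stopping at density [c]: the parent of a maximal cell has density at most [c], so the cell
    itself has density at most [2^n c = a] and [small] gains the factor [b] there. The union [E1] of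
    these cells exceeds [E] in measure by at most the factor [1/c], so the step can be iterated. *)
Lemma Ainfty_cell_step Q d k (E : set (RnB R n)) (c : R) :
  c = a / 2 ^+ n ->
  dopen Q E -> E `<=` cells Q (d, k) ->
  (mu E <= c%:E * mu (cells Q (d, k)))%E ->
  exists E1 : set (RnB R n), [/\ dopen Q E1, E1 `<=` cells Q (d, k),
    (nu E <= b%:E * nu E1)%E & (c%:E * mu E1 <= mu E)%E].
Proof.
move=> cE oE EP hE.
have p2 : 0 < 2 ^+ n :> R by rewrite exprn_gt0.
have c0 : 0 < c by rewrite cE divr_gt0.
have c1 : c < 1.
  by rewrite cE ltr_pdivrMr// mul1r (lt_le_trans a1)// exprn_ege1// ler1n.
have mE := dopen_measurable oE.
pose p e j := (c%:E * mu (cells Q (e, j)) < mu (E `&` cells Q (e, j)))%E.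
pose M := maxcells Q d p.
have tM : trivIset M (cells Q) := @maxcells_triv _ _ Q d p.
(* [E] is dyadically open, so small cells around its points have density 1, above [c], and no null
   set escapes the cover. *)
have EM : E `<=` \bigcup_(i in M) cells Q i.
  move=> x Ex; have [e eE] := oE _ Ex.
  have [] := @maxcells_cover _ _ Q d p (maxn d e) x (leq_maxl _ _).
    rewrite /p setIidr; last first.
      by move=> y yx; apply: eE; apply: dcell_subset yx; exact: leq_maxr.
    rewrite mu_cell -EFinM lte_fin gtr_pMl// exprn_gt0//.
    exact: (side_gt0 (dcell Q _ k)).
  by move=> f _ Mf; exists (f, didx Q f x) => //; exact: dcell_self.
have mM i : M i -> measurable (cells Q i : set (RnB R n)).
  by move=> _; exact: measurable_cells.
have mE1 : measurable (\bigcup_(i in M) cells Q i : set (RnB R n)).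
  exact: countable_bigcup_measurable.
exists (\bigcup_(i in M) cells Q i); split.
- by apply: dopen_bigcup => -[e j] _; exact: dopen_cell.
- move=> x [[e j] [/= de pej _] xej].
  have [y [Ey yej]] : E `&` cells Q (e, j) !=set0.
    apply/set0P/eqP => E0; move: pej; rewrite /p E0 measure0 ltNge mule_ge0//.
    by rewrite lee_fin ltW.
  have /dcellP yk := EP _ Ey.
  move: xej yej => /dcellP xj /dcellP yj; apply/dcellP; rewrite -yk /=.
  by apply: (didx_le de); rewrite xj yj.
- apply: local_le => // -[e j] [/= de pej hej].
  apply: small; [apply: measurableI => //; exact: measurable_cells|by move=> x []|].
  have [x xj] := cell_nonempty Q (e, j).
  (* No maximal cell has the starting generation: it would be the given cell, of density at most
     [c], or a cell disjoint from [E]. *)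
  move: de; rewrite leq_eqVlt => /orP[/eqP de|de].
    subst e; exfalso; move: pej; rewrite /p; apply/negP; rewrite -leNgt.
    have [->|jk] := eqVneq j k; first by rewrite (setIidl EP).
    rewrite (_ : _ `&` _ = set0) ?measure0 ?mule_ge0 ?lee_fin ?(ltW c0)//.
    apply/seteqP; split => // y [/EP /dcellP yk /dcellP yj].
    by move: yk yj jk => /= <- <-; rewrite eqxx.
  case: e pej hej de xj => // e pej hej de xj.
  have xx : didx Q e.+1 x = j by apply/dcellP.
  have sub : cells Q (e.+1, j) `<=` cells Q (e, didx Q e x).
    by rewrite -xx; exact: dcell_subset.
  apply: (@le_trans _ _ (mu (E `&` cells Q (e, didx Q e x)))).
    apply: measure_mono; [by apply: measurableI => //; exact: measurable_cells..|].
    by move=> y [Ey yj]; split => //; exact: sub.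
  have := hej _ xj e; rewrite -ltnS de ltnSn => /(_ isT)/negP.
  rewrite /p -leNgt => /le_trans; apply.
  rewrite (mu_cell_pred Q e _ j) muleA -EFinM cE -mulrA mulVf ?mulr1//; exact: lt0r_neq0.
(* The second measure is [mu] restricted to [E]: every maximal cell holds more than the fraction [c]
   of its volume in [E]. *)
- have h := @local_le _ _ _ mu (mrestr mu mE) _ M (cells Q) (\bigcup_(i in M) cells Q i) c^-1.
  rewrite -lee_pdivlMl//; apply: (le_trans (h _ _ _ _ _ _)) => //.
  + by rewrite invr_ge0 ltW.
  + move=> [e j] [/= de pej hej]; rewrite /mrestr/=.
    rewrite lee_pdivlMl//.
    apply: le_trans (_ : c%:E * mu (cells Q (e, j)) <= _)%E.
      rewrite lee_pmul2l//; apply: measure_mono; last by move=> x [].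
        by apply: measurableI => //; exact: measurable_cells.
      exact: measurable_cells.
    by rewrite (setIC (cells Q (e, j)) E); exact: ltW.
  + apply: lee_wpmul2l; first by rewrite lee_fin invr_ge0 ltW.
    rewrite /mrestr/=; apply: measure_mono => //; first exact: measurableI.
Qed.

(** [N] iterations gain [b^N <= eps] in [nu] and cost [c^-N] in [mu], whence [del = c^N]. Dyadically
    open sets suffice for the hot regions of the good-lambda argument. *)
Lemma Ainfty_cells (eps : R) : 0 < eps -> exists2 del : R, 0 < del &
  forall Q d k (E : set (RnB R n)), dopen Q E -> E `<=` cells Q (d, k) ->
  (mu E <= del%:E * mu (cells Q (d, k)))%E ->
  (nu E <= eps%:E * nu (cells Q (d, k)))%E.
Proof.
move=> eps0; pose c := a / 2 ^+ n.
have p2 : 0 < 2 ^+ n :> R by rewrite exprn_gt0.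
have c0 : 0 < c by rewrite /c divr_gt0.
have c1 : c < 1.
  by rewrite /c ltr_pdivrMr// mul1r (lt_le_trans a1)// exprn_ege1// ler1n.
have [N hN] : exists N : nat, b ^+ N <= eps.
  have : (fun N => b ^+ N) @ \oo --> 0 by apply: cvg_expr; rewrite ger0_norm.
  move=> /cvgrPdist_le/(_ _ eps0)[N _ /(_ N (leqnn _))].
  by rewrite sub0r normrN ger0_norm ?exprn_ge0// => h; exists N.
exists (c ^+ N); first exact: exprn_gt0.
move=> Q d k E oE EP hE.
suff H : (nu E <= (b ^+ N)%:E * nu (cells Q (d, k)))%E.
  by apply: (le_trans H); rewrite lee_wpmul2r.
elim: N E oE EP hE {hN} => [|N IH] E oE EP hE.
  by rewrite expr0 mul1e; apply: measure_mono => //; [exact: dopen_measurable oE|exact: measurable_cells].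
have [|E1 [oE1 E1P h1 h2]] := @Ainfty_cell_step Q d k E c (erefl _) oE EP.
  apply: (le_trans hE); rewrite lee_wpmul2r// lee_fin exprS ler_piMr ?(ltW c0)//.
  by rewrite exprn_ile1 ?ltW.
apply: (le_trans h1); rewrite exprS EFinM -muleA lee_wpmul2l ?lee_fin//.
apply: IH => //; rewrite -(@lee_pmul2l _ c%:E)// muleA -EFinM -exprS.
exact: le_trans hE.
Qed.

End AinftyMeasure.
End CubeMeasure.

(** * Muckenhoupt and reverse Hoelder weights *)

Section MeasureClasses.
Context (R : realType) (n : nat) (mu nu : {measure set (RnB R n) -> \bar R}).

(** A_infinity in its qualitative form, for one pair [(a, b)]: common ground of A_1, A_p and reverse
    Hoelder weights. *)
Definition Ainfty_measure : Prop := exists a b : R, [/\ 0 < a, a < 1, 0 <= b, b < 1 &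
    forall (Q : cube R n) (E : set (RnB R n)), measurable E -> E `<=` cubeset Q ->
      (mu E <= a%:E * mu (cubeset Q))%E -> (nu E <= b%:E * nu (cubeset Q))%E].

(* Optimising over [tau] gives the self-improved comparison
   [nu E <= C' (mu E / mu Q)^(1 - 1/rho) nu Q], with [rho = (q0/q)']. *)
Definition RH_measure (q : R) (q0 : \bar R) : Prop :=
  q0 = +oo%E \/ exists r rho C : R,
  [/\ q0 = r%:E, q < r, 0 < C, (r - q) * (1 - rho) = - q &
    forall (Q : cube R n) (E : set (RnB R n)) (z tau : R), measurable E ->
      E `<=` cubeset Q -> 0 < tau -> (mu E <= z%:E * mu (cubeset Q))%E ->
      (nu E <= (tau * z + C * tau `^ (1 - rho))%:E * nu (cubeset Q))%E].

End MeasureClasses.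

Section Weights.
Context (R : realType) (n : nat) (mu : {measure set (RnB R n) -> \bar R}).
Hypothesis hmu : lebesgue_on_cubes mu.
Variable w : RnB R n -> R.
Hypothesis hw : weight mu w.
Implicit Types (Q P : cube R n).

Lemma powR_le (x y r : R) : 0 <= x -> x <= y -> 0 <= r -> x `^ r <= y `^ r.
Proof.
by move=> x0 xy r0; rewrite ge0_ler_powR ?nnegrE// (le_trans x0).
Qed.

Lemma measurable_weight : measurable_fun setT w.
Proof. by case: hw => _ []. Qed.

Lemma measurable_weightE D : measurable_fun D (EFin \o w).
Proof.
apply: measurable_funTS; apply/measurable_EFinP; exact: measurable_weight.
Qed.

Lemma wmeas_cube_fin Q : (wmeas mu w (cubeset Q) < +oo)%E.
Proof.
have [w0 [_ /(_ Q)]] := hw.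
by under eq_integral do rewrite powRr1// ger0_norm//.
Qed.

Lemma wmeas_null (E : set (RnB R n)) : measurable E -> mu E = 0%E ->
  wmeas mu w E = 0%E.
Proof.
move=> mE E0; have [w0 _] := hw; rewrite /wmeas.
rewrite (@ge0_negligible_integral _ _ _ mu E E)// ?setDv ?integral_set0//.
- exact: measurable_weightE.
- by move=> x _; rewrite lee_fin.
Qed.

Variable nu : {measure set (RnB R n) -> \bar R}.
Hypothesis nuE : forall E, nu E = wmeas mu w E.

Definition wbar Q := fine (nu (cubeset Q)) / side Q ^+ n.

Lemma wbar_ge0 Q : 0 <= wbar Q.
Proof. by rewrite divr_ge0 ?fine_ge0// exprn_ge0// ltW// side_gt0. Qed.

Lemma nu_wbar Q : nu (cubeset Q) = ((wbar Q)%:E * mu (cubeset Q))%E.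
Proof.
rewrite hmu -EFinM /wbar mulfVK ?fineK//.
  by rewrite ge0_fin_numE// nuE wmeas_cube_fin.
by rewrite gt_eqF// exprn_gt0// side_gt0.
Qed.

Lemma mu_cubeV Q : ((mu (cubeset Q))^-1 = ((side Q ^+ n)^-1)%:E)%E.
Proof. by rewrite hmu inver gt_eqF// exprn_gt0// side_gt0. Qed.

Lemma wavgE Q : wavg mu w (cubeset Q) = (wbar Q)%:E.
Proof.
rewrite /wavg -nuE nu_wbar mu_cubeV hmu -!EFinM mulrC mulfK//.
by rewrite gt_eqF// exprn_gt0// side_gt0.
Qed.

Definition wlow (t : R) : set (RnB R n) := [set x | w x < t].

Lemma measurable_wlow t : measurable (wlow t).
Proof.
rewrite (_ : wlow t = (EFin \o w) @^-1` [set` `]-oo, t%:E[]).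
  rewrite -[X in measurable X]setTI; apply: measurable_weightE => //.
  exact: emeasurable_itv.
by apply/seteqP; split => x /=; rewrite in_itv/= lte_fin.
Qed.

(** If [E] takes at most half of [Q], a quarter of [Q] lies outside [E] with [w >= c * wbar Q];
    hence the complement of [E] keeps at least the fraction [c' / 4] of the mass. *)
Lemma small_of_lower (c : R) : 0 < c ->
  (forall Q, (mu (cubeset Q `&` wlow (c * wbar Q)) <=
    (4^-1)%:E * mu (cubeset Q))%E) ->
  Ainfty_measure mu nu.
Proof.
(* Capped at 1 so that [b = 1 - c' / 4] is nonnegative. *)
move=> c0 hc; pose c' := Num.min c 1.
have c'0 : 0 < c' by rewrite lt_min c0 ltr01.
have c'1 : c' <= 1 by rewrite ge_min lexx orbT.
exists 2^-1, (1 - c' / 4); split; rewrite ?invr_gt0//; try lra.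
move=> Q E mE EQ hE.
have mQ := measurable_cubeset Q.
pose L : set (RnB R n) := cubeset Q `&` wlow (c * wbar Q).
have mL : measurable L.
  by apply: measurableI => //; exact: measurable_wlow.
pose F := (cubeset Q `\` E) `\` L.
have mD : measurable (cubeset Q `\` E : set (RnB R n)) by exact: measurableD.
have mF : measurable F by exact: measurableD.
have muoo A : measurable A -> A `<=` cubeset Q -> mu A \is a fin_num.
  move=> mA AQ; rewrite ge0_fin_numE// (le_lt_trans (measure_mono mu mA mQ AQ))//.
  by rewrite hmu ltry.
have nuoo A : measurable A -> A `<=` cubeset Q -> nu A \is a fin_num.
  move=> mA AQ; rewrite ge0_fin_numE// (le_lt_trans (measure_mono nu mA mQ AQ))//.
  by rewrite nuE wmeas_cube_fin.
have eD : mu (cubeset Q) = (mu (cubeset Q `\` E) + mu E)%E.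
  by rewrite (measureDI mu mQ mE) (setIidr EQ).
have eF : mu (cubeset Q `\` E) = (mu F + mu ((cubeset Q `\` E) `&` L))%E.
  exact: (measureDI mu mD mL).
have hL : (mu ((cubeset Q `\` E) `&` L) <= (4^-1)%:E * mu (cubeset Q))%E.
  apply: le_trans (hc Q); apply: measure_mono => //; exact: measurableI.
have hF : ((4^-1)%:E * mu (cubeset Q) <= mu F)%E.
  have fQ := muoo _ mQ (@subset_refl _ _).
  have fE := muoo _ mE EQ.
  have fF : mu F \is a fin_num by apply: muoo => // x [[]].
  have fD : mu (cubeset Q `\` E) \is a fin_num by apply: muoo => // x [].
  have fI : mu ((cubeset Q `\` E) `&` L) \is a fin_num.
    by apply: muoo => //; [exact: measurableI|move=> x [[]]].
  move: eD eF hL hE; rewrite -(fineK fQ) -(fineK fE) -(fineK fF) -(fineK fD) -(fineK fI).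
  rewrite -!EFinM -!EFinD !lee_fin => -[eD] [eF] hL hE; lra.
have hnF : ((c' * wbar Q)%:E * mu F <= nu F)%E.
  rewrite nuE /wmeas -integral_cst//; apply: ge0_le_integral => //.
  - by move=> x _; rewrite lee_fin mulr_ge0 ?wbar_ge0// ltW.
  - exact: measurable_weightE.
  - move=> x [[Qx _] nL]; rewrite lee_fin leNgt; apply/negP => h; apply: nL.
    split => //=; apply: (lt_le_trans h); rewrite ler_wpM2r ?wbar_ge0//.
    by rewrite ge_min lexx.
have hnD : (nu F <= nu (cubeset Q `\` E))%E by apply: measure_mono => // x [].
have enD : nu (cubeset Q) = (nu (cubeset Q `\` E) + nu E)%E.
  by rewrite (measureDI nu mQ mE) (setIidr EQ).
have : ((c' / 4)%:E * nu (cubeset Q) <= nu (cubeset Q `\` E))%E.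
  apply: le_trans (le_trans hnF hnD).
  rewrite nu_wbar muleA -EFinM (_ : c' / 4 * wbar Q = c' * wbar Q * 4^-1); last by ring.
  by rewrite EFinM -muleA lee_wpmul2l// lee_fin mulr_ge0 ?wbar_ge0// ltW.
have fQ := nuoo _ mQ (@subset_refl _ _).
have fE := nuoo _ mE EQ.
have fD : nu (cubeset Q `\` E) \is a fin_num by apply: nuoo => // x [].
move: enD; rewrite -(fineK fQ) -(fineK fE) -(fineK fD) -!EFinM -EFinD => -[e].
by rewrite !lee_fin; lra.
Qed.

(** With [c = 1 / (2 C')] the level [c * wbar Q] lies strictly below the essential infimum, so the
    set in question is null; if [wbar Q = 0] it is empty. *)
Lemma lower_A1 : A1 mu w -> exists2 c : R, 0 < c &
  (forall Q, (mu (cubeset Q `&` wlow (c * wbar Q)) <=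
    (4^-1)%:E * mu (cubeset Q))%E).
Proof.
move=> [C hC]; pose C' := Num.max C 1.
have C'1 : 1 <= C' by rewrite le_max lexx orbT.
have C'0 : 0 < C' by exact: lt_le_trans ltr01 C'1.
have [w0 _] := hw.
exists (2 * C')^-1; first by rewrite invr_gt0 mulr_gt0.
move=> Q; have := hC Q; rewrite wavgE.
have := wbar_ge0 Q; rewrite le_eqVlt => /orP[/eqP <- _|W0].
  rewrite (_ : _ `&` _ = set0) ?measure0 ?mule_ge0//.
  by apply/seteqP; split => // x [_]; rewrite /wlow /= mulr0 ltNge w0.
set e := essinf_on _ _ _ => he.
have [y /= ey cy] : exists2 t, mu (cubeset Q `&` [set x | ((w x)%:E < t)%E]) = 0%E &
    (((2 * C')^-1 * wbar Q)%:E < t)%E.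
  apply: ereal_sup_gt; rewrite -/(essinf_on mu (cubeset Q) w) -/e.
  have e0 : (0 <= e)%E.
    apply: ereal_sup_ubound => /=; rewrite (_ : _ `&` _ = set0) ?measure0//.
    by apply/seteqP; split => // x [_ /=]; rewrite lte_fin ltNge w0.
  have : ((wbar Q)%:E <= C'%:E * e)%E.
    by apply: (le_trans he); rewrite lee_wpmul2r// lee_fin le_max lexx.
  rewrite -lee_pdivrMl//; apply: lt_le_trans.
  rewrite -EFinM lte_fin ltr_pM2r// ltf_pV2 ?posrE ?mulr_gt0//.
  by rewrite ltr_pMl// ltr1n.
have w0' x : ((0 : R)%:E <= (w x)%:E)%E by rewrite lee_fin.
rewrite (_ : mu _ = 0%E) ?mule_ge0//.
apply: subset_measure0 ey.
- apply: measurableI; first exact: measurable_cubeset.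
  exact: measurable_wlow.
- apply: measurableI; first exact: measurable_cubeset.
  rewrite (_ : [set x | _] = (EFin \o w) @^-1` [set` `]-oo, y[]).
    rewrite -[X in measurable X]setTI; apply: measurable_weightE => //.
    exact: emeasurable_itv.
  by apply/seteqP; split => x /=; rewrite in_itv/=.
- move=> x [Qx /= wx]; split => //=; apply: lt_trans cy.
  by rewrite lte_fin.
Qed.

(** Chebyshev's inequality for [w^(-s)], [s = 1/(p-1)]: the set has relative measure at most
    [(c * wbar Q)^s S], with [S] the average of [w^(-s)]. The A_p condition bounds this by
    [(c C')^s], and [c] is chosen to make it 1/4. *)
Lemma lower_Ap (p : R) : 1 < p -> Ap_gt1 mu p w -> exists2 c : R, 0 < c &
  (forall Q, (mu (cubeset Q `&` wlow (c * wbar Q)) <=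
    (4^-1)%:E * mu (cubeset Q))%E).
Proof.
move=> p1 [C hC]; pose C' := Num.max C 1.
have C'1 : 1 <= C' by rewrite le_max lexx orbT.
have C'0 : 0 < C' by exact: lt_le_trans ltr01 C'1.
have [w0 _] := hw.
have q0 : 0 < p - 1 by rewrite subr_gt0.
set s := (p - 1)^-1 in hC *.
have s0 : 0 < s by rewrite invr_gt0.
pose c := 4 `^ (- (p - 1)) / C'.
have c0 : 0 < c by rewrite divr_gt0// powR_gt0.
exists c => // Q; have mQ := measurable_cubeset Q.
have := hC Q; rewrite wavgE.
have := wbar_ge0 Q; rewrite le_eqVlt => /orP[/eqP <- _|W0].
  rewrite (_ : _ `&` _ = set0) ?measure0 ?mule_ge0//.
  by apply/seteqP; split => // x [_]; rewrite /wlow /= mulr0 ltNge w0.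
set S := (_ * \int[mu]_(x in _) _)%E => hS.
have msig : measurable_fun setT (wpowneg w s).
  rewrite /wpowneg (_ : (fun x => _) =
      (fun x => if 0 < w x then (w x `^ (- s))%:E else +oo%E)); last first.
    by apply/funext => x; rewrite lt0r w0 andbT; case: eqP.
  apply: measurable_fun_ifT => //.
    by apply: measurable_fun_ltr => //; exact: measurable_weight.
  apply/measurable_EFinP; exact: (measurableT_comp (measurable_powR _) measurable_weight).
have sig0 x : (0 <= wpowneg w s x)%E.
  by rewrite /wpowneg; case: ifP => // _; rewrite lee_fin powR_ge0.
have S0 : (0 <= S)%E.
  by rewrite /S mu_cubeV mule_ge0 ?integral_ge0// lee_fin invr_ge0 exprn_ge0// ltW// side_gt0.
(* [wbar Q > 0], so an infinite [S] would make the A_p product infinite. *)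
have Sfin : S \is a fin_num.
  rewrite ge0_fin_numE//; apply: (@lty_poweRy _ _ (p - 1)); first by rewrite gt_eqF.
  rewrite ltey; apply/eqP => Sy; move: hS; rewrite Sy gt0_muley ?lte_fin//.
set L := _ `&` _.
have mL : measurable (L : set (RnB R n)).
  by apply: measurableI => //; exact: measurable_wlow.
have h1 : (((c * wbar Q) `^ (- s))%:E * mu L <= \int[mu]_(x in cubeset Q) wpowneg w s x)%E.
  rewrite -integral_cst//.
  apply: (@le_trans _ _ (\int[mu]_(x in L) wpowneg w s x)%E).
    apply: ge0_le_integral => //.
    - by move=> x _; rewrite lee_fin powR_ge0.
    - exact: measurable_funTS.
    - move=> x [Qx /= wx]; rewrite /wpowneg; case: eqP => [_|/eqP wx0].
        by rewrite leey.
      rewrite lee_fin !powRN lef_pV2 ?posrE ?powR_gt0//; last 2 first.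
      + by rewrite mulr_gt0.
      + by rewrite lt0r wx0 w0.
      by rewrite powR_le ?(ltW wx)// ltW.
  apply: ge0_subset_integral => //; first exact: measurable_funTS.
  by move=> x [].
have sQ : 0 < side Q ^+ n by rewrite exprn_gt0// side_gt0.
have eS : (\int[mu]_(x in cubeset Q) wpowneg w s x)%E = (S * mu (cubeset Q))%E.
  by rewrite /S mu_cubeV muleC muleA hmu -EFinM divff ?mul1e// gt_eqF.
move: h1; rewrite eS powRN => h1.
have cW0 : 0 < (c * wbar Q) `^ s by rewrite powR_gt0// mulr_gt0.
have h2 : (mu L <= ((c * wbar Q) `^ s)%:E * (S * mu (cubeset Q)))%E.
  by rewrite -lee_pdivrMl.
apply: (le_trans h2); rewrite muleA lee_wpmul2r//.
move: hS S0; rewrite -(fineK Sfin); set z := fine S => hS z0.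
rewrite poweR_EFin -EFinM !lee_fin in hS z0 *.
have -> : z = (z `^ (p - 1)) `^ s by rewrite -powRrM divff ?powRr1// gt_eqF.
rewrite -powRM ?mulr_ge0 ?powR_ge0 ?(ltW c0) ?(ltW W0)//.
have -> : 4^-1 = (4 `^ (- (p - 1))) `^ s :> R.
  by rewrite -powRrM mulNr divff ?powR_inv1// gt_eqF.
apply: powR_le; [|..|exact: ltW].
  by rewrite mulr_ge0 ?powR_ge0// mulr_ge0// ltW.
rewrite -mulrA /c mulrAC ler_pdivrMr// ler_wpM2l ?powR_ge0//.
by apply: (le_trans hS); rewrite le_max lexx.
all: by rewrite invr_ge0 ltW.
Qed.

(** Integrate [w <= T + T^(1-p) w^p] over [E] at the height [T = tau * wbar Q], and use the reverse
    Hoelder inequality for the second term. The free [tau] takes the place of Hoelder's inequality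
    and keeps the bound linear in [z], hence summable over levels. *)
Lemma RH_linear (p : R) : 1 < p -> RH mu p w -> exists2 C : R, 0 < C &
  forall Q (E : set (RnB R n)) (z tau : R), measurable E -> E `<=` cubeset Q ->
    0 < tau -> (mu E <= z%:E * mu (cubeset Q))%E ->
    (nu E <= (tau * z + C * tau `^ (1 - p))%:E * nu (cubeset Q))%E.
Proof.
move=> p1 [C hC]; have p0 : 0 < p by exact: lt_trans p1.
exists (`|C| `^ p + 1); first by rewrite ltr_wpDl// powR_ge0.
move=> Q E z tau mE EQ tau0 hE; have mQ := measurable_cubeset Q.
have [w0 _] := hw.
have := wbar_ge0 Q; rewrite le_eqVlt => /orP[/eqP W0|W0].
  have : (nu E <= nu (cubeset Q))%E by exact: measure_mono.
  by rewrite nu_wbar -W0 mul0e mule0.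
have sQ : 0 < side Q ^+ n by rewrite exprn_gt0// side_gt0.
pose T := tau * wbar Q; have T0 : 0 < T by rewrite mulr_gt0.
have mwp : measurable_fun setT (fun x => w x `^ p).
  exact: (measurableT_comp (measurable_powR _) measurable_weight).
have mwpE D : measurable_fun D (fun x => (w x `^ p)%:E).
  by apply: measurable_funTS; apply/measurable_EFinP.
have Ip : (\int[mu]_(x in cubeset Q) (w x `^ p)%:E <=
    (`|C| `^ p * wbar Q `^ p)%:E * mu (cubeset Q))%E.
  have := hC Q; rewrite wavgE /normavg /pavg.
  under eq_integral do rewrite ger0_norm//.
  set I := (\int[mu]_(x in _) _)%E.
  have I0 : (0 <= I)%E by apply: integral_ge0 => x _; rewrite lee_fin powR_ge0.
  rewrite mu_cubeV -EFinM => h.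
  have h1 : (((side Q ^+ n)^-1)%:E * I <= ((C * wbar Q) `^ p)%:E)%E.
    have iI : (0 <= ((side Q ^+ n)^-1)%:E * I)%E by rewrite mule_ge0// lee_fin invr_ge0 ltW.
    have CW : 0 <= C * wbar Q by rewrite -lee_fin (le_trans _ h)// poweR_ge0.
    rewrite -poweR_EFin -[leLHS]poweRe1// -(mulVf (lt0r_neq0 p0)) poweRrM.
    by apply: gt0_ler_poweR; rewrite ?(ltW p0)// in_itv/= leey ?poweR_ge0 ?lee_fin ?CW.
  rewrite hmu -lee_pdivrMr// muleC (le_trans h1)// lee_fin.
  rewrite -powRM ?wbar_ge0// powR_le ?(ltW p0)//.
    by rewrite -lee_fin (le_trans _ h)// poweR_ge0.
  by rewrite ler_wpM2r ?wbar_ge0// ler_norm.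
have pw x : w x <= T + T `^ (1 - p) * w x `^ p.
  have [wT|Tw] := leP (w x) T; first by rewrite ler_wpDr// mulr_ge0 ?powR_ge0.
  rewrite ler_wpDl ?(ltW T0)//.
  have wx0 := lt_trans T0 Tw.
  have -> : 1 - p = - (p - 1) by ring.
  rewrite powRN mulrC ler_pdivlMr ?powR_gt0//.
  rewrite -[leRHS]mulr_powRB1// ler_wpM2l// powR_le ?(ltW T0) ?(ltW Tw)//.
  by rewrite subr_ge0 ltW.
have : (nu E <= T%:E * mu E + (T `^ (1 - p))%:E * \int[mu]_(x in E) (w x `^ p)%:E)%E.
  rewrite nuE /wmeas -integral_cst// -ge0_integralZl_EFin ?powR_ge0//; last first.
    by move=> x _; rewrite lee_fin powR_ge0.
  rewrite -ge0_integralD//; last first.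
  - by apply: measurable_funeM.
  - by move=> x _; rewrite -EFinM lee_fin mulr_ge0 ?powR_ge0.
  - by move=> x _; rewrite lee_fin ltW.
  apply: ge0_le_integral => //.
  - by move=> x _; rewrite lee_fin.
  - exact: measurable_weightE.
  - by apply: emeasurable_funD => //; exact: measurable_funeM.
  - by move=> x _; rewrite -EFinM -EFinD lee_fin.
move=> /le_trans; apply.
apply: (@le_trans _ _ ((T * z)%:E * mu (cubeset Q) +
    (T `^ (1 - p) * (`|C| `^ p * wbar Q `^ p))%:E * mu (cubeset Q))%E).
  apply: leeD.
    by rewrite (EFinM T z) -muleA lee_wpmul2l// lee_fin ltW.
  rewrite EFinM -muleA lee_wpmul2l ?lee_fin ?powR_ge0//.
  apply: le_trans Ip; apply: ge0_subset_integral => // x _.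
  by rewrite lee_fin powR_ge0.
rewrite nu_wbar hmu -!EFinM -EFinD lee_fin -mulrDl [leRHS]mulrA ler_wpM2r//; first exact: ltW.
rewrite mulrDl /T; apply: lerD; first by rewrite mulrAC.
rewrite powRM ?(ltW tau0) ?(ltW W0)// mulrACA.
have -> : wbar Q `^ (1 - p) * wbar Q `^ p = wbar Q.
  by rewrite -powRD ?subrK ?powRr1 ?ltW// gt_eqF ?implybT.
rewrite ler_wpM2r ?(ltW W0)// mulrC ler_wpM2r ?powR_ge0//.
by rewrite lerDl.
Qed.

End Weights.

(** * Differentiation along dyadic cells *)

Section DyadicDifferentiation.
Context (R : realType) (n : nat) (mu : {measure set (RnB R n) -> \bar R}).
Hypothesis hmu : lebesgue_on_cubes mu.
Variable Q : cube R n.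

(** Outer regularity stated symmetrically in [E] and its complement, so that complements merely swap
    [U] and [V] and the sets with this property form a sigma-algebra. *)
Definition dyadic_approx (E : set (RnB R n)) : Prop := forall eta : R, 0 < eta ->
  exists U V : set (RnB R n), [/\ dopen Q U, dopen Q V, E `&` cubeset Q `<=` U,
    cubeset Q `\` E `<=` V & (mu (U `&` V `&` cubeset Q) <= eta%:E)%E].

Lemma dopen_open (O : set 'rV[R]_n) : open O -> dopen Q O.
Proof.
move=> oO x Ox.
have : nbhs x O by exact: open_nbhs_nbhs.
move=> /nbhs_ballP[e /= e0 xeO].
have s0 := side_gt0 Q.
have [d hd] : exists d : nat, side Q / 2 ^+ d < e.
  have : (fun d => 2^-1 ^+ d : R) @ \oo --> 0.
    by apply: cvg_expr; rewrite ger0_norm ?invr_ge0// invf_lt1// ltr1n.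
  have es : 0 < e / (2 * side Q) by rewrite divr_gt0// mulr_gt0.
  move=> /cvgrPdist_le/(_ _ es)[N _ /(_ N (leqnn _))].
  rewrite sub0r normrN ger0_norm ?exprn_ge0 ?invr_ge0// => h; exists N.
  rewrite -exprVn; apply: le_lt_trans (_ : side Q * (e / (2 * side Q)) < _).
    by rewrite ler_wpM2l// ltW.
  rewrite mulrC -mulrA invfM -mulrA mulVf ?gt_eqF// mulr1 gtr_pMr//.
  by rewrite invf_lt1// ltr1n.
exists d => y Dy; apply: xeO; split => // i j; rewrite (ord1 i) /ball /= /ball_/=.
have [] := Dy j; have [] := dcell_self Q d x j.
rewrite !dcell_corner /= => a b a' b'.
by rewrite ltr_norml; apply/andP; split; lra.
Qed.

Lemma dyadic_approxC E : dyadic_approx E -> dyadic_approx (~` E).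
Proof.
move=> aE eta eta0; have [U [V [oU oV EU EV h]]] := aE _ eta0.
exists V, U; split => //.
- by move=> x [nE Qx]; apply: EV.
- by move=> x [Qx /contrapT Ex]; apply: EU.
- by rewrite (setIC V).
Qed.

Lemma dyadic_approx_cell p : dyadic_approx (cells Q p).
Proof.
move=> eta eta0; exists (cells Q p), (~` cells Q p); split.
- exact: dopen_cell.
- exact: dopen_cellC.
- by move=> x [].
- by move=> x [].
- by rewrite setICr set0I measure0 lee_fin ltW.
Qed.

Lemma dyadic_approx0 : dyadic_approx set0.
Proof.
move=> eta eta0; exists set0, setT; split => //.
- by move=> x _; exists 0%N.
- by rewrite !set0I measure0 lee_fin ltW.
Qed.

(** Only finite intersections of the [V i] are kept, to remain dyadically open. The union of the
    [U i] is therefore cut at some [N] whose remainder [F N] has measure at most [eta / 2]; the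
    individual overlaps share the other half. *)
Lemma dyadic_approx_bigcup (E : (set (RnB R n))^nat) :
  (forall i, dyadic_approx (E i)) -> dyadic_approx (\bigcup_i E i).
Proof.
move=> aE eta eta0.
have /choice[U hU] : forall i, exists U : set (RnB R n), exists V : set (RnB R n),
  [/\ dopen Q U, dopen Q V, E i `&` cubeset Q `<=` U,
    cubeset Q `\` E i `<=` V & (mu (U `&` V `&` cubeset Q) <= (eta / 2 / (2 ^ i.+1)%:R)%:E)%E].
  by move=> i; have [|U [V h]] := aE i (eta / 2 / (2 ^ i.+1)%:R);
    [rewrite !divr_gt0// ltr0n expn_gt0|exists U, V].
have {hU} /choice[V hV] := hU.
have oU i : dopen Q (U i) by have [] := hV i.
have oV i : dopen Q (V i) by have [] := hV i.
have mQ := measurable_cubeset Q.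
have mU i : measurable (U i) by exact: (dopen_measurable (oU i)).
have mV i : measurable (V i) by exact: (dopen_measurable (oV i)).
pose F N := (\bigcup_i U i `\` \bigcup_(i in [set i | (i < N)%N]) U i) `&` cubeset Q.
have mF N : measurable (F N).
  apply: measurableI => //; apply: measurableD.
    exact: bigcupT_measurable.
  by apply: bigcup_measurable.
have [N hN] : exists N, (mu (F N) <= (eta / 2)%:E)%E.
  have cF : mu \o F @ \oo --> mu (\bigcap_N F N).
    apply: nonincreasing_cvg_mu => //.
    - apply: le_lt_trans (measure_mono mu (mF 0%N) mQ _) _; first by move=> x [].
      by rewrite hmu ltry.
    - exact: bigcapT_measurable.
    - apply/nonincreasing_seqP => N; apply/subsetPset => x [[Ux nx] Qx]; split => //.
      by split => // -[i /= iN Uix]; apply: nx; exists i => //=; exact: ltnW.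
  have F0 : \bigcap_N F N = set0.
    apply/seteqP; split => // x h; have [[[i _ Ui] _] _] := h 0%N I.
    by have [[_ []]] := h i.+1 I; exists i => /=.
  move: cF; rewrite F0 measure0 => /fine_cvgP[ff].
  move=> /cvgrPdist_le /(_ (eta / 2)) []; first by rewrite divr_gt0.
  move=> N1 _ h1; have [N2 _ h2] := ff.
  exists (maxn N1 N2); have := h1 _ (leq_maxl N1 N2); have := h2 _ (leq_maxr N1 N2).
  rewrite /= sub0r normrN ger0_norm ?fine_ge0// => fN.
  by rewrite -lee_fin fineK.
exists (\bigcup_i U i), (\bigcap_(i in [set i | (i < N)%N]) V i); split.
- by apply: dopen_bigcup => i _.
- elim: N {hN} => [|N IH]; first by move=> x _; exists 0%N => y _ i.
  rewrite (_ : \bigcap_(i in _) V i = V N `&` \bigcap_(i in [set i | (i < N)%N]) V i).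
    exact: dopenI.
  apply/seteqP; split => x.
    by move=> h; split; [exact: (h N (ltnSn N))|move=> i /= iN; apply: h => /=; exact: ltnW].
  move=> [VN h] i /=; rewrite ltnS leq_eqVlt => /orP[/eqP->//|]; exact: h.
- by move=> x [[i _ Ei] Qx]; exists i => //; have [_ _ h _ _] := hV i; apply: h.
- move=> x [Qx nE] i _; have [_ _ _ h _] := hV i; apply: h; split => // Ei.
  by apply: nE; exists i.
- have mUV i : measurable (U i `&` V i `&` cubeset Q).
    by apply: measurableI => //; exact: measurableI.
  apply: (@le_trans _ _ (mu (F N `|` \bigcup_i (U i `&` V i `&` cubeset Q)))).
    apply: measure_mono.
    + apply: measurableI => //; apply: measurableI; first exact: bigcupT_measurable.
      by apply: bigcap_measurableType.
    + by apply: measurableU => //; exact: bigcupT_measurable.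
    + move=> x [[[i _ Ui] Vx] Qx].
      have [[j jN Uj]|nx] := pselect ((\bigcup_(i in [set i | (i < N)%N]) U i) x).
        by right; exists j => //; split => //; split => //; exact: Vx.
      by left; split => //; split => //; exists i.
  apply: (le_trans (measureU2 mu _ _)) => //; first exact: bigcupT_measurable.
  have -> : eta = eta / 2 + eta / 2 by lra.
  rewrite EFinD leeD//.
  apply: (le_trans (measure_sigma_subadditive mu mUV _ (@subset_refl _ _))).
    exact: bigcupT_measurable.
  apply: le_trans (epsilon_trick0 xpredT _); last by rewrite divr_ge0// ltW.
  by apply: lee_nneseries => // i _; have [] := hV i.
Qed.

Lemma dyadic_approx_measurable (E : set (RnB R n)) :
  measurable E -> dyadic_approx E.
Proof.
apply: smallest_sub.
  split => [|A|F aF].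
  - exact: dyadic_approx0.
  - by rewrite setTD; exact: dyadic_approxC.
  - exact: dyadic_approx_bigcup.
move=> O /dopen_open oO.
have -> : O = \bigcup_k (if pickle_inv k is Some p then
    if `[< cells Q p `<=` O >] then cells Q p else set0 else set0).
  apply/seteqP; split => x.
    move=> /oO[d dO]; exists (pickle (d, didx Q d x)) => //.
    by rewrite pickleK_inv asboolT//; exact: dcell_self.
  by move=> [k _]; case: pickle_inv => // p; case: asboolP => // pO /pO.
apply: dyadic_approx_bigcup => k; case: pickle_inv => [p|]; last exact: dyadic_approx0.
by case: asboolP => _; [exact: dyadic_approx_cell|exact: dyadic_approx0].
Qed.

(** Stands in for Lebesgue's differentiation theorem: [E] is covered by disjoint cells of total
    measure at most [mu E + eta], each meeting [E] and so subject to the hypothesis. *)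
Lemma dyadic_differentiation (m1 : {measure set (RnB R n) -> \bar R})
    (G E : set (RnB R n)) (c : R) : 0 <= c ->
  measurable E -> E `<=` G -> G `<=` cubeset Q ->
  (forall d x, G x -> (m1 (cells Q (d, didx Q d x)) <=
     c%:E * mu (cells Q (d, didx Q d x)))%E) ->
  (m1 E <= c%:E * mu E)%E.
Proof.
move=> c0 mE EG GQ h; have mQ := measurable_cubeset Q.
have EQ := subset_trans EG GQ.
have fE : mu E \is a fin_num.
  by rewrite ge0_fin_numE// (le_lt_trans (measure_mono mu mE mQ EQ))// hmu ltry.
suff H (eta : R) : 0 < eta -> (m1 E <= c%:E * (mu E + eta%:E))%E.
  apply/lee_addgt0Pr => e e0.
  have c10 : 0 < c + 1 by rewrite ltr_wpDl.
  apply: (le_trans (H (e / (c + 1)) _)); first exact: divr_gt0.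
  rewrite ge0_muleDr ?lee_fin ?divr_ge0 ?(ltW e0) ?(ltW c10)// leeD2l// lee_fin.
  rewrite mulrA ler_pdivrMr// mulrC ler_wpM2l// ?(ltW e0)//.
  by rewrite lerDl.
move=> eta0.
have [U [V [oU oV EU EV hUV]]] := dyadic_approx_measurable mE eta0.
have mU := dopen_measurable oU; have mV := dopen_measurable oV.
have {}EU : E `<=` U by move=> x Ex; apply: EU; split => //; exact: EQ.
(* Cells inside [U] keep the total measure small; meeting [E] puts them inside [Q] and makes the
   hypothesis on [m1] applicable. *)
pose p e j := cells Q (e, j) `<=` U /\ (cells Q (e, j) `&` E) !=set0.
pose M := maxcells Q 0 p.
have tM : trivIset M (cells Q) := @maxcells_triv _ _ Q 0 p.
have mM i : M i -> measurable (cells Q i : set (RnB R n)).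
  by move=> _; exact: measurable_cells.
have EM : E `<=` \bigcup_(i in M) cells Q i.
  move=> x Ex; have [d dU] := oU _ (EU _ Ex).
  have [|e _ Me] := @maxcells_cover _ _ Q 0 p d x (leq0n d).
    by split => //; exists x; split => //; exact: dcell_self.
  by exists (e, didx Q e x) => //; exact: dcell_self.
apply: (@le_trans _ _ (c%:E * mu (\bigcup_(i in M) cells Q i))%E).
  apply: local_le => // -[e j] [/= _ [_ [y [yj Ey]]] _].
  apply: (@le_trans _ _ (m1 (cells Q (e, j)))).
    apply: measure_mono; [|exact: measurable_cells|by move=> x []].
    by apply: measurableI => //; exact: measurable_cells.
  by move: yj => /dcellP /= <-; apply: h; exact: EG.
rewrite lee_wpmul2l//.
apply: (@le_trans _ _ (mu (U `&` cubeset Q))).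
  apply: measure_mono; [exact: countable_bigcup_measurable|exact: measurableI|].
  move=> x [[e j] [/= _ [jU [y [yj Ey]]] _] xj]; split; first exact: jU.
  apply/didx0P; have /didx0P <- := EQ _ Ey.
  move: xj yj => /dcellP /= xj /dcellP /= yj.
  by apply: (@didx_le _ _ _ 0 e) => //; rewrite xj yj.
have -> : U `&` cubeset Q = E `|` ((U `&` cubeset Q) `\` E).
  apply/seteqP; split => x.
    by move=> h'; have [Ex|nEx] := pselect (E x); [left|right].
  by case=> [Ex|[]//]; split; [exact: EU|exact: EQ].
have mUQ : measurable (U `&` cubeset Q : set (RnB R n)) by exact: measurableI.
apply: (le_trans (measureU2 mu mE _)); first exact: measurableD.
rewrite leeD2l// (le_trans _ hUV)//; apply: measure_mono.
- exact: measurableD.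
- by apply: measurableI => //; exact: measurableI.
- by move=> x [[Ux Qx] nE]; split => //; split => //; apply: EV.
Qed.

End DyadicDifferentiation.

(** * Nonnegative series with a varying first index *)

Section NonnegativeSeries.
Context (R : realType).
Implicit Types (f g : nat -> \bar R) (m k : nat).
Local Open Scope ereal_scope.

(** The terms are nonnegative only from index [m] on (nothing is known of [alpha 0] and [alpha 1]),
    so the others are set to zero. *)
Definition trunc_below m f : nat -> \bar R :=
  fun i => if (m <= i)%N then f i else 0.

Lemma series_trunc m f :
  \sum_(m <= k <oo) f k = \sum_(m <= k <oo) trunc_below m f k.
Proof.
congr (limn _); apply/funext => N; apply: eq_big_nat => i /andP[mi _].
by rewrite /trunc_below mi.
Qed.

Lemma trunc_ge0 m f : (forall i, (m <= i)%N -> 0 <= f i) ->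
  forall i, 0 <= trunc_below m f i.
Proof. by move=> f0 i; rewrite /trunc_below; case: ifP => // /f0. Qed.

Lemma series_ge0 m f : (forall i, (m <= i)%N -> 0 <= f i) ->
  0 <= \sum_(m <= k <oo) f k.
Proof. by move=> f0; apply: nneseries_ge0 => i mi _; exact: f0. Qed.

Lemma series_le m f g : (forall i, (m <= i)%N -> 0 <= f i) ->
  (forall i, (m <= i)%N -> f i <= g i) ->
  \sum_(m <= k <oo) f k <= \sum_(m <= k <oo) g k.
Proof.
move=> f0 fg; rewrite series_trunc [leRHS]series_trunc.
apply: lee_nneseries => i; first by move=> mi _; exact: trunc_ge0.
by move=> _; rewrite /trunc_below; case: ifP => // /fg.
Qed.

Lemma series_scale m f (c : R) : (forall i, (m <= i)%N -> 0 <= f i) ->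
  \sum_(m <= k <oo) (c%:E * f k) = c%:E * \sum_(m <= k <oo) f k.
Proof.
move=> f0; rewrite [in RHS]series_trunc -nneseriesZl; last by move=> i _; exact: trunc_ge0.
rewrite series_trunc; congr (limn _); apply/funext => N; apply: eq_big_nat => i /andP[mi _].
by rewrite /trunc_below mi.
Qed.

Lemma series_add m f g : (forall i, (m <= i)%N -> 0 <= f i) ->
  (forall i, (m <= i)%N -> 0 <= g i) ->
  \sum_(m <= k <oo) (f k + g k) = \sum_(m <= k <oo) f k + \sum_(m <= k <oo) g k.
Proof. by move=> f0 g0; apply: nneseriesD => i mi _; [exact: f0|exact: g0]. Qed.

Lemma series_shift m j f : (forall i, (m + j <= i)%N -> 0 <= f i) ->
  \sum_(m <= k <oo) f (k + j)%N = \sum_(m + j <= k <oo) f k.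
Proof.
move=> f0; rewrite series_trunc -(nneseries_addn m); last first.
  by apply: trunc_ge0 => i mi; apply: f0; rewrite leq_add2r.
rewrite [RHS]series_trunc -(nneseries_addn (m + j)); last exact: trunc_ge0.
apply: eq_eseriesr => i _.
by rewrite /trunc_below /= !leq_addl addnA.
Qed.

Lemma series_tail m j f : (m <= j)%N -> (forall i, (m <= i)%N -> 0 <= f i) ->
  \sum_(j <= k <oo) f k <= \sum_(m <= k <oo) f k.
Proof.
move=> mj f0; rewrite [leRHS](@nneseries_split _ _ m (j - m))// subnKC// leeDr//.
by rewrite big_nat; apply: sume_ge0 => i /andP[mi _]; exact: f0.
Qed.

Lemma series_term m j f : (m <= j)%N -> (forall i, (m <= i)%N -> 0 <= f i) ->
  f j <= \sum_(m <= k <oo) f k.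
Proof.
move=> mj f0; apply: (le_trans _ (series_tail mj f0)).
rewrite (@nneseries_split _ _ j 1)//; last by move=> i ji; apply: f0; exact: leq_trans ji.
rewrite addn1 big_nat1 leeDl// series_ge0// => i ji; apply: f0.
by rewrite (leq_trans mj)// ltnW.
Qed.

Lemma series_split m j f : (m <= j)%N -> (forall i, (m <= i)%N -> 0 <= f i) ->
  \sum_(m <= k <oo) f k = \sum_(m <= k < j) f k + \sum_(j <= k <oo) f k.
Proof. by move=> mj f0; rewrite (@nneseries_split _ _ m (j - m))// subnKC. Qed.

End NonnegativeSeries.

(** * Averages *)

Section Averages.
Context (R : realType) (n : nat) (mu : {measure set (RnB R n) -> \bar R}).
Hypothesis hmu : lebesgue_on_cubes mu.
Implicit Types (Q P : cube R n) (f g u : RnB R n -> R).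

Lemma powR_abs_add (r a b : R) : 0 <= r ->
  `|a + b| `^ r <= 2 `^ r * (`|a| `^ r + `|b| `^ r).
Proof.
move=> r0; have h (x y : R) : `|x| <= `|y| ->
    `|x + y| `^ r <= 2 `^ r * `|y| `^ r.
  move=> xy; rewrite -powRM//; apply: powR_le => //.
  by rewrite (le_trans (ler_normD _ _))// mulr_natl mulr2n lerD2r.
have [ab|/ltW ab] := leP `|a| `|b|.
  apply: (le_trans (h _ _ ab)); rewrite ler_wpM2l ?powR_ge0//.
  by rewrite lerDr powR_ge0.
rewrite addrC; apply: (le_trans (h _ _ ab)); rewrite ler_wpM2l ?powR_ge0//.
by rewrite lerDl powR_ge0.
Qed.

Lemma poweR_le (x y : \bar R) (r : R) : 0 <= r -> (0 <= x)%E -> (x <= y)%E ->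
  (poweR x r <= poweR y r)%E.
Proof.
move=> r0 x0 xy; have y0 := le_trans x0 xy.
by apply: gt0_ler_poweR; rewrite // in_itv/= leey ?x0 ?y0.
Qed.

Lemma measurable_powR_abs D f (r : R) : measurable_fun setT f ->
  measurable_fun D (fun x => (`|f x| `^ r)%:E).
Proof.
move=> mf; apply: measurable_funTS; apply/measurable_EFinP.
apply: (measurableT_comp (measurable_powR r)).
exact: measurableT_comp.
Qed.

Lemma normavg_ge0 (p : \bar R) Q f : (0 <= normavg mu p (cubeset Q) f)%E.
Proof.
case: p => [r||] /=; [exact: poweR_ge0| |by []].
(* The infimum runs over all extended reals; a negative [t] would be admissible only if [Q] were
   null. *)
apply/ereal_infP => t /=; case: (leP 0%E t) => // t0 h.
exfalso; move: h; rewrite (_ : _ `&` _ = cubeset Q).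
  by apply/eqP; rewrite gt_eqF// mu_cube_gt0.
apply/seteqP; split => x; first by case.
by move=> Qx; split => //=; rewrite (lt_le_trans t0).
Qed.

Lemma pavg_ge0 (r : R) Q f : (0 <= pavg mu r (cubeset Q) f)%E.
Proof.
rewrite /pavg mu_cubeV// mule_ge0//.
  by rewrite lee_fin invr_ge0 exprn_ge0// ltW// side_gt0.
by apply: integral_ge0 => x _; rewrite lee_fin powR_ge0.
Qed.

Lemma ae_measure0 f g (A : set (RnB R n)) : aeeq mu f g -> measurable A ->
  (forall x, A x -> f x <> g x) -> mu A = 0%E.
Proof.
move=> [N [mN N0 hN]] mA hA; apply: (subset_measure0 mA mN _ N0).
by move=> x /hA nfg; apply: hN.
Qed.

Lemma measurable_above f (t : \bar R) : measurable_fun setT f ->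
  measurable ([set x | (t < (`|f x|)%:E)%E] : set (RnB R n)).
Proof.
move=> mf; rewrite (_ : [set x | _] = (fun x => (`|f x|)%:E) @^-1` [set` `]t, +oo[]).
  rewrite -[X in measurable X]setTI.
  have : measurable_fun setT (fun x => (`|f x|)%:E).
    by apply/measurable_EFinP; exact: measurableT_comp.
  by apply => //; exact: emeasurable_itv.
by apply/seteqP; split => x /=; rewrite in_itv/= andbT.
Qed.

Lemma normavg_ae (p : \bar R) Q f g :
  measurable_fun setT f -> measurable_fun setT g -> aeeq mu f g ->
  normavg mu p (cubeset Q) f = normavg mu p (cubeset Q) g.
Proof.
move=> mf mg fg; have mQ := measurable_cubeset Q.
case: p => [r| |]; rewrite /normavg; last reflexivity.
  suff e : (\int[mu]_(x in cubeset Q) (`|f x| `^ r)%:E =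
      \int[mu]_(x in cubeset Q) (`|g x| `^ r)%:E)%E by rewrite /pavg e.
  have F := @measurable_powR_abs (cubeset Q) f r mf.
  have G := @measurable_powR_abs (cubeset Q) g r mg.
  apply: (ae_eq_integral _ _ mQ F G).
  by apply: filterS fg => x fgx _; rewrite fgx.
have aux f1 g1 (t : \bar R) : measurable_fun setT f1 -> measurable_fun setT g1 ->
    aeeq mu f1 g1 ->
    mu (cubeset Q `&` [set x | (t < (`|f1 x|)%:E)%E]) = 0%E ->
    mu (cubeset Q `&` [set x | (t < (`|g1 x|)%:E)%E]) = 0%E.
  move=> mf1 mg1 fg1 h0.
  have m1 := measurable_above t mf1; have m2 := measurable_above t mg1.
  have mA : measurable (cubeset Q `&` [set x | (t < (`|f1 x|)%:E)%E]) by exact: measurableI.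
  have mB : measurable (cubeset Q `&` [set x | (t < (`|g1 x|)%:E)%E]) by exact: measurableI.
  have e := measure_DI mu mB mA.
  rewrite e (_ : mu (_ `\` _) = 0%E) ?add0e.
    apply: (subset_measure0 _ mA _ h0); first exact: measurableI.
    exact: subIsetr.
  apply: (ae_measure0 fg1); first exact: measurableD.
  by move=> x [[Qx gx] nf] efg; apply: nf; split => //=; rewrite efg.
rewrite /esssup_on; congr ereal_inf; apply/seteqP; split => t /=; first exact: aux.
by apply: aux => //; apply: filterS fg => x ->.
Qed.

Lemma normavgN (p : \bar R) Q f :
  normavg mu p (cubeset Q) (fun x => - f x) = normavg mu p (cubeset Q) f.
Proof.
case: p => [r| |]; rewrite /normavg ?/pavg ?/esssup_on; last reflexivity.
  by under eq_integral do rewrite normrN.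
by congr ereal_inf; apply/funext => t /=; congr (mu (_ `&` _) = 0%E); apply/funext => x /=; rewrite normrN.
Qed.

Lemma normavg_subset (r K : R) Q P f : 1 <= r -> 1 <= K ->
  measurable_fun setT f -> cubeset Q `<=` cubeset P -> side P <= K * side Q ->
  (normavg mu r%:E (cubeset Q) f <= (K ^+ n)%:E * normavg mu r%:E (cubeset P) f)%E.
Proof.
move=> r1 K1 mf QP hK /=.
have r0 : 0 < r by exact: lt_le_trans r1.
have sQ := side_gt0 Q; have sP := side_gt0 P.
have K0 : 0 <= K by exact: le_trans K1.
apply: (@le_trans _ _ (poweR ((K ^+ n)%:E * pavg mu r (cubeset P) f) r^-1)).
  apply: gt0_ler_poweR; rewrite ?invr_ge0 ?(ltW r0)// ?in_itv/= ?leey ?andbT ?pavg_ge0//.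
    by rewrite mule_ge0 ?pavg_ge0// lee_fin exprn_ge0.
  rewrite /pavg !mu_cubeV// muleA -EFinM.
  have mI := @measurable_powR_abs (cubeset P) f r mf.
  apply: lee_pmul.
  - by rewrite lee_fin invr_ge0 exprn_ge0// ltW.
  - by apply: integral_ge0 => x _; rewrite lee_fin powR_ge0.
  - rewrite lee_fin -exprVn -exprVn -exprMn lerXn2r ?nnegrE ?mulr_ge0 ?invr_ge0 ?(ltW sQ) ?(ltW sP)//.
    by rewrite ler_pdivlMr// ler_pdivrMl// mulrC.
  - by apply: ge0_subset_integral => //; exact: measurable_cubeset.
rewrite poweRM ?pavg_ge0 ?lee_fin ?exprn_ge0// lee_wpmul2r ?poweR_ge0//.
rewrite poweR_EFin lee_fin ler1_powR ?exprn_ege1//.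
by rewrite invf_le1.
Qed.

Lemma poweR_root_add (r : R) (x y : \bar R) : 1 <= r -> (0 <= x)%E -> (0 <= y)%E ->
  (poweR (x + y) r^-1 <= 2%:E * (poweR x r^-1 + poweR y r^-1))%E.
Proof.
move=> r1; have r0 : 0 < r by exact: lt_le_trans r1.
have aux a b : (0 <= a)%E -> (0 <= b)%E -> (a <= b)%E ->
    (poweR (a + b) r^-1 <= 2%:E * poweR b r^-1)%E.
  move=> a0 b0 ab; apply: (@le_trans _ _ (poweR (2%:E * b) r^-1)).
    apply: gt0_ler_poweR; rewrite ?invr_ge0 ?(ltW r0)// ?in_itv/= ?leey ?andbT ?adde_ge0 ?mule_ge0//.
    by rewrite mule_natl mule2n leeD2r.
  rewrite poweRM// lee_wpmul2r ?poweR_ge0// poweR_EFin lee_fin ler1_powR ?ler1n//.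
  by rewrite invf_le1.
move=> x0 y0; have [xy|/ltW yx] := leP x y.
  by apply: (le_trans (aux _ _ x0 y0 xy)); rewrite lee_wpmul2l// leeDr// poweR_ge0.
rewrite addeC; apply: (le_trans (aux _ _ y0 x0 yx)).
by rewrite lee_wpmul2l// leeDl// poweR_ge0.
Qed.

Lemma pavg_add (r : R) Q f g : 0 <= r ->
  measurable_fun setT f -> measurable_fun setT g ->
  (pavg mu r (cubeset Q) (fun x => f x + g x)%R <=
   (2 `^ r)%:E * (pavg mu r (cubeset Q) f + pavg mu r (cubeset Q) g))%E.
Proof.
move=> r0 mf mg; have mQ := measurable_cubeset Q.
have mF := @measurable_powR_abs (cubeset Q) _ r mf.
have mG := @measurable_powR_abs (cubeset Q) _ r mg.
have mFG := @measurable_powR_abs (cubeset Q) _ r (measurable_funD mf mg).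
have p0 (h : RnB R n -> R) x : (0 <= (`|h x| `^ r)%:E)%E by rewrite lee_fin powR_ge0.
have m0 : (0 <= ((side Q ^+ n)^-1)%:E)%E by rewrite lee_fin invr_ge0 exprn_ge0// ltW// side_gt0.
have h : (\int[mu]_(x in cubeset Q) (`|f x + g x| `^ r)%:E <=
    (2 `^ r)%:E * (\int[mu]_(x in cubeset Q) (`|f x| `^ r)%:E +
                   \int[mu]_(x in cubeset Q) (`|g x| `^ r)%:E))%E.
  rewrite -(ge0_integralD mu mQ (fun x _ => p0 f x) mF (fun x _ => p0 g x) mG).
  have mS := emeasurable_funD mF mG.
  rewrite -(ge0_integralZl_EFin mu mQ _ mS (powR_ge0 _ _)); last first.
    by move=> x _; rewrite adde_ge0.
  apply: ge0_le_integral.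
  - exact: mQ.
  - by move=> x _; rewrite lee_fin powR_ge0.
  - exact: mFG.
  - exact: measurable_funeM.
  - by move=> x _; rewrite -EFinD -EFinM lee_fin powR_abs_add.
rewrite /pavg !mu_cubeV//.
move: h; set I := (\int[mu]_(x in _) _)%E; set I1 := (\int[mu]_(x in _) _)%E.
set I2 := (\int[mu]_(x in _) _)%E => h.
have I10 : (0 <= I1)%E by apply: integral_ge0.
have I20 : (0 <= I2)%E by apply: integral_ge0.
clearbody I I1 I2; by rewrite -ge0_muleDr// muleCA lee_wpmul2l.
Qed.

Definition exponent_ok (p : \bar R) := (1%:E <= p)%E.

Lemma normavg_add (p : \bar R) Q f g : exponent_ok p ->
  measurable_fun setT f -> measurable_fun setT g ->
  (normavg mu p (cubeset Q) (fun x => f x + g x)%R <=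
   4%:E * (normavg mu p (cubeset Q) f + normavg mu p (cubeset Q) g))%E.
Proof.
rewrite /exponent_ok; case: p => [r| |]; [rewrite /normavg|rewrite /normavg|by []]; last first.
  move=> _ mf mg.
  have f0 : (0 <= esssup_on mu (cubeset Q) f)%E by exact: (@normavg_ge0 +oo%E).
  have g0 : (0 <= esssup_on mu (cubeset Q) g)%E by exact: (@normavg_ge0 +oo%E).
  apply: (@le_trans _ _ (esssup_on mu (cubeset Q) f + esssup_on mu (cubeset Q) g)%E); last first.
    by rewrite -[leLHS]mul1e lee_wpmul2r ?adde_ge0// lee_fin ler1n.
  case ef : (esssup_on mu (cubeset Q) f) f0 => [a| |] // a0; last first.
    by rewrite addye ?leey// gt_eqF// (lt_le_trans _ g0)// ltNyr.
  case eg : (esssup_on mu (cubeset Q) g) g0 => [b| |] // b0; last first.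
    by rewrite addey// leey.
  apply/lee_addgt0Pr => e e0.
  have e2 : 0 < e / 2 by rewrite divr_gt0.
  have finf : esssup_on mu (cubeset Q) f \is a fin_num by rewrite ef.
  have [t1 /= h1 t1a'] := lb_ereal_inf_adherent e2 finf.
  have t1a : (t1 < (a + e / 2)%:E)%E by rewrite EFinD -ef.
  have fing : esssup_on mu (cubeset Q) g \is a fin_num by rewrite eg.
  have [t2 /= h2 t2b'] := lb_ereal_inf_adherent e2 fing.
  have t2b : (t2 < (b + e / 2)%:E)%E by rewrite EFinD -eg.
  apply: ereal_inf_lbound => /=.
  have mQ := measurable_cubeset Q.
  apply: (@subset_measure0 _ _ _ mu _
    ((cubeset Q `&` [set x | (t1 < (`|f x|)%:E)%E]) `|` (cubeset Q `&` [set x | (t2 < (`|g x|)%:E)%E]))).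
  - by apply: measurableI => //; apply: measurable_above; exact: measurable_funD.
  - by apply: measurableU; apply: measurableI => //; exact: measurable_above.
  - move=> x [Qx /=]; rewrite -!EFinD => h.
    have [k1|k1] := ltP t1 (`|f x|)%:E; first by left.
    have [k2|k2] := ltP t2 (`|g x|)%:E; first by right.
    move: (le_lt_trans k1 t1a) (le_lt_trans k2 t2b) h; rewrite !lte_fin => l1 l2.
    by have := ler_normD (f x) (g x); lra.
  - by apply: null_set_setU => //; apply: measurableI => //; exact: measurable_above.
rewrite lee_fin => r1 mf mg; have r0 : 0 < r by exact: lt_le_trans r1.
have := pavg_add Q (ltW r0) mf mg.
have := pavg_ge0 r Q (fun x => f x + g x); have := pavg_ge0 r Q f; have := pavg_ge0 r Q g.
move: (pavg _ _ _ _) (pavg _ _ _ _) (pavg _ _ _ _) => C A B B0 A0 C0 CAB.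
have AB0 : (0 <= A + B)%E by exact: adde_ge0.
have two0 : (0 <= (2 `^ r)%:E)%E by rewrite lee_fin powR_ge0.
apply: (@le_trans _ _ (poweR ((2 `^ r)%:E * (A + B)) r^-1)).
  apply: gt0_ler_poweR; rewrite ?invr_ge0 ?(ltW r0)// ?in_itv/= ?leey ?andbT//.
  exact: mule_ge0.
rewrite poweRM// poweR_EFin -powRrM divff ?gt_eqF// powRr1//.
rewrite (_ : 4%:E = 2%:E * 2%:E)%E; last by rewrite -EFinM; congr EFin; ring.
rewrite -muleA lee_wpmul2l//; exact: poweR_root_add.
Qed.

(* Jensen's inequality up to a factor 2, which only needs [y^p <= 1 + y^r]. *)
Lemma normavg_le_exponent (p : R) (q : \bar R) Q f (l : R) :
  1 <= p -> (p%:E <= q)%E -> measurable_fun setT f -> 0 < l ->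
  (normavg mu q (cubeset Q) f <= l%:E)%E ->
  (normavg mu p%:E (cubeset Q) f <= (2 * l)%:E)%E.
Proof.
move=> p1 pq mf l0.
have p0 : 0 < p by exact: lt_le_trans p1.
have mQ := measurable_cubeset Q.
have sQ : 0 < side Q ^+ n by rewrite exprn_gt0// side_gt0.
suff H : (normavg mu q (cubeset Q) f <= l%:E)%E ->
    (\int[mu]_(x in cubeset Q) (`|f x| `^ p)%:E <= ((2 * l) `^ p)%:E * mu (cubeset Q))%E.
  move=> /H h; rewrite /normavg.
  have -> : (2 * l)%:E = poweR ((2 * l) `^ p)%:E p^-1.
    by rewrite poweR_EFin -powRrM divff ?gt_eqF// powRr1// mulr_ge0// ltW.
  have hp : (pavg mu p (cubeset Q) f <= ((2 * l) `^ p)%:E)%E.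
    by rewrite /pavg mu_cubeV// muleC lee_pdivrMr// -hmu.
  by apply: poweR_le hp; [rewrite invr_ge0 ltW|exact: pavg_ge0].
case: q pq => [r| |]; [rewrite /normavg|rewrite /normavg|by []]; last first.
  move=> _ hl.
  have [t /= h1 tl] : exists2 t, mu (cubeset Q `&` [set x | (t < (`|f x|)%:E)%E]) = 0%E
      & (t < (2 * l)%:E)%E.
    have : (esssup_on mu (cubeset Q) f < (2 * l)%:E)%E.
      by apply: (le_lt_trans hl); rewrite lte_fin; lra.
    by move=> /ereal_inf_lt[t h1 h2]; exists t.
  pose N := cubeset Q `&` [set x | (t < (`|f x|)%:E)%E].
  have mN : measurable N by apply: measurableI => //; exact: measurable_above.
  have mFp D := @measurable_powR_abs D f p mf.
  have Fp0 D x : D x -> (0 <= (`|f x| `^ p)%:E)%E by rewrite lee_fin powR_ge0.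
  rewrite (ge0_negligible_integral mN mQ (mFp _) (Fp0 _) h1).
  apply: (@le_trans _ _ (\int[mu]_(x in cubeset Q `\` N) (cst ((2 * l) `^ p)%:E) x)%E).
    apply: ge0_le_integral.
    - exact: measurableD.
    - exact: Fp0.
    - exact: mFp.
    - exact: measurable_cst.
    - move=> x [Qx nN]; rewrite lee_fin powR_le ?(ltW p0)// leNgt; apply/negP => h.
      by apply: nN; split => //=; apply: (lt_trans tl); rewrite lte_fin.
  rewrite integral_cst; last exact: measurableD.
  rewrite lee_wpmul2l ?lee_fin ?powR_ge0//; apply: measure_mono => //; exact: measurableD.
rewrite lee_fin => pr hl; have r0 : 0 < r by exact: lt_le_trans pr.
have mF := @measurable_powR_abs (cubeset Q) _ r mf.
have h1 : (\int[mu]_(x in cubeset Q) (`|f x| `^ r)%:E <= (l `^ r)%:E * mu (cubeset Q))%E.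
  set I := (\int[mu]_(x in _) _)%E.
  have : (pavg mu r (cubeset Q) f <= (l `^ r)%:E)%E.
    have := poweR_le (ltW r0) (poweR_ge0 _ _) hl.
    by rewrite -poweRrM mulVf ?gt_eqF// poweRe1 ?pavg_ge0.
  by rewrite /pavg mu_cubeV// muleC lee_pdivrMr// -hmu.
have pt x : `|f x| `^ p <= l `^ p + l `^ p * (l `^ (- r)) * `|f x| `^ r.
  have [fl|lf] := leP `|f x| l.
    rewrite ler_wpDr ?mulr_ge0 ?powR_ge0// powR_le ?(ltW p0)//.
  rewrite ler_wpDl ?powR_ge0//.
  have y0 : 0 < `|f x| by exact: lt_trans lf.
  rewrite powRN mulrAC ler_pdivlMr ?powR_gt0//.
  have [e e0 ->] : exists2 e : R, 0 <= e & r = p + e.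
    by exists (r - p); [rewrite subr_ge0|rewrite addrC subrK].
  rewrite !powRD ?(gt_eqF l0) ?(gt_eqF y0) ?implybT//.
  rewrite mulrCA; do 2 (apply: ler_wpM2l; first exact: powR_ge0).
  exact: powR_le (ltW l0) (ltW lf) e0.
apply: (@le_trans _ _ (\int[mu]_(x in cubeset Q)
   ((l `^ p)%:E + (l `^ p * (l `^ (- r)))%:E * (`|f x| `^ r)%:E))%E).
  apply: ge0_le_integral.
  - exact: mQ.
  - by move=> x _; rewrite lee_fin powR_ge0.
  - exact: measurable_powR_abs.
  - by apply: emeasurable_funD => //; exact: measurable_funeM.
  - by move=> x _; rewrite -EFinM -EFinD lee_fin.
rewrite ge0_integralD//; last 3 first.
- by move=> x _; rewrite lee_fin powR_ge0.
- by move=> x _; rewrite -EFinM lee_fin !mulr_ge0 ?powR_ge0.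
- exact: measurable_funeM.
rewrite integral_cst// ge0_integralZl_EFin ?mulr_ge0 ?powR_ge0//.
apply: (@le_trans _ _ ((l `^ p)%:E * mu (cubeset Q) +
   (l `^ p * l `^ (- r))%:E * ((l `^ r)%:E * mu (cubeset Q)))%E).
  by rewrite leeD2l// lee_wpmul2l// lee_fin mulr_ge0 ?powR_ge0.
rewrite muleA -EFinM -mulrA -powRD ?(gt_eqF l0) ?implybT// addNr powRr0 mulr1.
rewrite hmu -!EFinM -EFinD lee_fin -mulrDl ler_wpM2r ?(ltW sQ)//.
have h2 : 2 <= 2 `^ p :> R.
  by have := @ler_powR R 2 _ _ _ p1; rewrite powRr1//; apply; exact: ler1n.
by rewrite powRM ?(ltW l0)//; have := ler_wpM2r (powR_ge0 l p) h2; lra.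
Qed.

End Averages.

(** * Operators with off-diagonal bounds *)

Section Operators.
Context (R : realType) (n : nat) (mu : {measure set (RnB R n) -> \bar R}).
Hypothesis hmu : lebesgue_on_cubes mu.
Variables (p0 : R) (q0 : \bar R) (Cp0 : R) (alpha beta : nat -> R).
Variable B : cube R n -> (RnB R n -> R) -> (RnB R n -> R).
Hypotheses (p01 : 1 <= p0) (pq : (p0%:E <= q0)%E).
Hypothesis hO : classO mu p0 q0 B Cp0 alpha beta.
Implicit Types (Q P T : cube R n) (f g u : RnB R n -> R).

Let p0_gt0 : 0 < p0. Proof. exact: lt_le_trans p01. Qed.

Let q0_ok : exponent_ok q0.
Proof. by apply: le_trans pq; rewrite lee_fin. Qed.

Lemma locLp_lin f g (c : R) : locLp mu p0 f -> locLp mu p0 g ->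
  locLp mu p0 (fun x => f x + c * g x).
Proof.
move=> [mf hf] [mg hg].
have mcg : measurable_fun setT (fun x => c * g x) by exact: measurable_funM.
split; first exact: measurable_funD.
move=> Q; have mQ := measurable_cubeset Q.
have pw (h : RnB R n -> R) x : cubeset Q x -> (0 <= (`|h x| `^ p0)%:E)%E.
  by rewrite lee_fin powR_ge0.
have mF := @measurable_powR_abs _ _ (cubeset Q) f p0 mf.
have mG := @measurable_powR_abs _ _ (cubeset Q) g p0 mg.
have mcG := measurable_funeM (`|c| `^ p0)%:E mG.
have G0 x : cubeset Q x -> (0 <= (`|c| `^ p0)%:E * (`|g x| `^ p0)%:E)%E.
  by move=> _; rewrite -EFinM lee_fin mulr_ge0 ?powR_ge0.
apply: (@le_lt_trans _ _ (\int[mu]_(x in cubeset Q)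
   ((2 `^ p0)%:E * ((`|f x| `^ p0)%:E + (`|c| `^ p0)%:E * (`|g x| `^ p0)%:E)))%E).
  apply: ge0_le_integral.
  - exact: mQ.
  - exact: (pw (fun x => f x + c * g x)).
  - by apply: measurable_powR_abs; exact: measurable_funD.
  - by apply: measurable_funeM; exact: emeasurable_funD.
  - move=> x _; rewrite -(EFinM (`|c| `^ p0)) -EFinD -EFinM lee_fin -powRM// -normrM.
    by rewrite powR_abs_add// ltW.
have S0 x : cubeset Q x ->
    (0 <= (`|f x| `^ p0)%:E + (`|c| `^ p0)%:E * (`|g x| `^ p0)%:E)%E.
  by move=> Qx; apply: adde_ge0; [exact: (pw f)|exact: G0].
rewrite (ge0_integralZl_EFin mu mQ S0 (emeasurable_funD mF mcG) (powR_ge0 _ _)).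
rewrite (ge0_integralD mu mQ (pw f) mF G0 mcG).
rewrite (ge0_integralZl_EFin mu mQ (pw g) mG (powR_ge0 _ _)).
by rewrite lte_mul_pinfty ?lee_fin ?powR_ge0// lte_add_pinfty// lte_mul_pinfty ?lee_fin ?powR_ge0.
Qed.

Lemma locLp_restr f E : measurable E -> locLp mu p0 f -> locLp mu p0 (restr f E).
Proof.
move=> mE [mf hf]; have mr : measurable_fun setT (restr f E).
  by apply: measurable_funM => //; exact: measurable_indic.
split; first exact: mr.
move=> Q; apply: le_lt_trans (hf Q); apply: ge0_le_integral.
- exact: measurable_cubeset.
- by move=> x _; rewrite lee_fin powR_ge0.
- exact: measurable_powR_abs.
- exact: measurable_powR_abs.
- move=> x _; rewrite lee_fin powR_le ?(ltW p0_gt0)// /restr normrM indicE.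
  by case: (x \in E); rewrite /= ?normr1 ?normr0 ?mulr1 ?mulr0.
Qed.

Lemma locLp_B Q f : locLp mu p0 f -> locLp mu p0 (B Q f).
Proof. by case: hO => /(_ Q)[h _] _ _ _ _; exact: h. Qed.

Lemma B_ae Q f g : locLp mu p0 f -> locLp mu p0 g -> aeeq mu f g ->
  aeeq mu (B Q f) (B Q g).
Proof. by case: hO => /(_ Q)[_ [h _]] _ _ _ _; exact: h. Qed.

Lemma B_lin Q f g c : locLp mu p0 f -> locLp mu p0 g ->
  aeeq mu (B Q (fun x => f x + c * g x)) (fun x => B Q f x + c * B Q g x).
Proof. by case: hO => /(_ Q)[_ [_ h]] _ _ _ _; exact: h. Qed.

Lemma B_comm Q P f : locLp mu p0 f -> aeeq mu (B Q (B P f)) (B P (B Q f)).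
Proof. by case: hO => _ h _ _ _; exact: h. Qed.

Lemma locLp_eq f g : f =1 g -> locLp mu p0 f -> locLp mu p0 g.
Proof. by move=> /funext ->. Qed.

Lemma locLp_add f g : locLp mu p0 f -> locLp mu p0 g ->
  locLp mu p0 (fun x => f x + g x).
Proof.
move=> hf hg; apply: locLp_eq (locLp_lin 1 hf hg) => x /=.
by rewrite mul1r.
Qed.

Lemma locLp_sub f g : locLp mu p0 f -> locLp mu p0 g ->
  locLp mu p0 (fun x => f x - g x).
Proof.
move=> hf hg; apply: locLp_eq (locLp_lin (- 1) hf hg) => x /=.
by rewrite mulN1r.
Qed.

Lemma B_add Q f g : locLp mu p0 f -> locLp mu p0 g ->
  aeeq mu (B Q (fun x => f x + g x)) (fun x => B Q f x + B Q g x).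
Proof.
move=> hf hg; have := B_lin Q 1 hf hg.
rewrite (_ : (fun x => f x + 1 * g x) = (fun x => f x + g x)); last first.
  by apply/funext => x; rewrite mul1r.
by apply: filterS => x ->; rewrite mul1r.
Qed.

Lemma B_sub Q f g : locLp mu p0 f -> locLp mu p0 g ->
  aeeq mu (B Q (fun x => f x - g x)) (fun x => B Q f x - B Q g x).
Proof.
move=> hf hg; have := B_lin Q (-1) hf hg.
rewrite (_ : (fun x => f x + -1 * g x) = (fun x => f x - g x)); last first.
  by apply/funext => x; rewrite mulN1r.
by apply: filterS => x ->; rewrite mulN1r.
Qed.

Lemma locLp_A Q f : locLp mu p0 f -> locLp mu p0 (opA B Q f).
Proof. by move=> hf; exact: (locLp_sub hf (locLp_B Q hf)). Qed.

Lemma A_add Q f g : locLp mu p0 f -> locLp mu p0 g ->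
  aeeq mu (opA B Q (fun x => f x + g x)) (fun x => opA B Q f x + opA B Q g x).
Proof.
by move=> hf hg; apply: filterS (B_add Q hf hg) => x; rewrite /opA => ->; ring.
Qed.

Local Notation avg k P u := (normavg mu p0%:E (cubeset (dil2 k P)) u).

Lemma avg_ge0 k P u : (0 <= avg k P u)%E.
Proof. exact: normavg_ge0. Qed.

Let alpha_ge0 k : (2 <= k)%N -> 0 <= alpha k.
Proof. by case: hO => _ _ _ [[h _] _] _; exact: h. Qed.

Definition alpha_sum P u := (\sum_(2 <= k <oo) ((alpha k)%:E * avg k P u))%E.

Let alpha_term_ge0 P u k : (2 <= k)%N -> (0 <= (alpha k)%:E * avg k P u)%E.
Proof. by move=> k2; rewrite mule_ge0 ?avg_ge0// lee_fin alpha_ge0. Qed.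

Lemma alpha_sum_ge0 P u : (0 <= alpha_sum P u)%E.
Proof. by apply: series_ge0 => k k2; exact: alpha_term_ge0. Qed.

Lemma restr_split u E x : u x = restr u E x + restr u (~` E) x.
Proof.
rewrite /restr !indicE in_setC; case: (x \in E); by rewrite /= ?mulr1 ?mulr0 ?addr0 ?add0r.
Qed.

Lemma A_restr_split Q u E : measurable E -> locLp mu p0 u ->
  aeeq mu (opA B Q u) (fun x => opA B Q (restr u E) x + opA B Q (restr u (~` E)) x).
Proof.
move=> mE hu.
have h := A_add Q (locLp_restr mE hu) (locLp_restr (measurableC mE) hu).
rewrite [X in opA B Q X](_ : u = (fun x => restr u E x + restr u (~` E) x)) //.
by apply/funext => x; exact: restr_split.
Qed.

Lemma normavg_A_split (r : \bar R) Q P u E : exponent_ok r ->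
  measurable E -> locLp mu p0 u ->
  (normavg mu r (cubeset Q) (opA B P u) <=
   4%:E * (normavg mu r (cubeset Q) (opA B P (restr u E)) +
           normavg mu r (cubeset Q) (opA B P (restr u (~` E)))))%E.
Proof.
move=> r1 mE hu.
have l1 := locLp_A P (locLp_restr mE hu).
have l2 := locLp_A P (locLp_restr (measurableC mE) hu).
rewrite (normavg_ae r Q (locLp_A P hu).1 (locLp_add l1 l2).1 (A_restr_split P mE hu)).
exact: (normavg_add hmu Q r1 l1.1 l2.1).
Qed.

(** Splitting [u] at [4P] merges the two clauses of (c) into one series: the local clause gives the
    term [k = 2], the far clause with [j = 1] the terms [k >= 3]. *)
Lemma normavg_A P u : locLp mu p0 u ->
  (normavg mu q0 (cubeset (dil2 1 P)) (opA B P u) <= 4%:E * alpha_sum P u)%E.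
Proof.
move=> hu; have mE := measurable_cubeset (dil2 2 P).
apply: (le_trans (normavg_A_split (dil2 1 P) P q0_ok mE hu)).
apply: lee_wpmul2l => //; rewrite /alpha_sum (@series_split _ 2 3)//; last first.
  by move=> i i2; exact: alpha_term_ge0.
have [_ _ _ [_ /(_ P u hu)[h1 h2]] _] := hO.
rewrite big_nat1; apply: leeD; first exact: h1.
apply: (le_trans (h2 1%N (leqnn _))); rewrite -(series_shift (m := 2) (j := 1))//.
  by move=> i i3; apply: alpha_term_ge0; exact: ltnW.
Qed.

Lemma normavg_exponent Q u (Y : \bar R) : measurable_fun setT u -> (0 <= Y)%E ->
  (normavg mu q0 (cubeset Q) u <= Y)%E ->
  (normavg mu p0%:E (cubeset Q) u <= 2%:E * Y)%E.
Proof.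
move=> mu_ Y0; case: Y Y0 => [y| |] // y0 h; last by rewrite gt0_muley// leey.
apply/lee_addgt0Pr => e e0; rewrite lee_fin in y0.
have l0 : 0 < y + e / 2 by rewrite ltr_wpDl// divr_gt0.
have := @normavg_le_exponent _ _ _ hmu p0 q0 Q u (y + e / 2) p01 pq mu_ l0.
rewrite -EFinM -EFinD (_ : 2 * y + e = 2 * (y + e / 2)); last by field.
by apply; apply: (le_trans h); rewrite lee_fin lerDl divr_ge0// ltW.
Qed.

Lemma normavg_abs_le (r : R) Q f g : 0 <= r -> measurable_fun setT f ->
  measurable_fun setT g -> (forall x, `|f x| <= `|g x|) ->
  (normavg mu r%:E (cubeset Q) f <= normavg mu r%:E (cubeset Q) g)%E.
Proof.
move=> r0 mf mg fg; apply: poweR_le; [by rewrite invr_ge0|exact: pavg_ge0|].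
have m0 : (0 <= ((side Q ^+ n)^-1)%:E)%E.
  by rewrite lee_fin invr_ge0 exprn_ge0// ltW// side_gt0.
rewrite /pavg (mu_cubeV hmu); apply: (lee_wpmul2l m0).
apply: ge0_le_integral.
- exact: measurable_cubeset.
- by move=> x _; rewrite lee_fin powR_ge0.
- exact: measurable_powR_abs.
- exact: measurable_powR_abs.
- by move=> x _; rewrite lee_fin powR_le.
Qed.

Lemma restr_abs_le u E x : `|restr u E x| <= `|u x|.
Proof.
by rewrite /restr normrM indicE; case: (x \in E); rewrite /= ?normr1 ?normr0 ?mulr1 ?mulr0.
Qed.

Lemma avg_succ k P u : measurable_fun setT u ->
  (avg k P u <= (2 ^+ n)%:E * avg k.+1 P u)%E.
Proof.
move=> mu_; apply: normavg_subset => //; first by rewrite ler1n.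
  apply: cubeset_sub => i; rewrite !dil2_corner /= exprS; have := side_gt0 P => s0;
  have : 0 <= 2 ^+ k * side P by rewrite mulr_ge0 ?exprn_ge0// ltW.
    by nra.
  by nra.
by rewrite /= exprS mulrA.
Qed.

(** Global boundedness (b) becomes local on truncated functions; [2^n] pays for passing from the
    average over [2^l P] to that over [2^(l+1) P]. *)
Lemma normavg_B_local l P u : locLp mu p0 u ->
  (avg l P (B P (restr u (cubeset (dil2 l.+1 P)))) <=
   (`|Cp0| * 2 ^+ n)%:E * avg l.+1 P u)%E.
Proof.
move=> hu; set S := dil2 l.+1 P; set Q := dil2 l P.
have mS := measurable_cubeset S; have mQ := measurable_cubeset Q.
have sQ : 0 < side Q ^+ n by rewrite exprn_gt0// side_gt0.
have sS : 0 < side S ^+ n by rewrite exprn_gt0// side_gt0.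
have lu := locLp_restr mS hu.
set g := B P (restr u (cubeset S)); have lg : locLp mu p0 g by exact: locLp_B.
set I := (\int[mu]_(x in cubeset S) (`|u x| `^ p0)%:E)%E.
set J := (\int[mu]_x (`|g x| `^ p0)%:E)%E.
have pw (h : RnB R n -> R) x : (0 <= (`|h x| `^ p0)%:E)%E by rewrite lee_fin powR_ge0.
have I0 : (0 <= I)%E by exact: integral_ge0.
have J0 : (0 <= J)%E by exact: integral_ge0.
have pi0 : 0 <= p0^-1 by rewrite invr_ge0 ltW.
have hJ : (poweR J p0^-1 <= `|Cp0|%:E * poweR I p0^-1)%E.
  have [_ _ h _ _] := hO; have := h P _ lu; rewrite /Lpnorm -/g -/J.
  rewrite (_ : (\int[mu]_x _)%E = I); last first.
    rewrite /I [RHS]integral_mkcond; apply: eq_integral => x _.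
    rewrite /restr patchE indicE; case: (x \in cubeset S); first by rewrite mulr1.
    by rewrite mulr0 normr0 powR0// gt_eqF.
  move=> /le_trans; apply; apply: lee_wpmul2r; first exact: poweR_ge0.
  by rewrite lee_fin ler_norm.
have hQ : (\int[mu]_(x in cubeset Q) (`|g x| `^ p0)%:E <= J)%E.
  apply: ge0_subset_integral => //; apply: measurable_powR_abs; exact: lg.1.
have i0 : (0 <= ((side Q ^+ n)^-1)%:E)%E by rewrite lee_fin invr_ge0 ltW.
have c0 : (0 <= `|Cp0|%:E)%E by rewrite lee_fin.
have hI : (poweR (((side Q ^+ n)^-1)%:E * I) p0^-1 <= (2 ^+ n)%:E * avg l.+1 P u)%E.
  have -> : (((side Q ^+ n)^-1)%:E * I = (2 ^+ n)%:E * pavg mu p0 (cubeset S) u)%E.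
    rewrite /pavg (mu_cubeV hmu) -/I muleA -EFinM; congr (_%:E * _)%E.
    rewrite /S /Q /= exprS -mulrA [X in _ / X]exprMn; field.
    by rewrite !expf_neq0// gt_eqF// mulr_gt0 ?exprn_gt0// side_gt0.
  have A0 := pavg_ge0 hmu p0 S u.
  rewrite -/S /normavg; move: (pavg mu p0 (cubeset S) u) A0 => A A0.
  rewrite poweRM ?lee_fin ?exprn_ge0//; apply: lee_wpmul2r; first exact: poweR_ge0.
  rewrite poweR_EFin lee_fin ler1_powR ?exprn_ege1 ?ler1n//.
  by rewrite invf_le1.
apply: (@le_trans _ _ (poweR (((side Q ^+ n)^-1)%:E * J) p0^-1)).
  apply: poweR_le => //; first exact: pavg_ge0.
  by rewrite /pavg mu_cubeV// lee_wpmul2l.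
rewrite (poweRM p0^-1 i0 J0); apply: (@le_trans _ _ (poweR ((side Q ^+ n)^-1)%:E p0^-1 *
   (`|Cp0|%:E * poweR I p0^-1))%E).
  by apply: lee_wpmul2l => //; exact: poweR_ge0.
move: hI; rewrite (poweRM p0^-1 i0 I0).
move: (poweR _ p0^-1) (poweR I p0^-1) (normavg _ _ _ _) => a b v hI.
rewrite muleCA EFinM -muleA; exact: (lee_wpmul2l c0 hI).
Qed.

(** Allows [A_P u] to be fed back into [normavg_A]. Near [2^l P] it rests on boundedness in L^{p0},
    away from it on (c) with [j = l]; [K] does not depend on [l]. *)
Lemma avg_A : exists2 K : R, 0 <= K & forall l P u, (1 <= l)%N -> locLp mu p0 u ->
  (avg l P (opA B P u) <= K%:E * (avg l.+1 P u + alpha_sum P u))%E.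
Proof.
pose K1 : R := 4 * (2 ^+ n + `|Cp0| * 2 ^+ n).
have K10 : 0 <= K1 by rewrite mulr_ge0// addr_ge0// ?mulr_ge0// exprn_ge0.
exists (4 * (K1 + 2)); first by rewrite mulr_ge0// addr_ge0.
move=> l P u l1 hu.
have mS := measurable_cubeset (dil2 l.+1 P).
have lu := locLp_restr mS hu.
have r1 : exponent_ok p0%:E by rewrite /exponent_ok lee_fin.
apply: (le_trans (normavg_A_split (dil2 l P) P r1 mS hu)).
rewrite EFinM -muleA; apply: lee_wpmul2l => //.
have near : (avg l P (opA B P (restr u (cubeset (dil2 l.+1 P)))) <= K1%:E * avg l.+1 P u)%E.
  apply: le_trans (normavg_add hmu (dil2 l P) r1 lu.1 (measurable_funN (locLp_B P lu).1)) _.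
  rewrite /K1 EFinM -muleA; apply: lee_wpmul2l => //.
  rewrite EFinD ge0_muleDl ?lee_fin ?mulr_ge0 ?exprn_ge0//; apply: leeD.
    apply: le_trans (avg_succ l P hu.1); apply: normavg_abs_le => //.
    - exact: ltW.
    - exact: lu.1.
    - exact: hu.1.
    - by move=> x; exact: restr_abs_le.
  rewrite (normavgN mu _ _ (B P (restr u (cubeset (dil2 l.+1 P))))).
  exact: normavg_B_local.
have far : (avg l P (opA B P (restr u (~` cubeset (dil2 l.+1 P)))) <= 2%:E * alpha_sum P u)%E.
  apply: normavg_exponent; [exact: (locLp_A P (locLp_restr (measurableC mS) hu)).1|exact: alpha_sum_ge0|].
  have [_ _ _ [_ /(_ P u hu)[_ h2]] _] := hO.
  apply: (le_trans (h2 l l1)).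
  rewrite (series_shift (m := 2) (j := l) (f := fun k => (alpha k)%:E * avg k P u)%E); last first.
    by move=> i i2; apply: alpha_term_ge0; apply: leq_trans i2; rewrite leq_addr.
  apply: series_tail; first by rewrite leq_addr.
  by move=> i; exact: alpha_term_ge0.
apply: (le_trans (leeD near far)).
rewrite ge0_muleDr ?avg_ge0 ?alpha_sum_ge0//; apply: leeD.
  by apply: lee_wpmul2r; [exact: avg_ge0|rewrite lee_fin lerDl].
by apply: lee_wpmul2r; [exact: alpha_sum_ge0|rewrite lee_fin lerDr].
Qed.

(** Coefficients for [A_P^2]: the inner [A_P] moves the average from [2^k P] to [2^(k+1) P], hence
    the extra [alpha (k-1)], which exists only from [k = 3] on. *)
Definition alpha2 (k : nat) : R := alpha k + (if (3 <= k)%N then alpha k.-1 else 0).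

Definition alpha2_sum P u := (\sum_(2 <= k <oo) ((alpha2 k)%:E * avg k P u))%E.

Lemma alpha2_ge0 k : (2 <= k)%N -> 0 <= alpha2 k.
Proof.
move=> k2; rewrite /alpha2 addr_ge0 ?alpha_ge0//; case: ifP => // k3.
by rewrite alpha_ge0//; case: k k3 {k2}.
Qed.

Let alpha2_term_ge0 P u k : (2 <= k)%N -> (0 <= (alpha2 k)%:E * avg k P u)%E.
Proof. by move=> k2; rewrite mule_ge0 ?avg_ge0// lee_fin alpha2_ge0. Qed.

Lemma alpha2_sum_ge0 P u : (0 <= alpha2_sum P u)%E.
Proof. by apply: series_ge0 => k k2; exact: alpha2_term_ge0. Qed.

Lemma alpha_sum_le P u : (alpha_sum P u <= alpha2_sum P u)%E.
Proof.
apply: series_le => k k2; first exact: alpha_term_ge0.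
apply: lee_wpmul2r; first exact: avg_ge0.
rewrite lee_fin /alpha2 lerDl; case: ifP => // k3.
by rewrite alpha_ge0//; case: k k3 {k2}.
Qed.

Lemma alpha_shift_sum_le P u :
  (\sum_(2 <= k <oo) ((alpha k)%:E * avg k.+1 P u) <= alpha2_sum P u)%E.
Proof.
apply: (@le_trans _ _ (\sum_(3 <= k <oo) ((alpha2 k)%:E * avg k P u))%E); last first.
  by apply: series_tail => // i; exact: alpha2_term_ge0.
rewrite -(series_shift (m := 2) (j := 1)); last first.
  by move=> i i3; apply: alpha2_term_ge0; exact: ltnW.
apply: series_le => k k2; first by rewrite mule_ge0 ?avg_ge0// lee_fin alpha_ge0.
rewrite addn1; apply: lee_wpmul2r; first exact: avg_ge0.
by rewrite lee_fin /alpha2 ltnS k2 /= lerDr alpha_ge0// ltnW.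
Qed.

Lemma alpha_summable : exists2 S : R, 0 <= S &
  (\sum_(2 <= k <oo) (alpha k)%:E <= S%:E)%E.
Proof.
have [_ _ _ [[_ h] _] _] := hO.
set s := (\sum_(2 <= k <oo) _)%E in h.
have term0 k : (2 <= k)%N -> (0 <= (2 `^ (k%:R * n%:R / p0) * alpha k)%:E)%E.
  by move=> k2; rewrite lee_fin mulr_ge0 ?powR_ge0 ?alpha_ge0.
have s0 : (0 <= s)%E by exact: series_ge0.
exists (fine s); first exact: fine_ge0.
rewrite fineK ?ge0_fin_numE//; apply: series_le => k k2; first by rewrite lee_fin alpha_ge0.
rewrite lee_fin ler_peMl ?alpha_ge0//.
rewrite -[leLHS](powRr0 2) ler_powR ?ler1n// divr_ge0 ?mulr_ge0//; exact: ltW.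
Qed.

Lemma normavg_AA : exists2 K : R, 0 <= K & forall P u, locLp mu p0 u ->
  (normavg mu q0 (cubeset (dil2 1 P)) (opA B P (opA B P u)) <=
   K%:E * alpha2_sum P u)%E.
Proof.
have [K K0 hK] := avg_A; have [S S0 hS] := alpha_summable.
exists (4 * (K * (1 + S))); first by rewrite mulr_ge0// mulr_ge0// addr_ge0.
move=> P u hu; apply: (le_trans (normavg_A P (locLp_A P hu))).
rewrite EFinM -muleA; apply: lee_wpmul2l => //.
apply: (@le_trans _ _ (\sum_(2 <= k <oo) (K%:E * ((alpha k)%:E * avg k.+1 P u +
     (alpha k)%:E * alpha_sum P u)))%E).
  apply: series_le => k k2; first exact: alpha_term_ge0.
  rewrite -ge0_muleDr ?avg_ge0 ?alpha_sum_ge0// muleCA.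
  by apply: lee_wpmul2l; [rewrite lee_fin alpha_ge0|apply: hK => //; exact: ltnW].
have t1 k : (2 <= k)%N -> (0 <= (alpha k)%:E * avg k.+1 P u)%E.
  by move=> k2; rewrite mule_ge0 ?avg_ge0// lee_fin alpha_ge0.
have t2 k : (2 <= k)%N -> (0 <= (alpha k)%:E * alpha_sum P u)%E.
  by move=> k2; rewrite mule_ge0 ?alpha_sum_ge0// lee_fin alpha_ge0.
rewrite series_scale; last by move=> k k2; rewrite adde_ge0 ?t1 ?t2.
rewrite series_add// EFinM -muleA; apply: lee_wpmul2l; first by rewrite lee_fin.
rewrite EFinD ge0_muleDl ?lee_fin// mul1e; apply: leeD; first exact: alpha_shift_sum_le.
have X0 := alpha_sum_ge0 P u; have XY := alpha_sum_le P u.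
apply: (@le_trans _ _ (S%:E * alpha_sum P u)%E); last by apply: lee_wpmul2l; rewrite ?lee_fin.
move: X0 XY t2; case: (alpha_sum P u) => [x| |] // x0 _ t2.
  rewrite (eq_eseriesr (g := fun k => (x%:E * (alpha k)%:E)%E)); last first.
    by move=> i _; rewrite muleC.
  rewrite (@series_scale _ 2 (fun k => (alpha k)%:E)); last first.
    by move=> i i2; rewrite lee_fin alpha_ge0.
  by rewrite [leRHS]muleC; exact: lee_wpmul2l.
(* [alpha_sum] may be infinite. The bound is then trivial for [S > 0]; for [S = 0] all coefficients
   vanish and [0 * +oo = 0] closes the case. *)
have [S00|S00] := eqVneq S 0; last first.
  by rewrite gt0_muley ?leey// lte_fin lt0r S00.
have a0 k : (2 <= k)%N -> alpha k = 0.
  move=> k2; apply/eqP; rewrite eq_le alpha_ge0// andbT -lee_fin -[X in (_ <= X%:E)%E]S00.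
  apply: le_trans hS; apply: (@series_term _ 2 k (fun k => (alpha k)%:E) k2) => i i2 /=.
  by rewrite lee_fin alpha_ge0.
rewrite S00 mul0e; apply: (@le_trans _ _ (\sum_(2 <= k <oo) (0 : \bar R))%E).
  by apply: series_le => // i i2; rewrite a0// mul0e.
by rewrite eseries0.
Qed.

(* On [2P]: [h = (2 A_P - A_P^2) h - B_P A_T (B_P f) + B_P (B_P f)], because
   [2 A - A^2 = 1 - B^2] and [B_P B_T f = B_T B_P f]. *)
Lemma local_decomposition : exists2 K : R, 0 <= K & forall P T f,
  cubeset P `<=` cubeset T -> locLp mu p0 f ->
  exists v1 v2 v3 : RnB R n -> R,
  [/\ [/\ measurable_fun setT v1, measurable_fun setT v2 & measurable_fun setT v3],
      aeeq mu (B T f) (fun x => v1 x + v2 x + v3 x),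
      (normavg mu q0 (cubeset (dil2 1 P)) v1 <= K%:E * alpha2_sum P (B T f))%E,
      (normavg mu q0 (cubeset (dil2 1 P)) v2 <=
         \sum_(1 <= k <oo) ((beta k.+1)%:E * avg k.+1 T (B P f)))%E &
      (avg 1 P v3 <= K%:E * (avg 1 P (B P f) + alpha_sum P (B P f)))%E].
Proof.
have [K K0 hK] := normavg_AA.
exists (4 * (4 + 4 * (4 + K)) + 32); first by rewrite addr_ge0 ?mulr_ge0 ?addr_ge0 ?mulr_ge0 ?addr_ge0.
move=> P T f PT hf.
set h := B T f; have lh : locLp mu p0 h by exact: locLp_B.
set g := B P f; have lg : locLp mu p0 g by exact: locLp_B.
have lA := locLp_A P lh; have lAA := locLp_A P lA.
have lAg := locLp_A T lg; have lBAg := locLp_B P lAg; have lBg := locLp_B P lg.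
exists (fun x => opA B P h x + (opA B P h x - opA B P (opA B P h) x)),
  (fun x => - B P (opA B T g) x), (B P g).
have lv1 := locLp_sub lA lAA.
split.
- split; [exact: (locLp_add lA lv1).1|exact: measurable_funN lBAg.1|exact: lBg.1].
- have e1 := B_sub P lh (locLp_B P lh).
  have e2 : aeeq mu (B P (B P h)) (B P (B T g)).
    by apply: B_ae; [exact: locLp_B..|exact: B_comm].
  have e3 := B_sub P lg lAg.
  have Tg : B T g = (fun x => g x - opA B T g x).
    by apply/funext => x; rewrite /opA; ring.
  rewrite Tg in e2.
  apply: filterS3 e1 e2 e3 => x; rewrite /opA => -> -> ->; ring.
- apply: (le_trans (normavg_add hmu (dil2 1 P) q0_ok lA.1 lv1.1)).
  set Y := alpha2_sum P h; have Y0 : (0 <= Y)%E by exact: alpha2_sum_ge0.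
  have hA : (normavg mu q0 (cubeset (dil2 1 P)) (opA B P h) <= 4%:E * Y)%E.
    by apply: (le_trans (normavg_A P lh)); apply: lee_wpmul2l => //; exact: alpha_sum_le.
  have := normavg_add hmu (dil2 1 P) q0_ok lA.1 (measurable_funN lAA.1).
  rewrite (normavgN mu _ _ (opA B P (opA B P h))) => h2.
  apply: (@le_trans _ _ (4%:E * (4%:E * Y + 4%:E * (4%:E * Y + K%:E * Y)))%E).
    apply: lee_wpmul2l => //; apply: leeD => //.
    apply: (le_trans h2); apply: lee_wpmul2l => //; apply: leeD => //; exact: hK.
  have gen (z : \bar R) : (0 <= z)%E -> (4%:E * (4%:E * z + 4%:E * (4%:E * z + K%:E * z)) <=
      (4 * (4 + 4 * (4 + K)) + 32)%:E * z)%E.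
    case: z => [z| |] // z0; last first.
      rewrite [leRHS]gt0_muley ?leey// lte_fin.
      by rewrite ltr_wpDl// mulr_ge0// addr_ge0// mulr_ge0// addr_ge0.
    rewrite lee_fin in z0; rewrite -!EFinM lee_fin.
    by nra.
  exact: gen.
- rewrite (normavgN mu _ _ (B P (opA B T g))).
  by have [_ _ _ _ [_ h5]] := hO; exact: h5.
- have -> : B P g = (fun x => g x - opA B P g x).
    by apply/funext => x; rewrite /opA; ring.
  have r1 : exponent_ok p0%:E by rewrite /exponent_ok lee_fin.
  have lAPg := locLp_A P lg.
  apply: (le_trans (normavg_add hmu (dil2 1 P) r1 lg.1 (measurable_funN lAPg.1))).
  rewrite (normavgN mu _ _ (opA B P g)).
  have X0 := alpha_sum_ge0 P g.
  have hA : (avg 1 P (opA B P g) <= 2%:E * (4%:E * alpha_sum P g))%E.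
    by apply: normavg_exponent; [exact: lAPg.1|exact: mule_ge0|exact: normavg_A].
  have a0 := avg_ge0 1 P g.
  apply: (@le_trans _ _ (4%:E * (8%:E * avg 1 P g + 8%:E * alpha_sum P g))%E).
    apply: lee_wpmul2l => //; apply: leeD.
      by rewrite -[leLHS]mul1e; apply: lee_wpmul2r => //; rewrite lee_fin ler1n.
    by apply: (le_trans hA); rewrite muleA -EFinM (_ : 2 * 4 = 8 :> R)//; ring.
  rewrite -ge0_muleDr// muleA -EFinM; apply: lee_wpmul2r; first exact: adde_ge0.
  rewrite lee_fin (_ : 4 * 8 = 32 :> R); last by ring.
  by rewrite lerDr mulr_ge0// addr_ge0// mulr_ge0// addr_ge0.
Qed.

Lemma change_of_cube Q T f : locLp mu p0 f ->
  aeeq mu (B Q f) (fun x => B T f x + (opA B T (B Q f) x - opA B Q (B T f) x)).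
Proof.
move=> hf; apply: filterS (B_comm Q T hf) => x.
by rewrite /opA => ->; ring.
Qed.

End Operators.

(** * Good-lambda inequality *)

Section HotRegions.
Context (R : realType) (n : nat) (mu : {measure set (RnB R n) -> \bar R}).
Hypothesis hmu : lebesgue_on_cubes mu.
Implicit Types (Q : cube R n).

Lemma nbr_didx_S Q d (x y : 'rV[R]_n) :
  nbr (didx Q d.+1 x) (didx Q d.+1 y) -> nbr (didx Q d x) (didx Q d y).
Proof.
move=> h i; move: (h i); rewrite !mxE.
have s0 : 0 < side Q by exact: side_gt0.
have E (z : R) : z / (side Q / 2 ^+ d.+1) = 2 * (z / (side Q / 2 ^+ d)).
  by rewrite exprS; field; rewrite gt_eqF//= gt_eqF// exprn_gt0.
rewrite !E; set a := (x 0 i - _) / _; set b := (y 0 i - _) / _ => ab.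
have aux (u v : R) : Num.floor (2 * u) <= Num.floor (2 * v) + 1 ->
    Num.floor u <= Num.floor v + 1.
  move=> uv; have h1 : (2 * Num.floor u <= Num.floor (2 * u)).
    by rewrite floor_ge_int intrM; have := floor_le u; lra.
  have h2 : Num.floor (2 * v) <= 2 * Num.floor v + 1.
    rewrite -ltzD1 floor_lt_int !intrD intrM.
    by have /andP[_] := floor_itv v; rewrite intrD; lra.
  lia.
move: ab; rewrite !ler_norml => /andP[h1 h2].
have h3 := aux a b; have h4 := aux b a.
by apply/andP; split; lia.
Qed.

Lemma nbr_didx_le Q d e (x y : 'rV[R]_n) : (d <= e)%N ->
  nbr (didx Q e x) (didx Q e y) -> nbr (didx Q d x) (didx Q d y).
Proof.
move=> /subnKC <-; elim: (e - d)%N => [|k IH]; first by rewrite addn0.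
by rewrite addnS => /nbr_didx_S.
Qed.

Definition hotregion Q d (k : 'rV[int]_n) (p : nat -> 'rV[int]_n -> Prop) : set (RnB R n) :=
  [set x | cells Q (d, k) x /\ exists e j, [/\ (d < e)%N, nbr (didx Q e x) j,
     cells Q (e, j) `<=` cubeset (dil2 1 (dcell Q d k)) & p e j]].

Lemma hotregion_dopen Q d k p : dopen Q (hotregion Q d k p).
Proof.
move=> x [xk [e [j [de xj jP pej]]]]; exists e => y /dcellP yx; split.
  by move: xk => /dcellP /= <-; apply/dcellP; apply: (didx_le (ltnW de)).
by exists e, j; split => //; rewrite yx.
Qed.

Lemma hotregion_sub Q d k p : hotregion Q d k p `<=` cells Q (d, k).
Proof. by move=> x []. Qed.

(** Weak type (1,1): the maximal hot cells are disjoint inside [2P] and their triples cover the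
    region, whence [3^n]. *)
Lemma hotregion_measure Q d k p (m1 : {measure set (RnB R n) -> \bar R}) (s : R) :
  0 < s -> (forall e j, p e j -> cells Q (e, j) `<=` cubeset (dil2 1 (dcell Q d k)) ->
    (s%:E * mu (cells Q (e, j)) <= m1 (cells Q (e, j)))%E) ->
  (s%:E * mu (hotregion Q d k p) <= (3 ^+ n)%:E * m1 (cubeset (dil2 1 (dcell Q d k))))%E.
Proof.
move=> s0 hp; set P2 := cubeset _.
pose pp e j := cells Q (e, j) `<=` P2 /\ p e j.
pose M := maxcells Q d.+1 pp.
have tM : trivIset M (cells Q) := @maxcells_triv _ _ Q d.+1 pp.
have mM i : M i -> measurable (cells Q i : set (RnB R n)).
  by move=> _; exact: measurable_cells.
have mU : measurable (\bigcup_(i in M) cells Q i : set (RnB R n)).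
  exact: countable_bigcup_measurable.
have mE := dopen_measurable (@hotregion_dopen Q d k p).
have h1 : (mu (hotregion Q d k p) <= (3 ^+ n)%:E * mu (\bigcup_(i in M) cells Q i))%E.
  apply: (@cover_le _ _ _ mu mu _ M (cells Q) (fun i => cubeset (tri (dcell Q i.1 i.2)))) => //.
  - by move=> i _; exact: measurable_cubeset.
  - move=> x [xk [e [j [de xj jP pej]]]].
    have [y yj] := cell_nonempty Q (e, j); have /dcellP /= ey := yj.
    have [|f /andP[df fe] Mf] := @maxcells_cover _ _ Q d.+1 pp e y de.
      by rewrite ey; split.
    exists (f, didx Q f y) => //=; apply/triP; apply: (nbr_didx_le fe).
    by rewrite ey.
  - by move=> i _; rewrite (mu_tri hmu).
have h2 : (mu (\bigcup_(i in M) cells Q i) <= s^-1%:E * m1 (\bigcup_(i in M) cells Q i))%E.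
  apply: local_le => //; first by rewrite invr_ge0 ltW.
  move=> [e j] [/= de [jP pej] _]; rewrite lee_pdivlMl//.
  apply: le_trans (hp _ _ pej jP); apply: lee_wpmul2l; first by rewrite lee_fin ltW.
  apply: measure_mono; [|exact: measurable_cells|by move=> x []].
  by apply: measurableI => //; exact: measurable_cells.
have h3 : (m1 (\bigcup_(i in M) cells Q i) <= m1 P2)%E.
  apply: measure_mono => //; first exact: measurable_cubeset.
  by move=> x [[e j] [/= _ [jP _] _] /jP].
rewrite -lee_pdivlMl// muleCA; apply: (le_trans h1); apply: lee_wpmul2l.
  by rewrite lee_fin exprn_ge0.
by apply: (le_trans h2); apply: lee_wpmul2l => //; rewrite lee_fin invr_ge0 ltW.
Qed.

Definition hot (p : R) Q (u : RnB R n -> R) (t : R) (e : nat) (j : 'rV[int]_n) : Prop :=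
  ((t `^ p)%:E * mu (cells Q (e, j)) < \int[mu]_(x in cells Q (e, j)) (`|u x| `^ p)%:E)%E.

Lemma powR_density (p : R) (u : RnB R n -> R) : measurable_fun setT u ->
  exists m1 : {measure set (RnB R n) -> \bar R},
    forall E, m1 E = (\int[mu]_(x in E) (`|u x| `^ p)%:E)%E.
Proof.
move=> mu_; apply: density_measure; first exact: measurable_powR_abs.
by move=> x; rewrite lee_fin powR_ge0.
Qed.

Lemma mu_dil2_cell Q d k :
  mu (cubeset (dil2 1 (dcell Q d k))) = ((2 ^+ n)%:E * mu (cells Q (d, k)))%E.
Proof. by rewrite mu_cell// hmu /= expr1 exprMn EFinM. Qed.

Lemma integral_le_normavg (p l : R) Q u : 0 < p -> 0 <= l ->
  (normavg mu p%:E (cubeset Q) u <= l%:E)%E ->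
  (\int[mu]_(x in cubeset Q) (`|u x| `^ p)%:E <= (l `^ p)%:E * mu (cubeset Q))%E.
Proof.
move=> p0 l0 h.
have sQ : 0 < side Q ^+ n by rewrite exprn_gt0// side_gt0.
have := poweR_le (ltW p0) (poweR_ge0 _ _) h.
rewrite -poweRrM mulVf ?gt_eqF// poweRe1 ?pavg_ge0// poweR_EFin.
by rewrite /pavg mu_cubeV// muleC lee_pdivrMr// -hmu.
Qed.

Lemma normavg_le_integral (p l : R) Q u : 0 < p -> 0 <= l ->
  (\int[mu]_(x in cubeset Q) (`|u x| `^ p)%:E <= (l `^ p)%:E * mu (cubeset Q))%E ->
  (normavg mu p%:E (cubeset Q) u <= l%:E)%E.
Proof.
move=> p0 l0 h.
have sQ : 0 < side Q ^+ n by rewrite exprn_gt0// side_gt0.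
have hp : (pavg mu p (cubeset Q) u <= (l `^ p)%:E)%E.
  by rewrite /pavg mu_cubeV// muleC lee_pdivrMr// -hmu.
have pi0 : 0 <= p^-1 by rewrite invr_ge0 ltW.
have := poweR_le pi0 (pavg_ge0 hmu p Q u) hp.
by rewrite poweR_EFin -powRrM divff ?gt_eqF// powRr1.
Qed.

(** [6^n] is the covering constant [3^n] times the volume ratio [2^n] of [2P] to [P]. *)
Lemma hot_measure (p l t : R) Q d k u : 1 <= p -> 0 <= l -> 0 < t ->
  measurable_fun setT u ->
  (normavg mu p%:E (cubeset (dil2 1 (dcell Q d k))) u <= l%:E)%E ->
  (mu (hotregion Q d k (hot p Q u t)) <=
    (6 ^+ n * (l / t) `^ p)%:E * mu (cells Q (d, k)))%E.
Proof.
move=> p1 l0 t0 mu_ hl; have p0 : 0 < p by exact: lt_le_trans p1.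
have [m1 m1E] := powR_density p mu_.
have tp : 0 < t `^ p by exact: powR_gt0.
have := @hotregion_measure Q d k (hot p Q u t) m1 (t `^ p) tp.
have hh : forall e j, hot p Q u t e j ->
    cells Q (e, j) `<=` cubeset (dil2 1 (dcell Q d k)) ->
    ((t `^ p)%:E * mu (cells Q (e, j)) <= m1 (cells Q (e, j)))%E.
  by move=> e j hej _; rewrite m1E; exact: ltW.
move=> /(_ hh); rewrite m1E.
have h2 := integral_le_normavg p0 l0 hl.
rewrite -lee_pdivlMl// => /le_trans; apply.
rewrite mu_dil2_cell in h2.
apply: (@le_trans _ _ ((t `^ p)^-1%:E * ((3 ^+ n)%:E * ((l `^ p)%:E * ((2 ^+ n)%:E * mu (cells Q (d, k))))))%E).
  apply: lee_wpmul2l; first by rewrite lee_fin invr_ge0 ltW.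
  by apply: lee_wpmul2l => //; rewrite lee_fin exprn_ge0.
rewrite !muleA -!EFinM; apply: lee_wpmul2r => //; rewrite lee_fin.
rewrite powRM ?invr_ge0 ?(ltW t0)// (_ : 6 = 3 * 2 :> R); last by ring.
rewrite [(3 * 2) ^+ n]exprMn -powR_inv1 ?powR_ge0// -powRrM mulrN1.
rewrite (_ : t^-1 `^ p = t `^ (- p)); first by lra.
by rewrite -powR_inv1 ?(ltW t0)// -powRrM mulN1r.
Qed.

End HotRegions.

Section LevelSets.
Context (R : realType) (n : nat) (mu : {measure set (RnB R n) -> \bar R}).
Hypothesis hmu : lebesgue_on_cubes mu.
Implicit Types (Q : cube R n) (u : RnB R n -> R).

Lemma powRD_pos (x a b : R) : 0 < x -> x `^ (a + b) = x `^ a * x `^ b.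
Proof. by move=> x0; rewrite powRD// (gt_eqF x0) implybT. Qed.

Lemma two_powR_gt1 (th : R) : 0 < th -> 1 < 2 `^ th.
Proof.
move=> th0; have {1}-> : 1 = 1 `^ th :> R by rewrite powR1.
by rewrite gt0_ltr_powR// ?nnegrE// ltr1n.
Qed.

Lemma powRV (x r : R) : 0 <= x -> x^-1 `^ r = (x `^ r)^-1.
Proof. by move=> x0; rewrite -[x^-1]powR_inv1// -powRrM mulN1r powRN. Qed.

Definition above u (t : R) : set (RnB R n) := [set x | t < `|u x|].

Lemma measurable_aboveR u t : measurable_fun setT u -> measurable (above u t).
Proof.
move=> mu_; rewrite (_ : above u t = [set x | (t%:E < (`|u x|)%:E)%E]).
  exact: measurable_above.
by apply/seteqP; split => x /=; rewrite lte_fin.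
Qed.

Lemma chebyshev_cube (r l t : R) Q u : 0 < r -> 0 <= l -> 0 < t -> measurable_fun setT u ->
  (normavg mu r%:E (cubeset Q) u <= l%:E)%E ->
  (mu (cubeset Q `&` above u t) <= ((l / t) `^ r)%:E * mu (cubeset Q))%E.
Proof.
move=> r0 l0 t0 mu_ hl; have mQ := measurable_cubeset Q.
have mE : measurable (cubeset Q `&` above u t).
  by apply: measurableI => //; exact: measurable_aboveR.
have h1 := integral_le_normavg hmu r0 l0 hl.
have h2 : ((t `^ r)%:E * mu (cubeset Q `&` above u t) <=
    \int[mu]_(x in cubeset Q) (`|u x| `^ r)%:E)%E.
  rewrite -(integral_cst mu mE).
  apply: (@le_trans _ _ (\int[mu]_(x in cubeset Q `&` above u t) (`|u x| `^ r)%:E)%E).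
    apply: ge0_le_integral.
    - exact: mE.
    - by move=> x _; rewrite lee_fin powR_ge0.
    - exact: measurable_cst.
    - exact: measurable_powR_abs.
    - by move=> x [_ /= tx]; rewrite lee_fin; apply: powR_le => //; exact: ltW.
  apply: ge0_subset_integral => //; exact: measurable_powR_abs.
have tr : 0 < t `^ r by exact: powR_gt0.
rewrite powRM ?invr_ge0 ?(ltW t0)//.
rewrite powRV ?(ltW t0)//.
rewrite mulrC EFinM -muleA lee_pdivlMl//; exact: le_trans h1.
Qed.

(** A growing geometric progression cut at [z] is dominated by its last term. This is the sum over
    levels in the layer-cake argument. *)
Lemma geometric_powR (th l z : R) L : 0 < th -> 0 < l -> 0 <= z ->
  \sum_(1 <= m < L.+1) (if 2 ^+ m * l < z then (2 ^+ m * l) `^ th else 0) <=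
  (1 - 2 `^ (- th))^-1 * z `^ th.
Proof.
move=> th0 l0 z0; set c := (_)^-1.
have d1 : 2 `^ (- th) < 1.
  by rewrite powRN invf_lt1 ?powR_gt0// two_powR_gt1.
have c0 : 0 < c by rewrite invr_gt0 subr_gt0.
have ce : c * 2 `^ (- th) + 1 = c.
  have : c * (1 - 2 `^ (- th)) = 1 by rewrite mulVf// gt_eqF// subr_gt0.
  lra.
have full K : \sum_(1 <= m < K.+1) (2 ^+ m * l) `^ th <= c * (2 ^+ K * l) `^ th.
  elim: K => [|K IH].
    by rewrite big_geq// mulr_ge0 ?powR_ge0// ltW.
  rewrite big_nat_recr//=; apply: (le_trans (lerD IH (lexx _))).
  have -> : 2 ^+ K * l = 2 ^+ K.+1 * l * 2^-1.
    by rewrite exprS; field.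
  have x0 : 0 <= 2 ^+ K.+1 * l by rewrite mulr_ge0 ?exprn_ge0// ltW.
  rewrite [(2 ^+ K.+1 * l * 2^-1) `^ th]powRM ?invr_ge0//.
  rewrite powRV// -powRN.
  rewrite -[X in _ <= X * _]ce; lra.
elim: L => [|L IH].
  by rewrite big_geq// mulr_ge0 ?powR_ge0// ltW.
rewrite big_nat_recr//=; case: ifPn => hL; last by rewrite addr0.
have x0 : 0 <= 2 ^+ L.+1 * l by rewrite mulr_ge0 ?exprn_ge0// ltW.
apply: (@le_trans _ _ (c * (2 ^+ L.+1 * l) `^ th)).
  apply: le_trans (full L.+1); rewrite [leRHS]big_nat_recr//= lerD//.
  by apply: ler_sum => m _; case: ifP => // _; exact: powR_ge0.
by rewrite ler_wpM2l ?(ltW c0)// powR_le ?(ltW th0)// ltW.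
Qed.

End LevelSets.

Section BadCells.
Context (R : realType) (n : nat) (mu : {measure set (RnB R n) -> \bar R}).
Hypothesis hmu : lebesgue_on_cubes mu.
Variables (p : R) (Q : cube R n) (h : RnB R n -> R).
Hypotheses (p1 : 1 <= p) (mh : measurable_fun setT h).

Let p0 : 0 < p. Proof. exact: lt_le_trans p1. Qed.

(** The triple is essential: when no ancestor of [P] is bad, the tripled ancestors contain the
    dilates [2^l P], which the ancestors themselves need not. *)
Definition bad (t : R) (e : nat) (j : 'rV[int]_n) : Prop :=
  ((t `^ p)%:E * mu (cubeset (tri (dcell Q e j))) <
    \int[mu]_(x in cubeset (tri (dcell Q e j))) (`|h x| `^ p)%:E)%E.

Definition badset t : set (RnB R n) :=
  [set x | cubeset Q x /\ exists e, bad t e (didx Q e x)].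

Lemma bad_mono s t e j : 0 <= s -> s <= t -> bad t e j -> bad s e j.
Proof.
move=> s0 st; apply: le_lt_trans; apply: lee_wpmul2r => //.
by rewrite lee_fin powR_le// ltW.
Qed.

Lemma badset_mono s t : 0 <= s -> s <= t -> badset t `<=` badset s.
Proof.
by move=> s0 st x [Qx [e be]]; split => //; exists e; exact: bad_mono be.
Qed.

Lemma badset_dopen t : dopen Q (badset t).
Proof.
move=> x [Qx [e be]]; exists e => y /dcellP yx; split; last by exists e; rewrite yx.
by apply/didx0P; rewrite (didx_le (leq0n e) yx); apply/didx0P.
Qed.

Lemma measurable_badset t : measurable (badset t).
Proof. exact: dopen_measurable (@badset_dopen t). Qed.

(** An average over [3P] is a mean of averages over its neighbouring cells, so one of them is as
    large. *)
Lemma bad_nbr t e k : 0 <= t -> bad t e k -> exists2 j, nbr k j &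
  ((t `^ p)%:E * mu (cells Q (e, j)) < \int[mu]_(x in cells Q (e, j)) (`|h x| `^ p)%:E)%E.
Proof.
move=> t0 bk; apply: contrapT => nex; move: bk; apply/negP; rewrite -leNgt.
have [m1 m1E] := powR_density mu p mh; rewrite -m1E.
have mT := measurable_cubeset (tri (dcell Q e k)).
pose F (j : 'rV[int]_n) := cells Q (e, j) : set (RnB R n).
have mF i : nbr k i -> measurable (F i) by move=> _; exact: measurable_cells.
have tF : trivIset [set j | nbr k j] F by exact: (@dcell_disj _ _ Q e).
apply: (@le_trans _ _ ((t `^ p)%:E * mu (\bigcup_(j in [set j | nbr k j]) F j))%E).
  apply: local_le => //; first exact: powR_ge0.
  - move=> x /triP xk; exists (didx Q e x); first exact: nbr_sym.
    exact: dcell_self.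
  - move=> j kj; apply: (@le_trans _ _ (m1 (F j))).
      by apply: measure_mono => //; [apply: measurableI => //; exact: mF|exact: mF].
    rewrite m1E leNgt; apply/negP => hj; apply: nex; by exists j.
apply: lee_wpmul2l; first by rewrite lee_fin powR_ge0.
apply: measure_mono => //; first exact: countable_bigcup_measurable.
by move=> x [j /= kj /dcellP xj]; apply/triP; rewrite xj; exact: nbr_sym.
Qed.

(** Off the bad set all cell averages of [|h|^p] are at most [3^n t^p], so by dyadic differentiation
    the exceptional part [E] satisfies [s^p mu E <= 3^n t^p mu E]. Since [(4^(n+1))^p >= 3^n + 1],
    it is null. *)
Lemma above_badset (nu : {measure set (RnB R n) -> \bar R}) (t : R) :
  (forall E : set (RnB R n), measurable E -> mu E = 0%E -> nu E = 0%E) ->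
  0 < t -> (nu (cubeset Q `&` above h (4 ^+ n.+1 * t)) <= nu (badset t))%E.
Proof.
move=> nunull t0; have mQ := measurable_cubeset Q.
set s := _ * t; have s0 : 0 < s by rewrite mulr_gt0// exprn_gt0.
have mA := measurable_aboveR s mh.
pose E := (cubeset Q `\` badset t) `&` above h s.
have mE : measurable E.
  by apply: measurableI => //; apply: measurableD => //; exact: measurable_badset.
have [m1 m1E] := powR_density mu p mh.
have h1 : (m1 E <= (3 ^+ n * t `^ p)%:E * mu E)%E.
  apply: (@dyadic_differentiation _ _ _ hmu Q m1 (cubeset Q `\` badset t)) => //.
  - by rewrite mulr_ge0 ?exprn_ge0 ?powR_ge0.
  - by move=> x [].
  - move=> d x [Qx nb].
    have : ~ bad t d (didx Q d x) by move=> b; apply: nb; split => //; exists d.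
    move=> /negP; rewrite -leNgt -m1E (mu_tri hmu) => hb.
    apply: (@le_trans _ _ (m1 (cubeset (tri (dcell Q d (didx Q d x)))))).
      apply: measure_mono; [exact: measurable_cells|exact: measurable_cubeset|].
      by move=> y /dcellP /= yx; apply/triP; rewrite yx; exact: nbr_refl.
    by apply: (le_trans hb); rewrite muleA -EFinM mulrC.
have h2 : ((s `^ p)%:E * mu E <= m1 E)%E.
  rewrite m1E -(integral_cst mu mE); apply: ge0_le_integral.
  - exact: mE.
  - by move=> x _; rewrite lee_fin powR_ge0.
  - exact: measurable_cst.
  - exact: measurable_powR_abs.
  - by move=> x [_ /= sx]; rewrite lee_fin; apply: powR_le; exact: ltW.
have fE : mu E \is a fin_num.
  rewrite ge0_fin_numE// (le_lt_trans (measure_mono mu mE mQ _))//; first by move=> x [[]].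
  by rewrite hmu ltry.
have E0 : mu E = 0%E.
  have mE0 : (0 <= mu E)%E by exact: measure_ge0.
  have := le_trans h2 h1; move: mE0.
  move: (mu E) fE => [e| |]// _; rewrite -!EFinM !lee_fin => e0 he; congr (_%:E).
  have tp : 0 < t `^ p by rewrite powR_gt0.
  have c : 4 ^+ n.+1 <= (4 ^+ n.+1) `^ p :> R.
    have := @ler_powR R (4 ^+ n.+1) _ 1 p p1; rewrite powRr1 ?exprn_ge0//; apply.
    by rewrite exprn_ege1// ler1n.
  have c3 : 3 ^+ n <= 4 ^+ n :> R by rewrite lerXn2r ?nnegrE// ler_nat.
  have c4 : 1 <= 4 ^+ n :> R by rewrite exprn_ege1// ler1n.
  have c5 : 3 ^+ n + 1 <= (4 ^+ n.+1) `^ p :> R by apply: le_trans c; rewrite exprS; lra.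
  move: he; rewrite /s powRM ?exprn_ge0 ?(ltW t0)//.
  set A := (4 ^+ n.+1) `^ p in c5 *; set C := 3 ^+ n in c5 *; set T := t `^ p in tp *.
  clearbody A C T.
  move=> he; have : T * e <= 0 by have := ler_wpM2r (mulr_ge0 (ltW tp) e0) c5; lra.
  by rewrite pmulr_rle0// => e1; apply/le_anti/andP.
have nE := nunull E mE E0.
have mB := measurable_badset t.
apply: (@le_trans _ _ (nu (E `|` badset t))).
  apply: measure_mono; [exact: measurableI|exact: measurableU|].
  move=> x [Qx sx]; have [bx|nx] := pselect (badset t x); first by right.
  by left; split.
apply: (@le_trans _ _ (nu E + nu (badset t))%E); first exact: measureU2.
by rewrite nE add0e.
Qed.

(** Badness at level [T] cannot come from an ancestor of the stopping cell [P], nor from [P] itself.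
    It comes from a finer cell, whose hot neighbour lies in [2P], where the decomposition of [h]
    makes one of the three pieces hot. *)
Lemma hot_of_bad (d : nat) k t T s (v1 v2 v3 : RnB R n -> R) x : 0 <= t -> t <= T ->
  0 < s -> 36 * s <= T -> 2 ^+ n * t <= T -> (0 < d)%N ->
  measurable_fun setT v1 -> measurable_fun setT v2 -> measurable_fun setT v3 ->
  aeeq mu h (fun y => v1 y + v2 y + v3 y) ->
  (forall y, cells Q (d, k) y -> forall e, (e < d)%N -> ~ bad t e (didx Q e y)) ->
  cells Q (d, k) x -> badset T x ->
  [\/ hotregion Q d k (hot mu p Q v1 s) x, hotregion Q d k (hot mu p Q v2 s) x |
      hotregion Q d k (hot mu p Q v3 s) x].
Proof.
move=> t0 tT s0 sT nT d0 mv1 mv2 mv3 hv anc xk [Qx [e be]].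
have [ed|ed|ed] := ltngtP e d; first by exfalso; apply: (anc x xk e ed); exact: bad_mono be.
all: swap 1 2.
  (* The cell [P] itself: [3P] lies in the triple of the good parent, whose volume is only [2^n]
     times larger, and [2^n t <= T]. *)
  exfalso; subst e; case: d d0 anc be xk => // d _ anc be xk.
  have /negP := anc x xk d (ltnSn d); rewrite -leNgt => hd.
  move: be; apply/negP; rewrite -leNgt.
  have [m1 m1E] := powR_density mu p mh; move: hd; rewrite -!m1E => hd.
  apply: (@le_trans _ _ (m1 (cubeset (tri (dcell Q d (didx Q d x)))))).
    apply: measure_mono; [exact: measurable_cubeset|exact: measurable_cubeset|].
    by move=> y /triP yx; apply/triP; exact: nbr_didx_le yx.
  apply: (le_trans hd); rewrite !(mu_tri hmu).
  have := @mu_cell_pred _ _ _ hmu Q d (didx Q d x) (didx Q d.+1 x); rewrite /cells /= => ->.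
  rewrite [leLHS]muleCA [leRHS]muleCA; apply: lee_wpmul2l; first by rewrite lee_fin exprn_ge0.
  rewrite muleA -EFinM; apply: lee_wpmul2r => //; rewrite lee_fin.
  have T0 : 0 <= 2 ^+ n * t by rewrite mulr_ge0// exprn_ge0.
  apply: le_trans (powR_le T0 nT (ltW p0)).
  rewrite powRM ?exprn_ge0// mulrC ler_wpM2r ?powR_ge0//.
  have := @ler_powR R (2 ^+ n) _ 1 p p1; rewrite powRr1 ?exprn_ge0//; apply.
  by rewrite exprn_ege1// ler1n.
have [|j xj hj] := @bad_nbr T e (didx Q e x) _ be; first exact: le_trans tT.
have jP : cells Q (e, j) `<=` cubeset (dil2 1 (dcell Q d k)).
  apply: (nbr_dil2 ed (nbr_sym xj)); move: xk => /dcellP /= <-.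
  by apply: dcell_subset; exact: ltnW.
have reg v : hot mu p Q v s e j -> hotregion Q d k (hot mu p Q v s) x.
  by move=> hh; split => //; exists e, j.
have [h1|n1] := pselect (hot mu p Q v1 s e j); first by apply: Or31; exact: reg.
have [h2|n2] := pselect (hot mu p Q v2 s e j); first by apply: Or32; exact: reg.
have [h3|n3] := pselect (hot mu p Q v3 s e j); first by apply: Or33; exact: reg.
exfalso; move: hj; apply/negP; rewrite -leNgt.
have nv v : ~ hot mu p Q v s e j ->
    (normavg mu p%:E (cells Q (e, j)) v <= s%:E)%E.
  move=> /negP; rewrite /hot -leNgt => hh.
  exact: (normavg_le_integral hmu p0 (ltW s0) hh).
have ok : exponent_ok p%:E by [].
have m12 : measurable_fun setT (fun y => v1 y + v2 y) by exact: measurable_funD.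
have m123 : measurable_fun setT (fun y => v1 y + v2 y + v3 y) by exact: measurable_funD.
have a1 := normavg_add hmu (dcell Q e j) ok mv1 mv2.
have a2 := normavg_add hmu (dcell Q e j) ok m12 mv3.
have := normavg_ae p%:E (dcell Q e j) mh m123 hv.
move: a1 a2 (nv _ n1) (nv _ n2) (nv _ n3); rewrite /cells [(e, j).1]/= [(e, j).2]/=.
move=> a1 a2 b1 b2 b3 eh.
have hh : (normavg mu p%:E (cubeset (dcell Q e j)) h <= T%:E)%E.
  rewrite eh; apply: (le_trans a2).
  (* Two quasi-triangle inequalities give [4 (4 (s + s) + s) = 36 s], the origin of 36. *)
  apply: (@le_trans _ _ (4%:E * (4%:E * (s%:E + s%:E) + s%:E))%E).
    apply: lee_wpmul2l; first by rewrite lee_fin.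
    apply: (leeD _ b3); apply: (le_trans a1).
    by apply: lee_wpmul2l; [rewrite lee_fin|exact: (leeD b1 b2)].
  by rewrite -!(EFinM, EFinD) lee_fin; lra.
exact: (integral_le_normavg hmu p0 (le_trans t0 tT) hh).
Qed.

End BadCells.

Section GoodLambda.
Context (R : realType) (n : nat) (mu : {measure set (RnB R n) -> \bar R}).
Hypothesis hmu : lebesgue_on_cubes mu.
Variables (nu : {measure set (RnB R n) -> \bar R}) (p q : R) (q0 : \bar R).
Hypotheses (p1 : 1 <= p) (pq : p < q).
Hypothesis nuoo : forall Q : cube R n, (nu (cubeset Q) < +oo)%E.
Hypothesis nunull : forall E : set (RnB R n), measurable E -> mu E = 0%E -> nu E = 0%E.
Hypothesis nucells : forall eps : R, 0 < eps -> exists2 del : R, 0 < del &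
  forall (Q : cube R n) d k (E : set (RnB R n)), dopen Q E -> E `<=` cells Q (d, k) ->
  (mu E <= del%:E * mu (cells Q (d, k)))%E ->
  (nu E <= eps%:E * nu (cells Q (d, k)))%E.
Hypothesis nuq0 : RH_measure mu nu q q0.
Implicit Types (Q : cube R n) (u : RnB R n -> R).

Let p0 : 0 < p. Proof. exact: lt_le_trans p1. Qed.
Let q_gt0 : 0 < q. Proof. exact: lt_trans pq. Qed.

(** Chebyshev's inequality in L^{q0} followed by the reverse Hoelder comparison. For [q0 = +oo] the
    level set is null once [t > 2 l]. *)
Lemma weak_bound : exists2 C : R, 0 < C & forall Q u (t l : R),
  measurable_fun setT u -> 0 < l -> (normavg mu q0 (cubeset Q) u <= l%:E)%E -> 0 < t ->
  ((t `^ q)%:E * nu (cubeset Q `&` above u t) <= (C * l `^ q)%:E * nu (cubeset Q))%E.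
Proof.
have triv Q u t l : measurable_fun setT u -> 0 < t -> t <= l ->
    ((t `^ q)%:E * nu (cubeset Q `&` above u t) <= (l `^ q)%:E * nu (cubeset Q))%E.
  move=> mu_ t0 tl; have mQ := measurable_cubeset Q; apply: lee_pmul => //.
  - by rewrite lee_fin powR_ge0.
  - by rewrite lee_fin; apply: powR_le => //; exact: ltW.
  - apply: measure_mono => //; apply: measurableI => //; exact: measurable_aboveR.
case: nuq0 => [->|[r [rho [C [-> qr C0 hrho hC]]]]].
  exists (2 `^ q); first by rewrite powR_gt0.
  move=> Q u t l mu_ l0 hl t0; have mQ := measurable_cubeset Q.
  rewrite -powRM ?(ltW l0)//.
  have [tl|lt_] := leP t (2 * l); first exact: triv.
  rewrite nunull ?mule0 ?mule_ge0 ?lee_fin ?powR_ge0//.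
    by apply: measurableI => //; exact: measurable_aboveR.
  have [s /= hs st] : exists2 s, mu (cubeset Q `&` [set x | (s < (`|u x|)%:E)%E]) = 0%E
      & (s < t%:E)%E.
    have : (esssup_on mu (cubeset Q) u < t%:E)%E.
      by apply: (le_lt_trans hl); rewrite lte_fin (lt_trans _ lt_)//; lra.
    by move=> /ereal_inf_lt[s h1 h2]; exists s.
  apply: subset_measure0 hs.
  - by apply: measurableI => //; exact: measurable_aboveR.
  - by apply: measurableI => //; exact: measurable_above.
  - move=> x [Qx /= tx]; split => //=; apply: (lt_trans st).
    by rewrite lte_fin.
exists (1 + C); first by rewrite addr_gt0.
move=> Q u t l mu_ l0 hl t0; have mQ := measurable_cubeset Q.
have r0 : 0 < r by exact: lt_trans qr.
have [tl|lt_] := leP t l.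
  apply: (le_trans (triv Q _ _ _ mu_ t0 tl)); apply: lee_wpmul2r => //.
  by rewrite lee_fin ler_peMl ?powR_ge0// lerDl ltW.
have h := chebyshev_cube hmu r0 (ltW l0) t0 mu_ hl.
pose y := t / l; have y0 : 0 < y by rewrite divr_gt0.
have hy : l / t = y `^ (-1) by rewrite powR_inv1 ?(ltW y0)// /y invf_div.
(* This [tau] balances the two terms: [tau y^(-r)] and [tau^(1 - rho)] both equal [y^(-q)], the
   latter by [(r - q)(1 - rho) = - q]. *)
have tau0 : 0 < y `^ (r - q) by rewrite powR_gt0.
have mE : measurable (cubeset Q `&` above u t).
  by apply: measurableI => //; exact: measurable_aboveR.
have := hC Q _ _ _ mE (@subIsetl _ _ _) tau0 h.
rewrite hy -powRrM -powRD_pos//.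
rewrite -powRrM hrho (_ : r - q + -1 * r = - q); last by ring.
move=> hn; apply: (@le_trans _ _ ((t `^ q)%:E * ((y `^ (- q) + C * y `^ (- q))%:E * nu (cubeset Q)))%E).
  by apply: lee_wpmul2l => //; rewrite lee_fin powR_ge0.
rewrite muleA -EFinM; apply: lee_wpmul2r => //; rewrite lee_fin.
have -> : t = y * l by rewrite /y mulfVK// gt_eqF.
have e : y `^ q * y `^ (- q) = 1 by rewrite -powRD_pos// subrr powRr0.
rewrite powRM ?(ltW y0) ?(ltW l0)//.
have -> : y `^ q * l `^ q * (y `^ (- q) + C * y `^ (- q)) =
   (y `^ q * y `^ (- q)) * ((1 + C) * l `^ q) by ring.
by rewrite e mul1r.
Qed.

(* The [L^r] bound of the dyadic maximal function, by layer cake over the levels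
   [2^m l]. *)
Lemma hot_strong (r : R) : p < r -> exists2 C : R, 0 < C &
  forall Q d k u (l : R) L, measurable_fun setT u -> 0 < l ->
  (normavg mu r%:E (cubeset (dil2 1 (dcell Q d k))) u <= l%:E)%E ->
  (\sum_(1 <= m < L.+1) (((2 ^+ m) `^ r)%:E *
     mu (hotregion Q d k (hot mu p Q u (2 ^+ m * l)))) <=
   C%:E * mu (cells Q (d, k)))%E.
Proof.
move=> pr; pose th := r - p; have th0 : 0 < th by rewrite subr_gt0.
have r0 : 0 < r by exact: lt_trans pr.
pose c := (1 - 2 `^ (- th))^-1.
have c0 : 0 < c.
  by rewrite invr_gt0 subr_gt0 powRN invf_lt1 ?powR_gt0// two_powR_gt1.
exists (2 * 3 ^+ n * (c * 2 `^ th) * 2 ^+ n).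
  by rewrite !mulr_gt0// ?exprn_gt0// powR_gt0.
move=> Q d k u l L mu_ l0 hl.
set P2 := cubeset _ in hl *; have mP2 : measurable P2 by exact: measurable_cubeset.
pose t m : R := 2 ^+ m * l; have t0 m : 0 < t m by rewrite mulr_gt0// exprn_gt0.
(* Values of [|u|] up to [t m / 2] contribute at most half of the threshold [(t m)^p], so a hot cell
   owes the other half to [g m]. *)
pose g m x : R := if t m < 2 * `|u x| then `|u x| `^ p else 0.
have g0 m x : 0 <= g m x by rewrite /g; case: ifP => // _; exact: powR_ge0.
have mg m : measurable_fun setT (g m).
  apply: measurable_fun_ifT => //.
    by apply: measurable_fun_ltr => //; apply: measurable_funM => //; exact: measurableT_comp.
  by have /measurable_EFinP := @measurable_powR_abs _ _ setT u p mu_.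
have mgE m D : measurable_fun D (EFin \o g m).
  by apply: measurable_funTS; apply/measurable_EFinP.
have muP2 : mu P2 = ((2 ^+ n)%:E * mu (cells Q (d, k)))%E by exact: mu_dil2_cell.
have key m : ((2^-1 * t m `^ p)%:E * mu (hotregion Q d k (hot mu p Q u (t m))) <=
    (3 ^+ n)%:E * \int[mu]_(x in P2) (g m x)%:E)%E.
  have [m1 m1E] : exists m1 : {measure set (RnB R n) -> \bar R},
      forall E, m1 E = (\int[mu]_(x in E) (g m x)%:E)%E.
    by apply: density_measure => [|x]; [exact: mgE|rewrite lee_fin].
  rewrite -m1E; apply: hotregion_measure => //; first by rewrite mulr_gt0 ?invr_gt0 ?powR_gt0.
  move=> e j hej _; set N := cells Q (e, j).
  have mN : measurable N by exact: measurable_cells.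
  have h1 : (\int[mu]_(x in N) (`|u x| `^ p)%:E <=
      m1 N + ((t m / 2) `^ p)%:E * mu N)%E.
    have c0' x : N x -> (0 <= cst ((t m / 2) `^ p)%:E x)%E.
      by rewrite /= lee_fin powR_ge0.
    have gN0 x : N x -> (0 <= (EFin \o g m) x)%E by rewrite /= lee_fin.
    rewrite m1E -(integral_cst mu mN).
    rewrite -(ge0_integralD mu mN gN0 (mgE m N) c0' (measurable_cst _)).
    apply: ge0_le_integral.
    - exact: mN.
    - by move=> x _; rewrite lee_fin powR_ge0.
    - exact: measurable_powR_abs.
    - by apply: emeasurable_funD => //; exact: measurable_cst.
    - move=> x _; rewrite /= -EFinD lee_fin /g; case: ifPn => h.
        by rewrite lerDl powR_ge0.
      by rewrite add0r powR_le ?(ltW p0)//; lra.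
  have h2 := lt_le_trans hej h1.
  have th2 : (t m / 2) `^ p <= 2^-1 * t m `^ p.
    rewrite powRM ?invr_ge0// ?(ltW (t0 m))// mulrC ler_wpM2r ?powR_ge0//.
    rewrite powRV// lef_pV2 ?posrE ?powR_gt0//.
    by have := @ler_powR R 2 _ _ _ p1; rewrite powRr1//; apply; exact: ler1n.
  move: h2; rewrite mu_cell//; set v := (_ ^+ n); have v0 : 0 <= v.
    by rewrite exprn_ge0// divr_ge0 ?exprn_ge0// ltW// side_gt0.
  have := measure_ge0 m1 N; case: (m1 N) => [z| |] //= z0; last by rewrite leey.
  by rewrite -!EFinM -EFinD lte_fin lee_fin; nra.
have key2 m : (((2 ^+ m) `^ r)%:E * mu (hotregion Q d k (hot mu p Q u (t m))) <=
    (2 * 3 ^+ n * (l `^ r)^-1)%:E * \int[mu]_(x in P2) ((t m `^ th) * g m x)%:E)%E.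
  have e1 : (2 ^+ m) `^ r = 2 * (l `^ r)^-1 * t m `^ th * (2^-1 * t m `^ p).
    have -> : 2 * (l `^ r)^-1 * t m `^ th * (2^-1 * t m `^ p) =
        (l `^ r)^-1 * (t m `^ th * t m `^ p) by field; rewrite gt_eqF// powR_gt0.
    rewrite -powRD_pos// subrK /t powRM ?exprn_ge0// ?(ltW l0)//.
    by rewrite mulrCA mulVf ?mulr1// gt_eqF// powR_gt0.
  rewrite e1 EFinM -muleA.
  apply: (@le_trans _ _ ((2 * (l `^ r)^-1 * t m `^ th)%:E *
     ((3 ^+ n)%:E * \int[mu]_(x in P2) (g m x)%:E))%E).
    by apply: lee_wpmul2l => //; rewrite lee_fin !mulr_ge0 ?invr_ge0 ?powR_ge0.
  have eI : (\int[mu]_(x in P2) ((t m `^ th) * g m x)%:E =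
      (t m `^ th)%:E * \int[mu]_(x in P2) (g m x)%:E)%E.
    have gP0 x : P2 x -> (0 <= (EFin \o g m) x)%E by rewrite /= lee_fin.
    rewrite -(ge0_integralZl_EFin mu mP2 gP0 (mgE m P2) (powR_ge0 _ _)).
    by apply: eq_integral => x _; rewrite /= EFinM.
  rewrite eI.
  rewrite !muleA -!EFinM; apply: lee_wpmul2r; first by apply: integral_ge0 => x _; rewrite lee_fin.
  by rewrite lee_fin; lra.
have lr : 0 < l `^ r by exact: powR_gt0.
have cc0 : 0 <= 2 * 3 ^+ n * (l `^ r)^-1.
  by rewrite !mulr_ge0 ?exprn_ge0// invr_ge0 ltW.
apply: (@le_trans _ _ (\sum_(1 <= m < L.+1) ((2 * 3 ^+ n * (l `^ r)^-1)%:E *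
     \int[mu]_(x in P2) ((t m `^ th) * g m x)%:E)%E)).
  by apply: lee_sum => m _; exact: key2.
have G0 m x : (0 <= ((t m `^ th) * g m x)%:E)%E by rewrite lee_fin mulr_ge0 ?powR_ge0.
have mG m : measurable_fun P2 (fun x => ((t m `^ th) * g m x)%:E).
  by apply: measurable_funTS; apply/measurable_EFinP; exact: measurable_funM.
rewrite -ge0_sume_distrr; last by move=> m _; apply: integral_ge0.
rewrite -ge0_integral_sum//.
apply: (@le_trans _ _ ((2 * 3 ^+ n * (l `^ r)^-1)%:E *
    \int[mu]_(x in P2) ((c * 2 `^ th)%:E * (`|u x| `^ r)%:E))%E).
  apply: lee_wpmul2l; first by rewrite lee_fin.
  apply: ge0_le_integral.
  - exact: mP2.
  - by move=> x _; apply: sume_ge0.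
  - by apply: emeasurable_sum.
  - by apply: measurable_funeM; exact: measurable_powR_abs.
  - move=> x _; rewrite sumEFin -EFinM lee_fin.
    have ux : 0 <= 2 * `|u x| by rewrite mulr_ge0.
    have := geometric_powR L th0 l0 ux; rewrite -/c => hg.
    have -> : \sum_(1 <= m < L.+1) t m `^ th * g m x =
       (\sum_(1 <= m < L.+1) (if 2 ^+ m * l < 2 * `|u x| then (2 ^+ m * l) `^ th else 0)) * `|u x| `^ p.
      rewrite big_distrl /=; apply: eq_bigr => m _.
      by rewrite /g /t; case: ifP; rewrite ?mulr0 ?mul0r.
    apply: (le_trans (ler_wpM2r (powR_ge0 _ _) hg)).
    rewrite powRM// -!mulrA ler_wpM2l ?(ltW c0)// ler_wpM2l ?powR_ge0//.
    by rewrite -powRD /th subrK// (gt_eqF r0).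
have ur0 x : P2 x -> (0 <= (`|u x| `^ r)%:E)%E by rewrite lee_fin powR_ge0.
have c2 : 0 <= c * 2 `^ th by rewrite mulr_ge0 ?powR_ge0// ltW.
rewrite (ge0_integralZl_EFin mu mP2 ur0 (@measurable_powR_abs _ _ P2 u r mu_) c2).
have h2 := integral_le_normavg hmu r0 (ltW l0) hl.
apply: (@le_trans _ _ ((2 * 3 ^+ n * (l `^ r)^-1)%:E * ((c * 2 `^ th)%:E * ((l `^ r)%:E * mu P2)))%E).
  apply: lee_wpmul2l; first by rewrite lee_fin.
  by apply: lee_wpmul2l => //; rewrite lee_fin mulr_ge0 ?powR_ge0// ltW.
rewrite muP2 !muleA -!EFinM; apply: lee_wpmul2r => //; rewrite lee_fin.
have -> : 2 * 3 ^+ n * (l `^ r)^-1 * (c * 2 `^ th) * l `^ r * 2 ^+ n =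
   (l `^ r)^-1 * l `^ r * (2 * 3 ^+ n * (c * 2 `^ th) * 2 ^+ n) by ring.
by rewrite mulVf ?mul1r// gt_eqF.
Qed.

(** For finite [q0], each level costs a fixed [eps / 2] plus [kap] times its term in the sum of
    [hot_strong]. That sum is bounded independently of [L], so for large [L] its share per level is
    at most [eps / 2]. *)
Lemma hot_sum (eps : R) : 0 < eps -> exists2 L : nat, (0 < L)%N &
  forall Q d k u (l : R), measurable_fun setT u -> 0 < l ->
  (normavg mu q0 (cubeset (dil2 1 (dcell Q d k))) u <= l%:E)%E ->
  (\sum_(1 <= m < L.+1) (((2 ^+ m) `^ q)%:E *
     nu (hotregion Q d k (hot mu p Q u (2 ^+ m * l)))) <=
   (eps * L%:R)%:E * nu (cells Q (d, k)))%E.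
Proof.
move=> eps0; case: nuq0 => [->|[r [rho [C [-> qr C0 hrho hC]]]]].
  (* For [q0 = +oo] one level suffices: [|u| <= l] a.e. on [2P] keeps all averages below [2 l], so
     nothing is hot. *)
  exists 1%N => // Q d k u l mu_ l0 hl; rewrite big_nat1 mulr1.
  rewrite (_ : hotregion _ _ _ _ = set0) ?measure0 ?mule0 ?mule_ge0 ?lee_fin ?(ltW eps0)//.
  apply/seteqP; split => // x [xk [e [j [_ _ jP]]]]; rewrite /hot expr1 => hj.
  have hN : (normavg mu +oo%E (cubeset (dcell Q e j)) u <= l%:E)%E.
    apply/lee_addgt0Pr => b b0.
    have [s /= hs st] : exists2 s, mu (cubeset (dil2 1 (dcell Q d k)) `&`
        [set x | (s < (`|u x|)%:E)%E]) = 0%E & (s < l%:E + b%:E)%E.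
      have : (esssup_on mu (cubeset (dil2 1 (dcell Q d k))) u < l%:E + b%:E)%E.
        by apply: (le_lt_trans hl); rewrite -EFinD lte_fin ltrDl.
      by move=> /ereal_inf_lt[s h1 h2]; exists s.
    apply: ge_ereal_inf; exists s; last exact: ltW.
    apply: subset_measure0 hs.
    - by apply: measurableI; [exact: measurable_cubeset|exact: measurable_above].
    - by apply: measurableI; [exact: measurable_cubeset|exact: measurable_above].
    - by move=> y [/jP].
  have poo : (p%:E <= +oo)%E by rewrite leey.
  have l2 : 0 <= 2 * l by rewrite mulr_ge0// ltW.
  have := integral_le_normavg hmu p0 l2 (normavg_le_exponent hmu p1 poo mu_ l0 hN).
  by rewrite leNgt hj.
have pr : p < r by exact: lt_trans qr.
have [Cs Cs0 hCs] := hot_strong pr.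
have rho1 : 0 < rho - 1.
  have : (r - q) * (rho - 1) = q by rewrite -[rho - 1]opprB mulrN hrho opprK.
  by move=> e; rewrite -(pmulr_rgt0 _ (_ : 0 < r - q)) ?e// subr_gt0.
(* The solution of [C kap^(1 - rho) = eps / 2]. With [tau = kap (2^m)^(r - q)], the second term of
   the comparison, weighted by [(2^m)^q], is the same at every level. *)
pose kap := (2 * C / eps) `^ (rho - 1)^-1.
have b0 : 0 < 2 * C / eps by rewrite divr_gt0// mulr_gt0.
have kap0 : 0 < kap by exact: powR_gt0.
have kapE : C * kap `^ (1 - rho) = eps / 2.
  rewrite /kap -powRrM -[1 - rho]opprB mulrN mulVf ?gt_eqF// powR_inv1 ?(ltW b0)//.
  by field; rewrite !gt_eqF.
pose L := (Num.trunc (2 * kap * Cs / eps)).+1.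
have hL : kap * Cs <= eps / 2 * L%:R.
  have h0 : 0 <= 2 * kap * Cs / eps by rewrite divr_ge0 ?mulr_ge0// ltW.
  have /truncn_itv/andP[_ /ltW] := h0; rewrite -/L ler_pdivrMr//; lra.
exists L => // Q d k u l mu_ l0 hl; have {}hCs := hCs Q d k u l L mu_ l0 hl.
pose E m := hotregion Q d k (hot mu p Q u (2 ^+ m * l)).
have mE m : measurable (E m) by exact: (dopen_measurable (@hotregion_dopen _ _ Q d k _)).
have EP m : E m `<=` cells Q (d, k) by exact: hotregion_sub.
have mP := @measurable_cells _ _ Q (d, k).
pose v := (side Q / 2 ^+ d) ^+ n.
have v0 : 0 < v by rewrite exprn_gt0// divr_gt0 ?side_gt0// exprn_gt0.
have muP : mu (cells Q (d, k)) = v%:E by exact: mu_cell.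
have muE m : mu (E m) \is a fin_num.
  by rewrite ge0_fin_numE// (le_lt_trans (measure_mono mu (mE m) mP (@EP m)))// muP ltry.
pose z m := fine (mu (E m)) / v.
have zE m : mu (E m) = ((z m)%:E * mu (cells Q (d, k)))%E.
  by rewrite muP -EFinM /z mulfVK ?fineK// gt_eqF.
have z0 m : 0 <= z m by rewrite divr_ge0 ?fine_ge0 ?(ltW v0).
have hz : \sum_(1 <= m < L.+1) (2 ^+ m) `^ r * z m <= Cs.
  rewrite -(ler_pM2r v0) -lee_fin [leRHS]EFinM -muP; apply: le_trans hCs.
  rewrite mulr_suml -sumEFin; apply: lee_sum => m _.
  by rewrite -/(E m) zE muP -EFinM lee_fin -mulrA.
have hE m : (((2 ^+ m) `^ q)%:E * nu (E m) <=
    (kap * ((2 ^+ m) `^ r * z m) + eps / 2)%:E * nu (cells Q (d, k)))%E.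
  have y0 : 0 < (2 ^+ m : R) by rewrite exprn_gt0.
  have tau0 : 0 < kap * (2 ^+ m) `^ (r - q) by rewrite mulr_gt0// powR_gt0.
  have muz : (mu (E m) <= (z m)%:E * mu (cells Q (d, k)))%E by rewrite {1}zE.
  have := hC (dcell Q d k) (E m) (z m) _ (mE m) (@EP m) tau0 muz.
  have y1 : 0 <= (2 ^+ m) `^ q :> R by rewrite powR_ge0.
  move=> h; apply: (le_trans (lee_wpmul2l _ h)); first by rewrite lee_fin.
  rewrite muleA -EFinM; apply: lee_wpmul2r => //; rewrite lee_fin.
  rewrite [(kap * _) `^ _]powRM ?powR_ge0 ?(ltW kap0)// -powRrM hrho.
  rewrite mulrDr lerD//.
    have -> : (2 ^+ m) `^ r = (2 ^+ m) `^ q * (2 ^+ m) `^ (r - q) :> R.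
      by rewrite -powRD_pos// addrC subrK.
    lra.
  rewrite -kapE.
  have e : (2 ^+ m) `^ q * (2 ^+ m) `^ (- q) = 1 :> R by rewrite -powRD_pos// subrr powRr0.
  have -> : (2 ^+ m) `^ q * (C * (kap `^ (1 - rho) * (2 ^+ m) `^ (- q))) =
    ((2 ^+ m) `^ q * (2 ^+ m) `^ (- q)) * (C * kap `^ (1 - rho)) :> R by ring.
  by rewrite e mul1r.
apply: (@le_trans _ _ (\sum_(1 <= m < L.+1)
   (kap * ((2 ^+ m) `^ r * z m) + eps / 2)%:E * nu (cells Q (d, k)))%E).
  by apply: lee_sum => m _; exact: hE.
rewrite -ge0_sume_distrl; last first.
  move=> m _; rewrite lee_fin addr_ge0 ?divr_ge0 ?(ltW eps0)// mulr_ge0 ?(ltW kap0)//.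
  by rewrite mulr_ge0// powR_ge0.
apply: lee_wpmul2r => //; rewrite sumEFin lee_fin big_split/= -mulr_sumr.
rewrite big_const_nat iter_addr_0 subSS subn0 -[(eps / 2) *+ L]mulr_natr.
have := ler_wpM2l (ltW kap0) hz; move: (\sum_(1 <= m < L.+1) _) => S hS.
have -> : eps * L%:R = eps / 2 * L%:R + eps / 2 * L%:R by field.
by rewrite lerD2r (le_trans hS).
Qed.

(** Multiplied by [(2^m0 t)^q], the conclusion says that the contributions of the cell to phi at the
    [L] higher levels are on average at most half of [t^q nu P]. *)
Lemma good_lambda_cell (K : R) : 0 < K -> exists (m0 L : nat) (eta : R),
  [/\ (0 < L)%N, 0 < eta & forall Q h d k (t A : R) (v1 v2 v3 : RnB R n -> R),
    measurable_fun setT h -> measurable_fun setT v1 -> measurable_fun setT v2 ->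
    measurable_fun setT v3 -> 0 < t -> (0 < d)%N ->
    (forall y, cells Q (d, k) y -> forall e, (e < d)%N -> ~ bad mu p Q h t e (didx Q e y)) ->
    aeeq mu h (fun y => v1 y + v2 y + v3 y) ->
    (normavg mu q0 (cubeset (dil2 1 (dcell Q d k))) v1 <= (K * t)%:E)%E ->
    (normavg mu q0 (cubeset (dil2 1 (dcell Q d k))) v2 <= (K * t)%:E)%E ->
    (normavg mu p%:E (cubeset (dil2 1 (dcell Q d k))) v3 <= (K * A)%:E)%E ->
    A < eta * t ->
    (\sum_(m < L) (((2 ^+ m.+1) `^ q)%:E *
       nu (cells Q (d, k) `&` badset mu p Q h (2 ^+ (m0 + m.+1) * t))) <=
     (L%:R / (2 * (2 ^+ m0) `^ q))%:E * nu (cells Q (d, k)))%E].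
Proof.
move=> K0.
(* [2^m0] must beat [2^n] and [64 K]: then [l = 2^m0 t / 64] bounds the first two pieces, and 64
   exceeds the 36 of [hot_of_bad]. *)
pose m0 := maxn n (Num.trunc (64 * K)).+1.
have hm0 : 64 * K <= 2 ^+ m0.
  have h0 : 0 <= 64 * K by rewrite mulr_ge0// ltW.
  have /truncn_itv/andP[_ /ltW h1] := h0; apply: (le_trans h1).
  apply: (@le_trans _ _ m0%:R); first by rewrite ler_nat leq_maxr.
  by rewrite -natrX ler_nat ltnW// ltn_expl.
have nm0 : 2 ^+ n <= 2 ^+ m0 :> R by rewrite ler_eXn2l ?ltr1n// leq_maxl.
pose Y : R := (2 ^+ m0) `^ q.
have Y0 : 0 < Y by rewrite powR_gt0// exprn_gt0.
(* Three pieces, each with total [eps L], add up to [L / (2 Y)]. *)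
pose eps := (6 * Y)^-1; have eps0 : 0 < eps by rewrite invr_gt0 mulr_gt0.
have [L L0 hL] := hot_sum eps0.
pose Z : R := (2 ^+ L) `^ q; have Z0 : 0 < Z by rewrite powR_gt0// exprn_gt0.
have [del del0 hdel] := nucells (divr_gt0 eps0 Z0).
have six : 0 < 6 ^+ n :> R by rewrite exprn_gt0.
(* Small enough that the hot region of the third piece has density at most [del] at every level; the
   division of [eps] by [Z] offsets the weights [(2^(m+1))^q]. *)
pose eta := Num.min 1 (del / 6 ^+ n).
have eta0 : 0 < eta by rewrite lt_min ltr01 divr_gt0.
have eta1 : eta <= 1 by rewrite ge_min lexx.
have etad : 6 ^+ n * eta <= del by rewrite mulrC -ler_pdivlMr// ge_min lexx orbT.
exists m0, L, eta; split => // Q h d k t A v1 v2 v3 mh mv1 mv2 mv3 t0 d0 anc hv n1 n2 n3 At.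
pose l := 2 ^+ m0 * t / 64.
have l0 : 0 < l by rewrite divr_gt0// mulr_gt0// exprn_gt0.
have Kt : K * t <= l.
  by rewrite /l ler_pdivlMr//; have := ler_wpM2r (ltW t0) hm0; lra.
have KA : K * A <= eta * l.
  have := ler_wpM2l (ltW K0) (ltW At); have := ler_wpM2l (ltW eta0) Kt; lra.
have el0 : 0 <= eta * l by rewrite mulr_ge0// ltW.
pose H v m := hotregion Q d k (hot mu p Q v (2 ^+ m * l)).
have mH v m : measurable (H v m) by exact: (dopen_measurable (@hotregion_dopen _ _ Q d k _)).
have mP := @measurable_cells _ _ Q (d, k).
have nP : nu (cells Q (d, k)) \is a fin_num by rewrite ge0_fin_numE//; exact: nuoo.
have s1 v : measurable_fun setT v ->
    (normavg mu q0 (cubeset (dil2 1 (dcell Q d k))) v <= (K * t)%:E)%E ->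
    (\sum_(m < L) (((2 ^+ m.+1) `^ q)%:E * nu (H v m.+1)) <=
      (eps * L%:R)%:E * nu (cells Q (d, k)))%E.
  move=> mv hn; have hn' : (normavg mu q0 (cubeset (dil2 1 (dcell Q d k))) v <= l%:E)%E.
    by apply: (le_trans hn); rewrite lee_fin.
  by have := hL Q d k v l mv l0 hn'; rewrite big_add1 /= big_mkord.
have s3 : (\sum_(m < L) (((2 ^+ m.+1) `^ q)%:E * nu (H v3 m.+1)) <=
      (eps * L%:R)%:E * nu (cells Q (d, k)))%E.
  have n3' : (normavg mu p%:E (cubeset (dil2 1 (dcell Q d k))) v3 <= (eta * l)%:E)%E.
    by apply: (le_trans n3); rewrite lee_fin.
  apply: (@le_trans _ _ (\sum_(m < L) (eps%:E * nu (cells Q (d, k))))%E); last first.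
    rewrite -ge0_sume_distrl; last by move=> _ _; rewrite lee_fin ltW.
    by rewrite sumEFin sumr_const card_ord -[eps *+ L]mulr_natr.
  apply: lee_sum => m _.
  have p2 : 1 <= 2 ^+ m.+1 :> R by rewrite exprn_ege1// ler1n.
  have l2 : 0 < 2 ^+ m.+1 * l by rewrite mulr_gt0// exprn_gt0.
  have := hot_measure hmu p1 el0 l2 mv3 n3'; rewrite -/(H v3 m.+1) => hh.
  have {}hh : (nu (H v3 m.+1) <= (eps / Z)%:E * nu (cells Q (d, k)))%E.
    apply: hdel; [exact: hotregion_dopen|exact: hotregion_sub|].
    apply: (le_trans hh); apply: lee_wpmul2r => //; rewrite lee_fin.
    apply: le_trans etad; apply: ler_wpM2l; first exact: ltW.
    have ratio : eta * l / (2 ^+ m.+1 * l) <= eta.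
      rewrite -mulf_div divff ?gt_eqF// mulr1 ler_pdivrMr ?exprn_gt0//.
      by rewrite ler_peMr// ltW.
    apply: (@le_trans _ _ (eta `^ p)).
      by apply: powR_le; rewrite ?divr_ge0 ?(ltW l2)//; exact: ltW.
    by apply: ge1r_powR => //; rewrite eta0.
  apply: (le_trans (lee_wpmul2l _ hh)); first by rewrite lee_fin powR_ge0.
  rewrite muleA -EFinM; apply: lee_wpmul2r => //; rewrite lee_fin.
  rewrite mulrA ler_pdivrMr// mulrC ler_wpM2l ?(ltW eps0)//.
  by apply: powR_le; rewrite ?exprn_ge0// ?(ltW q_gt0)// ler_eXn2l ?ltr1n.
apply: (@le_trans _ _ (\sum_(m < L) (((2 ^+ m.+1) `^ q)%:E * nu (H v1 m.+1)) +
   \sum_(m < L) (((2 ^+ m.+1) `^ q)%:E * nu (H v2 m.+1)) +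
   \sum_(m < L) (((2 ^+ m.+1) `^ q)%:E * nu (H v3 m.+1)))%E); last first.
  apply: (le_trans (leeD (leeD (s1 v1 mv1 n1) (s1 v2 mv2 n2)) s3)).
  have eL : 0 <= eps * L%:R by rewrite mulr_ge0 ?(ltW eps0).
  rewrite -!ge0_muleDl ?lee_fin ?addr_ge0//.
  apply: lee_wpmul2r => //; rewrite -!EFinD lee_fin /eps -/Y.
  by rewrite le_eqVlt; apply/orP; left; apply/eqP; field; rewrite gt_eqF.
rewrite -!big_split /=; apply: lee_sum => m _.
rewrite -!ge0_muleDr ?adde_ge0//; apply: lee_wpmul2l; first by rewrite lee_fin powR_ge0.
apply: (@le_trans _ _ (nu (H v1 m.+1 `|` H v2 m.+1 `|` H v3 m.+1))); last first.
  apply: (@le_trans _ _ (nu (H v1 m.+1 `|` H v2 m.+1) + nu (H v3 m.+1))%E).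
    by apply: measureU2 => //; exact: measurableU.
  by apply: (leeD _ (lexx _)); exact: measureU2.
apply: measure_mono.
- by apply: measurableI => //; exact: measurable_badset.
- by apply: measurableU => //; exact: measurableU.
move=> x [xP xb].
have TE : 2 ^+ (m0 + m.+1) * t = 64 * (2 ^+ m.+1 * l).
  by rewrite exprD /l; field.
have l2 : 0 < 2 ^+ m.+1 * l by rewrite mulr_gt0// exprn_gt0.
have T0 : 0 <= 2 ^+ m0 * t by rewrite mulr_ge0// ?exprn_ge0// ltW.
have Tm : 2 ^+ m0 * t <= 2 ^+ (m0 + m.+1) * t.
  by rewrite ler_wpM2r ?(ltW t0)// ler_eXn2l ?ltr1n// leq_addr.
have tT : t <= 2 ^+ (m0 + m.+1) * t by rewrite ler_peMl ?(ltW t0)// exprn_ege1// ler1n.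
have sT : 36 * (2 ^+ m.+1 * l) <= 2 ^+ (m0 + m.+1) * t by rewrite TE; lra.
have nT : 2 ^+ n * t <= 2 ^+ (m0 + m.+1) * t.
  by apply: le_trans Tm; rewrite ler_wpM2r ?(ltW t0).
case: (hot_of_bad hmu p1 mh (ltW t0) tT l2 sT nT d0 mv1 mv2 mv3 hv anc xP xb) => hx.
- by left; left.
- by left; right.
- by right.
Qed.

(** The interface with the operators; [A d k] stands for a~ of the cell. *)
Definition stopping_decomposition Q h (A : nat -> 'rV[int]_n -> R) (K lam : R) : Prop :=
  forall t d k, lam <= t -> (0 < d)%N ->
  cells Q (d, k) `<=` cubeset Q ->
  (forall y, cells Q (d, k) y -> forall e, (e < d)%N -> ~ bad mu p Q h t e (didx Q e y)) ->
  exists v1 v2 v3 : RnB R n -> R,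
  [/\ measurable_fun setT v1, measurable_fun setT v2, measurable_fun setT v3 &
   [/\ aeeq mu h (fun y => v1 y + v2 y + v3 y),
     (normavg mu q0 (cubeset (dil2 1 (dcell Q d k))) v1 <= (K * t)%:E)%E,
     (normavg mu q0 (cubeset (dil2 1 (dcell Q d k))) v2 <= (K * t)%:E)%E &
     (normavg mu p%:E (cubeset (dil2 1 (dcell Q d k))) v3 <= (K * A d k)%:E)%E]].

(** What [D_q] provides for a~ on disjoint cells of [Q]: a weak-type bound, with [D] of size
    a~(2Q)^q w(Q). *)
Definition level_bound Q (A : nat -> 'rV[int]_n -> R) (D : R) : Prop :=
  forall (S : set (nat * 'rV[int]_n)) (s : R), 0 < s ->
  trivIset S (cells Q) -> (forall i, S i -> cells Q i `<=` cubeset Q) ->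
  (forall i, S i -> s <= A i.1 i.2) ->
  ((s `^ q)%:E * nu (\bigcup_(i in S) cells Q i) <= D%:E)%E.

Section Data.
Variables (Q : cube R n) (h : RnB R n -> R) (A : nat -> 'rV[int]_n -> R) (K lam D : R).
Hypotheses (mh : measurable_fun setT h) (lam0 : 0 < lam).
Hypothesis root : ~ bad mu p Q h lam 0 0.
Hypothesis decomposition : stopping_decomposition Q h A K lam.
Hypothesis level : level_bound Q A D.

Let bs t := badset mu p Q h t.

(** The stopping cells at level [t] are split according to [A < eta t]. The cell estimate handles
    those below; those above are few by [level_bound]. *)
Lemma good_lambda_step (m0 L : nat) (eta t : R) :
  (forall d k (t A : R) (v1 v2 v3 : RnB R n -> R),
    measurable_fun setT v1 -> measurable_fun setT v2 ->
    measurable_fun setT v3 -> 0 < t -> (0 < d)%N ->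
    (forall y, cells Q (d, k) y -> forall e, (e < d)%N -> ~ bad mu p Q h t e (didx Q e y)) ->
    aeeq mu h (fun y => v1 y + v2 y + v3 y) ->
    (normavg mu q0 (cubeset (dil2 1 (dcell Q d k))) v1 <= (K * t)%:E)%E ->
    (normavg mu q0 (cubeset (dil2 1 (dcell Q d k))) v2 <= (K * t)%:E)%E ->
    (normavg mu p%:E (cubeset (dil2 1 (dcell Q d k))) v3 <= (K * A)%:E)%E ->
    A < eta * t ->
    (\sum_(m < L) (((2 ^+ m.+1) `^ q)%:E *
       nu (cells Q (d, k) `&` badset mu p Q h (2 ^+ (m0 + m.+1) * t))) <=
     (L%:R / (2 * (2 ^+ m0) `^ q))%:E * nu (cells Q (d, k)))%E) ->
  0 < eta -> lam <= t ->
  (\sum_(m < L) (((2 ^+ m.+1) `^ q)%:E * nu (bs (2 ^+ (m0 + m.+1) * t))) <=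
   (L%:R / (2 * (2 ^+ m0) `^ q))%:E * nu (bs t) +
   (L%:R * (2 ^+ L) `^ q * ((eta * t) `^ q)^-1 * D)%:E)%E.
Proof.
move=> hcell eta0 lt_; have t0 : 0 < t by exact: lt_le_trans lt_.
have mB s : measurable (bs s) by exact: measurable_badset.
pose pp e j := cells Q (e, j) `<=` cubeset Q /\ bad mu p Q h t e j.
pose M := maxcells Q 0 pp.
have tM : trivIset M (cells Q) := @maxcells_triv _ _ Q 0 pp.
have MB : bs t `<=` \bigcup_(i in M) cells Q i.
  move=> x [Qx [e be]]; have [|f _ Mf] := @maxcells_cover _ _ Q 0 pp e x (leq0n e).
    split => // y /dcellP /= yx; apply/didx0P.
    by rewrite (didx_le (leq0n e) yx); apply/didx0P.
  by exists (f, didx Q f x) => //; exact: dcell_self.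
have BM i : M i -> cells Q i `<=` bs t.
  case: i => d k [/= _ [sub bk] _] x xk; split; first exact: sub.
  by exists d; move: xk => /dcellP /= ->.
have Mprop d k : M (d, k) -> [/\ (0 < d)%N, cells Q (d, k) `<=` cubeset Q &
    forall y, cells Q (d, k) y -> forall e, (e < d)%N -> ~ bad mu p Q h t e (didx Q e y)].
  move=> [/= _ [sub bk] anc]; split; [|exact: sub|].
  (* Generation 0 means [Q] itself, which [root] and monotonicity declare good at level [t]. *)
  - case: d sub bk anc => [|d] sub bk _; last exact: ltn0Sn.
    exfalso; apply: root.
    have [x xk] := cell_nonempty Q (0%N, k).
    have : didx Q 0 x = 0 by apply/didx0P; exact: sub.
    move: xk => /dcellP /= -> k0; move: bk; rewrite k0.
    exact: (bad_mono p1 (ltW lam0) lt_).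
  - move=> y yk e ed be; apply: (anc y yk e ed); split => // z /dcellP /= zy.
    apply/didx0P; rewrite (didx_le (leq0n e) zy); apply/didx0P; exact: sub.
pose M1 := M `&` [set i | A i.1 i.2 < eta * t].
pose M2 := M `&` [set i | eta * t <= A i.1 i.2].
pose U1 := \bigcup_(i in M1) cells Q i; pose U2 := \bigcup_(i in M2) cells Q i.
have mU1 : measurable (U1 : set (RnB R n)).
  by apply: countable_bigcup_measurable => i _; exact: measurable_cells.
have mU2 : measurable (U2 : set (RnB R n)).
  by apply: countable_bigcup_measurable => i _; exact: measurable_cells.
have tM1 : trivIset M1 (cells Q) by apply: sub_trivIset tM => i [].
have tM2 : trivIset M2 (cells Q) by apply: sub_trivIset tM => i [].
pose tm m := 2 ^+ (m0 + m.+1) * t.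
(* All [L] levels are packed into one measure, so that a single localisation treats them
   together. *)
pose m1 : {measure set (RnB R n) -> \bar R} := msum (fun m => mscale (NngNum (powR_ge0 (2 ^+ m.+1) q))
   (mrestr nu (mB (tm m)))) L.
have m1E E : m1 E = (\sum_(m < L) (((2 ^+ m.+1) `^ q)%:E * nu (E `&` bs (tm m))))%E.
  by [].
have b1 : (m1 U1 <= (L%:R / (2 * (2 ^+ m0) `^ q))%:E * nu (bs t))%E.
  apply: (@le_trans _ _ ((L%:R / (2 * (2 ^+ m0) `^ q))%:E * nu U1)%E).
    apply: (@local_le _ _ _ m1 nu _ M1 (cells Q)).
    - by rewrite divr_ge0// mulr_ge0// powR_ge0.
    - by move=> i _; exact: measurable_cells.
    - exact: tM1.
    - exact: mU1.
    - exact: subset_refl.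
    - case=> d k [/Mprop[d0 sub anc] /= Ak].
      have [v1 [v2 [v3 [mv1 mv2 mv3 [hv n1 n2 n3]]]]] := decomposition lt_ d0 sub anc.
      apply: le_trans (hcell d k t (A d k) v1 v2 v3 mv1 mv2 mv3 t0 d0 anc hv n1 n2 n3 Ak).
      rewrite m1E; apply: lee_sum => m _; apply: lee_wpmul2l.
        by rewrite lee_fin powR_ge0.
      apply: measure_mono.
      + apply: measurableI => //; apply: measurableI => //; exact: measurable_cells.
      + by apply: measurableI => //; exact: measurable_cells.
      + by move=> x [[_ xk] xb].
  apply: lee_wpmul2l; first by rewrite lee_fin divr_ge0// mulr_ge0// powR_ge0.
  by apply: measure_mono => // x [i [Mi _]]; exact: BM.
have et0 : 0 < eta * t by rewrite mulr_gt0.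
have b2 : (m1 U2 <= (L%:R * (2 ^+ L) `^ q * ((eta * t) `^ q)^-1 * D)%:E)%E.
  have lb : (nu U2 <= (((eta * t) `^ q)^-1 * D)%:E)%E.
    have := @level M2 (eta * t) et0 tM2.
    rewrite EFinM lee_pdivlMl ?powR_gt0//; apply.
    - by case=> d k [/Mprop[]].
    - by case=> d k [].
  apply: (@le_trans _ _ (\sum_(m < L) ((2 ^+ L) `^ q * (((eta * t) `^ q)^-1 * D))%:E)%E).
    rewrite m1E; apply: lee_sum => m _; rewrite [leRHS]EFinM; apply: lee_pmul => //.
    - rewrite lee_fin powR_le ?exprn_ge0// ?(ltW q_gt0)//.
      by rewrite ler_eXn2l ?ltr1n.
    - by apply: le_trans lb; apply: measure_mono => //; exact: measurableI.
  by rewrite sumEFin sumr_const card_ord -[_ *+ L]mulr_natl lee_fin !mulrA.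
apply: (@le_trans _ _ (m1 (U1 `|` U2))).
  rewrite m1E; apply: lee_sum => m _; apply: lee_wpmul2l; first by rewrite lee_fin powR_ge0.
  apply: measure_mono => //; first by apply: measurableI => //; exact: measurableU.
  move=> x xb; split => //.
  have xt : bs t x.
    apply: badset_mono xb => //; first exact: ltW.
    by rewrite ler_peMl ?(ltW t0)// exprn_ege1// ler1n.
  have [i Mi xi] := MB x xt; case: (ltP (A i.1 i.2) (eta * t)) => hA.
    by left; exists i.
  by right; exists i.
apply: (@le_trans _ _ (m1 U1 + m1 U2)%E); first exact: measureU2.
exact: leeD.
Qed.

End Data.

(** The constant depends on [K] and the measures but not on [Q], [h], [A], [lam] or [D], which gives
    uniformity over all cubes and functions. *)
Lemma good_lambda (K : R) : 0 < K -> exists2 C : R, 0 < C &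
  forall (Q : cube R n) (h : RnB R n -> R) (A : nat -> 'rV[int]_n -> R) (lam D : R),
  measurable_fun setT h -> 0 < lam -> 0 <= D -> ~ bad mu p Q h lam 0 0 ->
  stopping_decomposition Q h A K lam -> level_bound Q A D ->
  forall t, 0 < t -> ((t `^ q)%:E * nu (cubeset Q `&` above h t) <=
    (C * (lam `^ q * fine (nu (cubeset Q)) + D))%:E)%E.
Proof.
have halves (x z : R) : 0 <= x -> (x + 2 * z) / 2 + z <= x + 2 * z by move=> ?; lra.
have final (a c B D : R) : 0 <= a -> 0 <= c -> 0 <= B -> 0 <= D ->
    B + a * (B + 2 * (c * D)) <= (1 + a * (1 + 2 * c)) * (B + D).
  move=> a0 c0 B0 D0; have := mulr_ge0 a0 (mulr_ge0 c0 B0); have := mulr_ge0 a0 D0; lra.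
have pw0 (x : R) : 0 <= x `^ q by exact: powR_ge0.
move=> K0; have [m0 [L [eta [L0 eta0 hcell]]]] := good_lambda_cell K0.
pose Y : R := (2 ^+ m0) `^ q; have Y0 : 0 < Y by rewrite powR_gt0// exprn_gt0.
pose Z : R := (2 ^+ L) `^ q; have Z0 : 0 < Z by rewrite powR_gt0// exprn_gt0.
pose W : R := (4 ^+ n.+1) `^ q; have W0 : 0 < W by rewrite powR_gt0// exprn_gt0.
pose V : R := (2 ^+ (m0 + L)) `^ q; have V0 : 0 < V by rewrite powR_gt0// exprn_gt0.
pose c1 := Y * Z * (eta `^ q)^-1.
have c10 : 0 < c1 by rewrite !mulr_gt0// invr_gt0 powR_gt0.
have two0 : 0 < 2 `^ q :> R by rewrite powR_gt0.
exists (W * (1 + 2 `^ q * V * (1 + 2 * c1))).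
  by rewrite mulr_gt0// addr_gt0// !mulr_gt0// addr_gt0// mulr_gt0.
move=> Q h A lam D mh lam0 D0 root dec lev t t0.
pose bs s := badset mu p Q h s.
have mB s : measurable (bs s) by exact: measurable_badset.
have mQ := measurable_cubeset Q.
have bQ s : (nu (bs s) <= nu (cubeset Q))%E by apply: measure_mono => // x [].
have fQ : nu (cubeset Q) \is a fin_num by rewrite ge0_fin_numE.
have fB s : nu (bs s) \is a fin_num by rewrite ge0_fin_numE// (le_lt_trans (bQ s)).
pose b s := fine (nu (bs s)); pose y := fine (nu (cubeset Q)).
have b0 s : 0 <= b s by rewrite fine_ge0.
have y0 : 0 <= y by rewrite fine_ge0.
have byQ s : b s <= y by rewrite -lee_fin !fineK.
have bm s s' : 0 <= s -> s <= s' -> b s' <= b s.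
  by move=> s0 ss; rewrite -lee_fin !fineK//; apply: measure_mono => //; exact: badset_mono.
(* A bound preserved by the step: it dominates phi at the first level, and [X / 2 + c1 D <= X]. *)
pose X := lam `^ q * y + 2 * (c1 * D).
have lq0 : 0 <= lam `^ q * y by rewrite mulr_ge0// powR_ge0.
have cD0 : 0 <= c1 * D by rewrite mulr_ge0// ltW.
have l0 j : 0 < 2 ^+ j * lam by rewrite mulr_gt0// exprn_gt0.
pose phi j := (2 ^+ j * lam) `^ q * b (2 ^+ j * lam).
have phi0 j : 0 <= phi j by rewrite mulr_ge0// powR_ge0.
(* Pigeonhole: if all [L] levels exceeded this bound, so would their average. *)
have step j : exists2 m, (m < L)%N & phi (j + m0 + m.+1)%N <= phi j / 2 + c1 * D.
  apply: contrapT => nex.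
  have gt m : (m < L)%N -> phi j / 2 + c1 * D < phi (j + m0 + m.+1)%N.
    by move=> mL; rewrite ltNge; apply/negP => h1; apply: nex; exists m.
  have lt_ : lam <= 2 ^+ j * lam by rewrite ler_peMl ?(ltW lam0)// exprn_ege1// ler1n.
  have := good_lambda_step lam0 root dec lev
    (fun d k t A v1 v2 v3 => hcell Q h d k t A v1 v2 v3 mh) eta0 lt_.
  have e2 m : 2 ^+ (m0 + m.+1) * (2 ^+ j * lam) = 2 ^+ (j + m0 + m.+1) * lam.
    by rewrite mulrA -exprD (addnC _ j) addnA.
  have -> : (\sum_(m < L) (((2 ^+ m.+1) `^ q)%:E *
      nu (badset mu p Q h (2 ^+ (m0 + m.+1) * (2 ^+ j * lam)))))%E =
      (\sum_(m < L) (2 ^+ m.+1) `^ q * b (2 ^+ (j + m0 + m.+1) * lam))%:E.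
    rewrite -sumEFin; apply: eq_bigr => m _; rewrite EFinM e2; congr (_ * _)%E.
    by rewrite fineK.
  rewrite -[nu _](fineK (fB _)) -EFinM -EFinD lee_fin -/(b _) => hs.
  have T0 : 0 < (2 ^+ j * lam) `^ q by exact: powR_gt0.
  have YT : 0 < Y * (2 ^+ j * lam) `^ q by rewrite mulr_gt0.
  have := ler_wpM2l (ltW YT) hs; rewrite mulr_sumr.
  have -> : \sum_(m < L) Y * (2 ^+ j * lam) `^ q *
      ((2 ^+ m.+1) `^ q * b (2 ^+ (j + m0 + m.+1) * lam)) = \sum_(m < L) phi (j + m0 + m.+1)%N.
    apply: eq_bigr => m _; rewrite /phi -[in RHS]e2.
    rewrite (exprD _ m0) [in RHS]powRM ?mulr_ge0 ?exprn_ge0 ?(ltW lam0)//.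
    rewrite [(2 ^+ m0 * _) `^ q]powRM ?exprn_ge0// -/Y -exprD e2; ring.
  have gtsum : L%:R * (phi j / 2 + c1 * D) < \sum_(m < L) phi (j + m0 + m.+1)%N.
    have -> : L%:R * (phi j / 2 + c1 * D) = \sum_(m < L) (phi j / 2 + c1 * D).
      by rewrite sumr_const card_ord mulr_natl.
    apply: ltr_sum; first by apply/hasP; exists (Ordinal L0); rewrite ?mem_index_enum.
    by move=> m _; exact: gt.
  rewrite leNgt => /negP; apply; apply: le_lt_trans gtsum.
  rewrite [(eta * _) `^ q]powRM ?(ltW eta0) ?(ltW (l0 j))// -/Y -/Z /phi /c1.
  have eq0 : eta `^ q != 0 by rewrite gt_eqF// powR_gt0.
  rewrite le_eqVlt; apply/orP; left; apply/eqP; field.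
  by rewrite eq0 !gt_eqF.
have X0 : 0 <= X by rewrite addr_ge0// mulr_ge0.
(* Climbing from level 0, every window of length [m0 + L] contains a level with phi at most [X]. *)
have phiX N : exists i, [/\ (N <= i)%N, (i <= N + (m0 + L))%N & phi i <= X].
  elim: N => [|N [i [Ni iN iX]]].
    exists 0%N; split => //; rewrite /phi expr0 mul1r /X.
    apply: (@le_trans _ _ (lam `^ q * y)); first by rewrite ler_wpM2l ?powR_ge0.
    by rewrite lerDl mulr_ge0.
  have [Ni1|] := leqP N.+1 i; first by exists i; split => //; rewrite addSn ltnW.
  rewrite ltnS => iN1; have -> : N = i by apply/eqP; rewrite eqn_leq Ni iN1.
  have [m mL hm] := step i; exists (i + m0 + m.+1)%N; split.
  - by rewrite -addnA -addn1 leq_add2l addnS.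
  - by rewrite -addnA addSn leqW// leq_add2l leq_add2l.
  - apply: (le_trans hm); apply: le_trans (halves _ (c1 * D) lq0).
    by rewrite lerD2r ler_wpM2r ?invr_ge0.
(* The bad sets decrease, so between good levels phi grows at most by the power [(2^(j-i))^q], with
   [j - i <= m0 + L]. *)
have phiV j : phi j <= V * X.
  have [|jV] := leqP (m0 + L) j.
    move=> hj; have [i [ji ij iX]] := phiX (j - (m0 + L))%N.
    rewrite subnK// in ij.
    have -> : phi j = (2 ^+ (j - i)) `^ q * ((2 ^+ i * lam) `^ q * b (2 ^+ j * lam)).
      rewrite mulrA -powRM ?exprn_ge0 ?(ltW (l0 i))// mulrA -exprD subnK//.
    apply: (ler_pM (pw0 _) (mulr_ge0 (pw0 _) (b0 _))).
      rewrite /V powR_le ?exprn_ge0// ?(ltW q_gt0)// ler_eXn2l ?ltr1n//.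
      by rewrite leq_subLR addnC -leq_subLR.
    apply: le_trans iX; rewrite ler_wpM2l ?powR_ge0//; apply: bm; first exact: ltW.
    by rewrite ler_wpM2r ?(ltW lam0)// ler_eXn2l ?ltr1n.
  rewrite /phi powRM ?exprn_ge0 ?(ltW lam0)// -mulrA.
  apply: (ler_pM (pw0 _) (mulr_ge0 (pw0 _) (b0 _))).
    by rewrite /V powR_le ?exprn_ge0// ?(ltW q_gt0)// ler_eXn2l ?ltr1n// ltnW.
  apply: (@le_trans _ _ (lam `^ q * y)); first by rewrite ler_wpM2l ?powR_ge0.
  by rewrite /X lerDl mulr_ge0.
pose s := t / 4 ^+ n.+1; have s0 : 0 < s by rewrite divr_gt0// exprn_gt0.
have ts : t = 4 ^+ n.+1 * s by rewrite /s mulrC mulfVK// gt_eqF// exprn_gt0.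
(* Below [lam] the bound by [nu Q] is enough; above it, rounding [s] to a level [2^j lam] costs
   [2^q]. *)
have psi : s `^ q * b s <= lam `^ q * y + 2 `^ q * V * X.
  have VX0 : 0 <= 2 `^ q * V * X by rewrite !mulr_ge0// ltW.
  have [sl|sl] := leP s lam.
    rewrite -[leLHS]addr0 lerD//; apply: (ler_pM (pw0 _) (b0 _)); last exact: byQ.
    by apply: powR_le => //; exact: ltW.
  have [j /andP[js sj]] : exists j, 2 ^+ j * lam <= s <= 2 ^+ j.+1 * lam.
    have ex : exists j, s <= 2 ^+ j * lam.
      have r0 : 0 <= s / lam by rewrite divr_ge0 ?ltW.
      have /truncn_itv/andP[_ /ltW h1] := r0; exists (Num.trunc (s / lam)).+1.
      rewrite -ler_pdivrMr//; apply: (le_trans h1).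
      by rewrite -natrX ler_nat ltnW// ltn_expl.
    case: (ex_minnP ex) => -[|j]; first by rewrite expr0 mul1r leNgt sl.
    move=> hj hmin; exists j; rewrite hj andbT; apply/ltW; rewrite ltNge.
    by apply/negP => /hmin; rewrite ltnn.
  apply: (@le_trans _ _ (2 `^ q * phi j)).
    rewrite /phi mulrA; apply: (ler_pM (pw0 _) (b0 _)).
      rewrite -powRM ?(ltW (l0 j))// mulrA -exprS.
      by apply: powR_le; rewrite ?(ltW s0)// ltW.
    by apply: bm js; exact: ltW.
  rewrite -[leLHS]add0r lerD// -mulrA ler_wpM2l ?(ltW two0)//.
apply: (@le_trans _ _ ((t `^ q)%:E * nu (bs s))%E).
  apply: lee_wpmul2l; first by rewrite lee_fin powR_ge0.
  rewrite [in above _ _]ts; exact: above_badset.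
rewrite -[nu _](fineK (fB _)) -EFinM lee_fin -/(b _).
rewrite {1}ts powRM ?exprn_ge0 ?(ltW s0)// -/W -(mulrA W (s `^ q)) -(mulrA W (1 + _)).
apply: (ler_wpM2l (ltW W0)); apply: (le_trans psi).
exact: (final _ _ _ _ (mulr_ge0 (ltW two0) (ltW V0)) (ltW c10) lq0 D0).
Qed.

End GoodLambda.

(** * From the weight classes to the two conditions on measures *)

Section WeightMeasure.
Context (R : realType) (n : nat) (mu : {measure set (RnB R n) -> \bar R}).
Hypothesis hmu : lebesgue_on_cubes mu.
Variable w : RnB R n -> R.
Hypothesis hw : weight mu w.
Variable nu : {measure set (RnB R n) -> \bar R}.
Hypothesis nuE : forall E, nu E = wmeas mu w E.

(** A large [tau] makes [C tau^(1-p)] at most 1/4; then density [1 / (4 tau)] makes the linear term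
    1/4 as well. *)
Lemma small_of_RH (p : R) : 1 < p -> RH mu p w ->
  Ainfty_measure mu nu.
Proof.
move=> p1 hRH; have [C C0 hC] := RH_linear hmu hw nuE p1 hRH.
have pm : 0 < p - 1 by rewrite subr_gt0.
pose tau := Num.max 1 ((4 * C) `^ (p - 1)^-1).
have tau1 : 1 <= tau by rewrite le_max lexx.
have tau0 : 0 < tau by exact: lt_le_trans tau1.
have C4 : 0 < 4 * C by rewrite mulr_gt0.
have small : C * tau `^ (1 - p) <= 4^-1.
  have h : 4 * C <= tau `^ (p - 1).
    apply: (@le_trans _ _ (((4 * C) `^ (p - 1)^-1) `^ (p - 1))).
      by rewrite -powRrM mulVf ?gt_eqF// powRr1// ltW.
    apply: powR_le; rewrite ?powR_ge0 ?le_max ?lexx ?orbT//; exact: ltW.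
  rewrite -[1 - p]opprB powRN ler_pdivrMr ?powR_gt0//; lra.
exists (4 * tau)^-1, 2^-1; split => //.
- by rewrite invr_gt0 mulr_gt0.
- by rewrite invf_lt1 ?mulr_gt0//; lra.
- by rewrite invf_lt1// ltr1n.
move=> Q E mE EQ hE; apply: (le_trans (hC Q E _ _ mE EQ tau0 hE)).
apply: lee_wpmul2r => //; rewrite lee_fin.
have -> : tau * (4 * tau)^-1 = 4^-1 by rewrite invfM mulrCA divff ?gt_eqF// mulr1.
lra.
Qed.

Lemma RH_conj_small (q : R) (q0 : \bar R) : 0 < q -> (q%:E < q0)%E ->
  RH_conj mu q q0 w ->
  Ainfty_measure mu nu.
Proof.
move=> qp; case: q0 => [r| |]//=.
  rewrite lte_fin => qr; apply: small_of_RH.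
  have s1 : 1 < r / q by rewrite ltr_pdivlMr// mul1r.
  by rewrite ltr_pdivlMr ?subr_gt0// mul1r gtrBl.
move=> _ [p [_ [[_ hA]|[p1 hA]]]].
  by have [c c0 hc] := lower_A1 hmu hw nuE hA; exact: (small_of_lower hmu hw nuE c0 hc).
by have [c c0 hc] := lower_Ap hmu hw nuE p1 hA; exact: (small_of_lower hmu hw nuE c0 hc).
Qed.

Lemma RH_conj_linear (q : R) (q0 : \bar R) : 0 < q -> (q%:E < q0)%E ->
  RH_conj mu q q0 w ->
  RH_measure mu nu q q0.
Proof.
move=> qp; case: q0 => [r| |]//=; last by left.
rewrite lte_fin => qr hRH; right; set s := r / q in hRH.
have s1 : 1 < s by rewrite ltr_pdivlMr// mul1r.
have rho1 : 1 < s / (s - 1) by rewrite ltr_pdivlMr ?subr_gt0// mul1r gtrBl.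
have [C C0 hC] := RH_linear hmu hw nuE rho1 hRH.
exists r, (s / (s - 1)), C; split => //.
have rE : r = s * q by rewrite /s mulfVK// gt_eqF.
rewrite rE; field; rewrite subr_eq0 gt_eqF//.
Qed.

End WeightMeasure.

(** * Inequalities for the numbers [m_k] *)

Section StructuralConstants.
Context (R : realType) (n : nat) (p0 : R) (alpha beta : nat -> R).
Hypotheses (p01 : 1 <= p0) (ha : forall k, (2 <= k)%N -> 0 <= alpha k)
  (hb : forall k, 0 <= beta k).
Local Notation m := (mseq n p0 alpha beta).

Let e0 (k : nat) : 0 <= k%:R * n%:R / p0 :> R.
Proof. by rewrite divr_ge0// ?mulr_ge0// (le_trans _ p01). Qed.

Let pow1 (k : nat) : 1 <= 2 `^ (k%:R * n%:R / p0) :> R.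
Proof.
have := @ler_powR R 2 (ler1n _ 2) 0 (k%:R * n%:R / p0) (e0 k).
by rewrite powRr0.
Qed.

Lemma mseq_ge5 k : mseq n p0 alpha beta k.+4.+1 =
  Num.max (alpha k.+3) (Num.max (2 `^ (k.+4.+1%:R * n%:R / p0) * alpha k.+4)
        (Num.max (2 `^ (k.+4.+1%:R * n%:R / p0) * alpha k.+4.+1) (Num.max (alpha k.+4.+2)
          (Num.max (beta k.+2) (beta k.+3))))).
Proof. by rewrite /mseq !subSS !subn0. Qed.

Lemma mseq_ge0 k : 0 <= m k.
Proof.
move: k => [|[|[|[|[|k]]]]] //; rewrite ?mseq_ge5 /mseq ?le_max ?ha ?ler01 ?orbT//.
Qed.

Lemma mseq_1 : m 1 = 1. Proof. by []. Qed.

Lemma mseq_2 : 1 <= m 2. Proof. by rewrite /mseq le_max lexx. Qed.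

Lemma alpha_le_mseq k : (2 <= k)%N -> alpha k <= m k.
Proof.
move: k => [|[|[|[|[|k]]]]] // _; rewrite ?mseq_ge5 /mseq ?le_max ?lexx ?orbT//.
have h := ler_peMl (ha (isT : (1 < k.+4.+1)%N)) (pow1 k.+4.+1).
by rewrite h !orbT.
Qed.

Lemma alpha_le_mseqS k : (2 <= k)%N -> alpha k <= m k.+1.
Proof.
move: k => [|[|[|[|k]]]] // _; rewrite ?mseq_ge5 /mseq ?le_max ?lexx ?orbT//.
have h := ler_peMl (ha (isT : (1 < k.+4)%N)) (pow1 k.+4.+1).
by rewrite h !orbT.
Qed.

Lemma beta_le_mseq k : (1 <= k)%N -> beta k.+1 <= m (k + 3).
Proof.
move: k => [|[|k]] // _; first by rewrite /mseq ?le_max ?lexx ?orbT.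
by rewrite addn3 mseq_ge5 !le_max lexx !orbT.
Qed.

(** For [k >= 5] the weighted terms of [m_k] with [alpha (k-1)] and [alpha k] are made for this; for
    [k <= 4] the weight is at most [2^(4n/p0)], which enters the constant. *)
Lemma alpha2_le_mseq k : (2 <= k)%N ->
  2 `^ (k%:R * n%:R / p0) * alpha2 alpha k <= 2 * 2 `^ (4%:R * n%:R / p0) * m k.
Proof.
move=> k2; have c1 := pow1 4; set c := 2 `^ (4%:R * n%:R / p0) in c1 *.
have [k5|] := leqP 5 k.
  move: k k5 k2 => [|[|[|[|[|k]]]]] // _ _.
  have -> : alpha2 alpha k.+4.+1 = alpha k.+4.+1 + alpha k.+4 by [].
  have h1 : 2 `^ (k.+4.+1%:R * n%:R / p0) * alpha k.+4.+1 <= m k.+4.+1.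
    by rewrite mseq_ge5 !le_max lexx !orbT.
  have h2 : 2 `^ (k.+4.+1%:R * n%:R / p0) * alpha k.+4 <= m k.+4.+1.
    by rewrite mseq_ge5 !le_max lexx !orbT.
  have := ler_wpM2r (mseq_ge0 k.+4.+1) c1.
  by move: (m k.+4.+1) h1 h2 => M h1 h2; lra.
rewrite ltnS => k4.
have hk : 2 `^ (k%:R * n%:R / p0) <= c.
  apply: ler_powR; first exact: ler1n.
  by rewrite ler_wpM2r ?invr_ge0 ?(le_trans _ p01)// ler_wpM2r// ler_nat.
have h2 : alpha2 alpha k <= 2 * m k.
  have := alpha_le_mseq k2; rewrite /alpha2; case: ifP => k3.
    have : alpha k.-1 <= m k.
      by case: k k3 {k2 k4 hk} => [|[|[|k]]] // _; exact: alpha_le_mseqS.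
    lra.
  by have := mseq_ge0 k; lra.
have a0 : 0 <= alpha2 alpha k.
  rewrite /alpha2 addr_ge0 ?ha//; case: ifP => // k3; apply: ha.
  by case: k k3 {k2 k4 hk h2} => [|[|[|k]]].
have -> : 2 * c * m k = c * (2 * m k) by ring.
exact: (ler_pM (powR_ge0 _ _) a0 hk h2).
Qed.

End StructuralConstants.

(** * Families of cubes and the choice of the centre *)

Section Subcubes.
Context (R : realType) (n : nat).
Implicit Types (Q P : cube R n).

Definition subcube Q P :=
  (forall i, corner P 0 i <= corner Q 0 i) /\
  (forall i, corner Q 0 i + side Q <= corner P 0 i + side P).

Lemma subcube_cubeset Q P : subcube Q P -> cubeset Q `<=` cubeset P.
Proof. by case; exact: cubeset_sub. Qed.

(** Set inclusion is tested on two points: the lower corner of [Q], and a point just past the upper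
    face of [P] if [Q] reached beyond it. *)
Lemma subcube_of_cubeset Q P : cubeset Q `<=` cubeset P -> subcube Q P.
Proof.
move=> QP; have sQ := side_gt0 Q; split => i.
  have /QP /(_ i)[] // : cubeset Q (corner Q) by move=> j; split => //; rewrite ltrDl.
rewrite leNgt; apply/negP => h.
pose y : R := Num.max (corner Q 0 i) (corner P 0 i + side P).
pose x : 'rV[R]_n := \row_j (if j == i then y else corner Q 0 j).
have /QP /(_ i)[_] : cubeset Q x.
  move=> j; rewrite /x mxE; case: eqP => [->|_]; last by split => //; rewrite ltrDl.
  by rewrite /y le_max lexx /=; split => //; rewrite gt_max h ltrDl sQ.
by rewrite /x mxE eqxx ltNge /y le_max lexx orbT.
Qed.

Definition center Q i : R := corner Q 0 i + side Q / 2.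

Lemma subcube_center Q P :
  (forall i, `|center Q i - center P i| <= (side P - side Q) / 2) -> subcube Q P.
Proof.
by move=> h; split => i; move: (h i); rewrite ler_norml /center => /andP[]; lra.
Qed.

Lemma subcube_centerP Q P i : subcube Q P ->
  `|center Q i - center P i| <= (side P - side Q) / 2.
Proof.
move=> [h1 h2]; have := h1 i; have := h2 i.
by rewrite ler_norml /center => ? ?; apply/andP; split; lra.
Qed.

Lemma center_dil2 k Q i : center (dil2 k Q) i = center Q i.
Proof. rewrite /center dil2_corner /=; lra. Qed.

Lemma side_dil2 k Q : side (dil2 k Q) = 2 ^+ k * side Q. Proof. by []. Qed.

Definition ccube (x : 'rV[R]_n) (s : R) (s0 : 0 < s) : cube R n :=
  @Cube R n (x - const_mx (s / 2)) s s0.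

Lemma center_ccube x s (s0 : 0 < s) i : center (ccube x s0) i = x 0 i.
Proof. rewrite /center /= !mxE; lra. Qed.

Lemma tcube_side Q (d : nat) : 0 < 3 / 2 * side Q / 2 ^+ d.
Proof. by rewrite divr_gt0 ?exprn_gt0// mulr_gt0 ?side_gt0// divr_gt0. Qed.

(** The cube [T_d] of the overview, with [T] at [d = 0]. The factor 3/2 is the smallest for which
    [T] contains [Q] whenever its centre is within [l(Q)/4] of that of [Q] in each coordinate. *)
Definition tcube Q (x : 'rV[R]_n) (d : nat) : cube R n := ccube x (tcube_side Q d).

Lemma center_tcube Q x d i : center (tcube Q x d) i = x 0 i.
Proof. exact: center_ccube. Qed.

Lemma side_tcube Q x d : side (tcube Q x d) = 3 / 2 * side Q / 2 ^+ d.
Proof. by []. Qed.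

Lemma cube_center Q P : (forall i, center Q i = center P i) -> side Q = side P -> Q = P.
Proof.
move=> h s; apply: cube_eq => //; apply/rowP => i; have := h i.
by rewrite /center s => /addIr.
Qed.

(** The [T_d] share their large dilates with [T], so averages of the single function [B_T f] can be
    summed into a~(T_d). *)
Lemma dil2_tcube Q x k d : dil2 (k + d) (tcube Q x d) = dil2 k (tcube Q x 0).
Proof.
apply: cube_center => [i|]; first by rewrite !center_dil2 !center_tcube.
rewrite !side_dil2 !side_tcube exprD expr0 divr1 -mulrA; congr (_ * _).
by rewrite mulrC mulfVK// gt_eqF// exprn_gt0.
Qed.

Lemma center_tri Q i : center (tri Q) i = center Q i.
Proof. rewrite /center tri_corner /=; lra. Qed.

Lemma side_tri Q : side (tri Q) = 3 * side Q. Proof. by []. Qed.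

Lemma side_dcell Q d k : side (dcell Q d k) = side Q / 2 ^+ d. Proof. by []. Qed.

Lemma subcube_refl Q : subcube Q Q. Proof. by split. Qed.

Lemma subcube_trans Q P T : subcube Q P -> subcube P T -> subcube Q T.
Proof.
by move=> [a b] [c e]; split => i; [apply: le_trans (a i)|apply: le_trans (e i)].
Qed.

Lemma subcube_dil2 k Q : subcube Q (dil2 k Q).
Proof.
apply: subcube_center => i; rewrite center_dil2 subrr normr0 side_dil2.
rewrite divr_ge0// subr_ge0 ler_peMl ?exprn_ege1 ?ler1n//.
exact: ltW (side_gt0 Q).
Qed.

End Subcubes.

Section FunctionalDq.
Context (R : realType) (n : nat) (mu : {measure set (RnB R n) -> \bar R}).
Variables (w : RnB R n -> R) (nu : {measure set (RnB R n) -> \bar R}).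
Hypothesis nuE : forall E, nu E = wmeas mu w E.
Variables (q CD : R).
Hypotheses (q_gt0 : 0 < q) (CD1 : 1 <= CD).
Implicit Types (Q P : cube R n).

Lemma finite_cover_le (I : finType) (G : I -> set (RnB R n)) (A : set (RnB R n)) (b : R) :
  measurable A -> (forall c, measurable (G c)) -> (forall c, (nu (G c) <= b%:E)%E) ->
  (forall x, A x -> exists c, G c x) -> (nu A <= (#|I|%:R * b)%:E)%E.
Proof.
move=> mA mG hG AG.
have key (s : seq I) : exists2 U : set (RnB R n), measurable U &
    (forall x c, c \in s -> G c x -> U x) /\ (nu U <= ((size s)%:R * b)%:E)%E.
  elim: s => [|c s [U mU [hU nU]]].
    by exists set0 => //; rewrite measure0 mul0r.
  exists (G c `|` U); first exact: measurableU.
  split=> [x c'|].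
    by rewrite inE => /orP[/eqP-> Gx|cs Gx]; [left|right; exact: hU cs Gx].
  apply: (@le_trans _ _ (nu (G c) + nu U)%E); first exact: measureU2.
  apply: (le_trans (leeD (hG c) nU)); rewrite -EFinD lee_fin /= -natr1; lra.
have [U mU [hU nU]] := key (enum I).
rewrite cardE; apply: le_trans nU; apply: measure_mono => // x /AG[c Gx].
by apply: (hU x c) => //; rewrite mem_enum.
Qed.

(** [D_q] as a Chebyshev inequality. The sets [F i] measured may differ from the disjoint cubes
    [P i] that carry [a], as cells do from the cubes [T_d]. *)
Lemma Dq_family (a : cube R n -> \bar R) (I : countType) (S : set I)
    (F : I -> set (RnB R n)) (P : I -> cube R n) Q (c s L : R) :
  Dq_with mu q w a CD -> 0 < s -> 0 <= c -> 0 <= L -> (a Q <= L%:E)%E ->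
  (forall i, S i -> cubeset (P i) `<=` cubeset Q) ->
  trivIset S (fun i => cubeset (P i)) ->
  (forall i, S i -> measurable (F i)) ->
  (forall i, S i -> nu (F i) <= c%:E * nu (cubeset (P i)))%E ->
  (forall i, S i -> (s%:E <= a (P i))%E) ->
  ((s `^ q)%:E * nu (\bigcup_(i in S) F i) <= (c * (CD * L) `^ q)%:E * nu (cubeset Q))%E.
Proof.
move=> [a_fin [_ hD]] s0 c0 L0 aQ PQ tP mF FP sP.
pose J := pickle @` S.
pose Qi k := if unpickle k is Some i then P i else Q.
have QiE i : Qi (pickle i) = P i by rewrite /Qi pickleK.
have sub k : J k -> cubeset (Qi k) `<=` cubeset Q.
  by move=> [i Si <-]; rewrite QiE; exact: PQ.
have disj k l : J k -> J l -> k <> l -> cubeset (Qi k) `&` cubeset (Qi l) = set0.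
  move=> [i Si <-] [j Sj <-]; rewrite !QiE => ij.
  apply/seteqP; split => // x xx; case: ij; congr pickle.
  by apply: (tP i j Si Sj); exists x.
have := hD Q J Qi sub disj.
rewrite esum_image; last by move=> i j _ _; exact: (pcan_inj pickleK).
move=> h.
have pq0 x : (0 <= poweR x q)%E by exact: poweR_ge0.
have sq : 0 < s `^ q by exact: powR_gt0.
rewrite -lee_pdivlMl//.
have mU : measurable (\bigcup_(i in S) F i) by exact: countable_bigcup_measurable.
apply: (le_trans (cover_esum nu mF mU (@subset_refl _ _))).
have q0 : 0 <= q by exact: ltW.
apply: (@le_trans _ _ (\esum_(i in S) ((c * (s `^ q)^-1)%:E *
    (poweR (a (P i)) q * wmeas mu w (cubeset (P i))))%E)).
  apply: le_esum => i Si; apply: (le_trans (FP i Si)); rewrite -nuE.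
  rewrite EFinM -muleA; apply: lee_wpmul2l; first by rewrite lee_fin.
  rewrite muleA -[leLHS]mul1e; apply: lee_wpmul2r => //.
  have := poweR_le q0 _ (sP i Si); rewrite lee_fin poweR_EFin => /(_ (ltW s0)) hs.
  rewrite -[1%E](_ : (((s `^ q)^-1)%:E * (s `^ q)%:E)%E = 1%E).
    by apply: lee_wpmul2l => //; rewrite lee_fin invr_ge0 ltW.
  by rewrite -EFinM mulVf// gt_eqF.
have cs0 : 0 <= c * (s `^ q)^-1 by rewrite mulr_ge0// invr_ge0 ltW.
have term0 i : S i -> (0 <= poweR (a (P i)) q * wmeas mu w (cubeset (P i)))%E.
  by move=> _; rewrite -nuE mule_ge0.
apply: (@le_trans _ _ ((c * (s `^ q)^-1)%:E *
   \esum_(i in S) (poweR (a (P i)) q * wmeas mu w (cubeset (P i))))%E).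
  apply: ge_ereal_sup => _ [X [fX XS] <-].
  rewrite -ge0_mule_fsumr; last by move=> i; rewrite -nuE mule_ge0.
  apply: lee_wpmul2l; first by rewrite lee_fin.
  by apply: ereal_sup_ubound; exists X.
apply: (@le_trans _ _ ((c * (s `^ q)^-1)%:E * ((CD `^ q)%:E * (L `^ q)%:E * nu (cubeset Q)))%E).
  apply: lee_wpmul2l; first by rewrite lee_fin.
  have -> : (\esum_(i in S) (poweR (a (P i)) q * wmeas mu w (cubeset (P i))) =
     \esum_(i in S) (poweR (a (Qi (pickle i))) q * wmeas mu w (cubeset (Qi (pickle i)))))%E.
    by apply: eq_esum => i _; rewrite QiE.
  apply: (le_trans h); rewrite -nuE; apply: lee_wpmul2r => //.
  apply: lee_wpmul2l; first by rewrite lee_fin powR_ge0.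
  have := poweR_le q0 _ aQ; rewrite poweR_EFin; apply.
  by have [] := a_fin Q.
rewrite !muleA -!EFinM; apply: lee_wpmul2r => //; rewrite lee_fin.
rewrite powRM ?(le_trans _ CD1)//; lra.
Qed.

End FunctionalDq.

Section Selection.
Context (R : realType) (n : nat) (mu : {measure set (RnB R n) -> \bar R}).
Variables (w : RnB R n -> R) (nu : {measure set (RnB R n) -> \bar R}).
Hypothesis nuE : forall E, nu E = wmeas mu w E.
Hypothesis nuoo : forall Q : cube R n, (nu (cubeset Q) < +oo)%E.
Hypothesis dbl : forall K : R, exists2 C : R, 1 <= C & forall Q P : cube R n,
  subcube Q P -> side P <= K * side Q -> (nu (cubeset P) <= C%:E * nu (cubeset Q))%E.
Variables (q CD : R).
Hypotheses (q_gt0 : 0 < q) (CD1 : 1 <= CD).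
Implicit Types (Q P : cube R n) (a : cube R n -> \bar R).

(** [D_q] for the one-element family [P] leaves the ratio of [nu Q] to [nu P], which doubling
    bounds. *)
Lemma Dq_compare (K : R) : exists2 C : R, 0 < C & forall a Q P (L : R),
  Dq_with mu q w a CD -> subcube P Q -> side Q <= K * side P ->
  (0 < nu (cubeset Q))%E -> 0 <= L -> (a Q <= L%:E)%E -> (a P <= (C * L)%:E)%E.
Proof.
have [Cd Cd1 hCd] := dbl K; have Cd0 : 0 < Cd by exact: lt_le_trans Cd1.
have CD0 : 0 < CD by exact: lt_le_trans CD1.
exists (CD * Cd `^ q^-1); first by rewrite mulr_gt0// powR_gt0.
move=> a Q P L hD PQ sPQ nQ L0 aQ; have [a_fin _] := hD.
have [aP0 aPoo] := a_fin P.
have fP : a P \is a fin_num by rewrite ge0_fin_numE.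
rewrite -(fineK fP) lee_fin; set s := fine (a P).
have [s0|s0] := leP s 0; first by apply: (le_trans s0); rewrite !mulr_ge0 ?powR_ge0// ltW.
have nP := hCd P Q PQ sPQ.
have fnP : nu (cubeset P) \is a fin_num by rewrite ge0_fin_numE.
have fnQ : nu (cubeset Q) \is a fin_num by rewrite ge0_fin_numE.
have nP0 : 0 < fine (nu (cubeset P)).
  rewrite lt_neqAle fine_ge0// andbT; apply/eqP => h.
  by move: nQ; rewrite ltNge => /negP; apply; apply: (le_trans nP); rewrite -(fineK fnP) -h mule0.
have hfam := @Dq_family _ _ _ w nu nuE q CD q_gt0 CD1 a unit setT
  (fun _ => cubeset P) (fun _ => P) Q 1 s L hD s0 ler01 L0 aQ.
have hU : \bigcup_(i in [set: unit]) cubeset P = cubeset P.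
  by apply/seteqP; split => [x []//|x Px]; exists tt.
rewrite hU in hfam.
have {}hfam : ((s `^ q)%:E * nu (cubeset P) <= (1 * (CD * L) `^ q)%:E * nu (cubeset Q))%E.
  apply: hfam => //.
  - by move=> _ _; exact: subcube_cubeset.
  - by move=> [] [] _ _ _.
  - by move=> _ _; exact: measurable_cubeset.
  - by move=> _ _; rewrite mul1e.
  - by move=> _ _; rewrite /s fineK.
have CL0 : 0 <= CD * L by rewrite mulr_ge0// ltW.
have key : s `^ q <= (CD * L) `^ q * Cd.
  rewrite -(ler_pM2r nP0) -lee_fin EFinM (fineK fnP) (le_trans hfam)// mul1r.
  rewrite EFinM (fineK fnP) EFinM -muleA; apply: lee_wpmul2l => //.
  by rewrite lee_fin powR_ge0.
rewrite leNgt; apply/negP => lt_.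
have : (CD * Cd `^ q^-1 * L) `^ q < s `^ q.
  by rewrite gt0_ltr_powR ?nnegrE ?(ltW s0)// !mulr_ge0 ?powR_ge0// ltW.
rewrite mulrAC powRM ?powR_ge0// -powRrM mulVf ?gt_eqF// powRr1 ?(ltW Cd0)//.
by rewrite ltNge key.
Qed.

(* The cubes [tcube] centred in distinct cells of one colour are disjoint, so
   that [D_q] applies to them. *)
Definition color (k : 'rV[int]_n) : {ffun 'I_n -> 'I_3} :=
  [ffun i => inord `|(k 0%R i %% 3)%Z|%N].

Lemma color_eq (k k' : 'rV[int]_n) i : color k = color k' ->
  (k 0%R i %% 3)%Z = (k' 0%R i %% 3)%Z.
Proof.
move=> /ffunP /(_ i); rewrite !ffunE => /(congr1 val) /=.
have b (z : int) : (`|(z %% 3)%Z| < 3)%N by lia.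
rewrite !inordK ?b//; lia.
Qed.

Lemma tcube_disjoint Q d (x x' y : 'rV[R]_n) :
  color (didx Q d x) = color (didx Q d x') ->
  cubeset (tcube Q x d) y -> cubeset (tcube Q x' d) y -> didx Q d x = didx Q d x'.
Proof.
move=> hc yx yx'; apply/rowP => i; have hm := color_eq i hc.
have := center_tcube Q x d i; have := center_tcube Q x' d i; rewrite /center => e1 e2.
have [] := yx i; have [] := yx' i; move: e1 e2; rewrite !side_tcube.
move=> e1 e2 a1 a2 a3 a4; have [] := dcell_self Q d x i; have [] := dcell_self Q d x' i.
rewrite !dcell_corner !side_dcell; move: e1 e2 a1 a2 a3 a4.
set k := didx Q d x 0 i in hm *; set k' := didx Q d x' 0 i in hm *.
have -> : 3 / 2 * side Q / 2 ^+ d = 3 / 2 * (side Q / 2 ^+ d) by rewrite mulrA.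
have : 0 < side Q / 2 ^+ d by exact: side_gt0 (dcell Q d 0).
set s := side Q / 2 ^+ d => s0 e1 e2 a1 a2 a3 a4 a5 a6 a7 a8.
have e3 (z : int) : (z + 3)%:~R = z%:~R + 3 :> R by rewrite intrD.
(* Centres of meeting cubes are less than 3/2 cell sides apart, so the indices differ by less than 3
   and equal residues force equality. *)
have h1 : k%:~R < (k' + 3)%:~R :> R by rewrite -(ltr_pM2l s0) e3; lra.
have h2 : k'%:~R < (k + 3)%:~R :> R by rewrite -(ltr_pM2l s0) e3; lra.
move: h1 h2; rewrite !ltr_int.
rewrite (divz_eq k 3) (divz_eq k' 3) hm.
by move: (k %/ 3)%Z (k' %/ 3)%Z (k' %% 3)%Z => A B r; clear; lia.
Qed.

(* [D_q] bounds the measure of the exceptional centres of generation [d] by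
   [O(K^-q 2^(-d n q / p0))]; as [n q / p0 >= 1], these sets together do not fill
   the middle cell of [Q] when [K] is large. *)
Lemma selection (p0 : R) : 1 <= p0 -> p0 < q -> (0 < n)%N ->
  exists2 K : R, 0 < K & forall a Q (L : R),
  Dq_with mu q w a CD -> (0 < nu (cubeset Q))%E -> 0 < L -> (a (dil2 1 Q) <= L%:E)%E ->
  exists x : 'rV[R]_n, (forall i, `|x 0 i - center Q i| <= side Q / 4) /\
    forall d : nat, (a (tcube Q x d) <= (K * 2 `^ (d%:R * n%:R / p0) * L)%:E)%E.
Proof.
move=> p01 pq n0; have p00 : 0 < p0 by exact: lt_le_trans p01.
have [Ct Ct1 hCt] := dbl 2; have Ct0 : 0 < Ct by exact: lt_le_trans Ct1.
have [C8 C81 hC8] := dbl 8; have C80 : 0 < C8 by exact: lt_le_trans C81.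
have CD0 : 0 < CD by exact: lt_le_trans CD1.
pose N : R := #|{ffun 'I_n -> 'I_3}|%:R.
have N0 : 0 < N.
  by rewrite /N ltr0n; apply/card_gt0P; exists [ffun=> ord0].
(* Chosen so that one colour in generation [d] carries at most [v / (4 N 2^d)]: [N] counts the
   colours, [Ct] compares cells with [T_d], and [C8] compares [2Q] with [r0]. *)
pose M := 4 * N * Ct * C8 * CD `^ q.
have M0 : 0 < M by rewrite !mulr_gt0// powR_gt0.
pose K := M `^ q^-1; have K0 : 0 < K by rewrite powR_gt0.
have Kq : K `^ q = M by rewrite -powRrM mulVf ?gt_eqF// powRr1// ltW.
exists K => // a Q L hD nQ L0 aQ.
(* The cell of side [l(Q)/4] whose lower corner is the centre of [Q]. *)
pose r0 := dcell Q 2 (const_mx 2).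
have cr0 i : center r0 i = center Q i + side Q / 8.
  rewrite /center dcell_corner side_dcell mxE /=; lra.
have sr0 : side r0 = side Q / 4 by rewrite side_dcell; lra.
have sQ := side_gt0 Q.
have r0Q : subcube r0 (dil2 1 Q).
  apply: subcube_center => i; rewrite center_dil2 side_dil2 sr0 cr0 ler_norml.
  apply/andP; split; lra.
have Q2Q : subcube Q (dil2 1 Q) by exact: subcube_dil2.
have nr0 : (nu (cubeset (dil2 1 Q)) <= C8%:E * nu (cubeset r0))%E.
  by apply: hC8 => //; rewrite side_dil2 sr0; lra.
have fr0 : nu (cubeset r0) \is a fin_num by rewrite ge0_fin_numE.
have f2Q : nu (cubeset (dil2 1 Q)) \is a fin_num by rewrite ge0_fin_numE.
pose v := fine (nu (cubeset r0)).
have v0 : 0 < v.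
  rewrite lt_neqAle fine_ge0// andbT; apply/eqP => h.
  have : (nu (cubeset Q) <= nu (cubeset (dil2 1 Q)))%E.
    by apply: measure_mono; [exact: measurable_cubeset..|exact: subcube_cubeset].
  move=> /le_trans /(_ nr0); rewrite -(fineK fr0) -/v -h mule0 leNgt nQ//.
pose s d := K * 2 `^ (d%:R * n%:R / p0) * L.
have s0 d : 0 < s d by rewrite !mulr_gt0// powR_gt0.
have r0x x : cubeset r0 x -> forall i, `|x 0 i - center Q i| <= side Q / 4.
  move=> rx i; have [] := rx i; rewrite dcell_corner side_dcell mxE /center /=.
  by move=> h1 h2; rewrite ler_norml; apply/andP; split; lra.
pose bad d k := [set x | [/\ cubeset r0 x, didx Q d x = k & (s d)%:E < a (tcube Q x d)]%E].
(* One exceptional centre per cell represents it: the whole cell is discarded as soon as it contains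
   one. *)
pose X d k : 'rV[R]_n := xget 0 (bad d k).
have hX d k : bad d k !=set0 -> bad d k (X d k).
  by move=> [x hx]; apply: (xgetPex 0); exists x.
pose S d c := [set k | bad d k !=set0 /\ color k = c].
pose G d c := \bigcup_(k in S d c) cells Q (d, k).
pose U d := \bigcup_(k in [set k | bad d k !=set0]) cells Q (d, k).
have mG d c : measurable (G d c : set (RnB R n)).
  by apply: countable_bigcup_measurable => k _; exact: measurable_cells.
have mU d : measurable (U d : set (RnB R n)).
  by apply: countable_bigcup_measurable => k _; exact: measurable_cells.
have Gbound d c : (nu (G d c) <= (v / 4 / N / 2 ^+ d)%:E)%E.
  have h := @Dq_family _ _ _ w nu nuE q CD q_gt0 CD1 a _ (S d c)
    (fun k => cells Q (d, k)) (fun k => tcube Q (X d k) d) (dil2 1 Q) Ct (s d) L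
    hD (s0 d) (ltW Ct0) (ltW L0) aQ.
  have {}h : ((s d `^ q)%:E * nu (G d c) <=
      (Ct * (CD * L) `^ q)%:E * nu (cubeset (dil2 1 Q)))%E.
    apply: h.
    - move=> k [/hX[rx _ _] _]; apply: subcube_cubeset; apply: subcube_center => i.
      rewrite center_tcube center_dil2 side_dil2 side_tcube.
      apply: (le_trans (r0x _ rx i)).
      have : side Q / 2 ^+ d <= side Q.
        by rewrite ler_pdivrMr ?exprn_gt0// ler_peMr ?(ltW sQ)// exprn_ege1// ler1n.
      rewrite -mulrA; lra.
    - move=> k k' [/hX[_ kx _] kc] [/hX[_ kx' _] kc'] [y [yk yk']].
      by rewrite -kx -kx'; apply: (tcube_disjoint _ yk yk'); rewrite kx kx' kc kc'.
    - by move=> k _; exact: measurable_cells.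
    - move=> k [/hX[_ kx _] _]; move: (X d k) kx => x <-.
      apply: (@le_trans _ _ (nu (cubeset (dil2 1 (tcube Q x d))))).
        apply: measure_mono; [exact: measurable_cells|exact: measurable_cubeset|].
        rewrite /cells; apply: subcube_cubeset; apply: subcube_center => i.
        have [] := dcell_self Q d x i; rewrite [(d, _).1]/= [(d, _).2]/=.
        rewrite center_dil2 center_tcube side_dil2 side_tcube side_dcell /center.
        have -> : 3 / 2 * side Q / 2 ^+ d = 3 / 2 * (side Q / 2 ^+ d) by rewrite mulrA.
        rewrite side_dcell => h1 h2; rewrite ler_norml expr1; apply/andP; split; lra.
      by apply: hCt; [exact: subcube_dil2|rewrite side_dil2 expr1].
    - by move=> k [/hX[_ _ /ltW]].
  have sq : 0 < s d `^ q by rewrite powR_gt0.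
  have fG : nu (G d c) \is a fin_num.
    rewrite ge0_fin_numE//; have := h; case: (nu (G d c)) => //=.
      by move=> r _; rewrite ltry.
    rewrite gt0_muley ?lte_fin// leye_eq => /eqP h'; exfalso; move: h'.
    by rewrite -(fineK f2Q) -EFinM.
  have {}h : s d `^ q * fine (nu (G d c)) <= Ct * (CD * L) `^ q * (C8 * v).
    rewrite -lee_fin EFinM fineK//; apply: (le_trans h).
    rewrite [leRHS]EFinM; apply: lee_wpmul2l.
      by rewrite lee_fin mulr_ge0 ?powR_ge0// ltW.
    by rewrite EFinM fineK.
  rewrite -(fineK fG) lee_fin; set g := fine _ in h *.
  have g0 : 0 <= g by rewrite fine_ge0.
  have sdq : M * L `^ q * 2 ^+ d <= s d `^ q.
    rewrite /s powRM ?mulr_ge0 ?powR_ge0 ?(ltW K0) ?(ltW L0)//.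
    rewrite [(K * _) `^ q]powRM ?powR_ge0 ?(ltW K0)// Kq mulrAC.
    apply: ler_wpM2r; first exact: powR_ge0.
    apply: ler_wpM2l; first exact: ltW.
    rewrite -powRrM -powR_mulrn//; apply: ler_powR; first exact: ler1n.
    have nq : p0 <= n%:R * q.
      apply: (le_trans (ltW pq)); rewrite ler_peMl ?(ltW q_gt0)// ler1n//.
    have -> : d%:R * n%:R / p0 * q = d%:R * (n%:R * q / p0) by ring.
    by rewrite ler_peMr// ler_pdivlMr// mul1r.
  have Lq : 0 < L `^ q by rewrite powR_gt0.
  have CDq : 0 < CD `^ q by rewrite powR_gt0.
  have h3 : M * L `^ q * 2 ^+ d * g <= Ct * (CD * L) `^ q * (C8 * v).
    by apply: le_trans h; exact: ler_wpM2r.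
  have d0 : 0 < 2 ^+ d :> R by rewrite exprn_gt0.
  rewrite ler_pdivlMr// ler_pdivlMr// ler_pdivlMr//.
  rewrite powRM ?(ltW CD0) ?(ltW L0)// in h3.
  have c0 : 0 < Ct * CD `^ q * C8 * L `^ q by rewrite !mulr_gt0.
  rewrite -(ler_pM2l c0); apply: le_trans (_ : Ct * (CD `^ q * L `^ q) * (C8 * v) <= _).
    by apply: le_trans h3; rewrite /M le_eqVlt; apply/orP; left; apply/eqP; ring.
  by rewrite le_eqVlt; apply/orP; left; apply/eqP; ring.
have Ubound d : (nu (U d) <= (v / 2 / (2 ^ d.+1)%:R)%:E)%E.
  have := @finite_cover_le _ _ nu _ (G d) (U d) _ (mU d) (mG d) (Gbound d).
  move=> /(_ _)/le_trans; apply.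
    by move=> x [k bk xk]; exists (color k); exists k.
  rewrite lee_fin -/N natrX exprS le_eqVlt; apply/orP; left; apply/eqP.
  by field; rewrite !gt_eqF// exprn_gt0.
apply: contrapT => nex.
have cov : cubeset r0 `<=` \bigcup_d U d.
  move=> x rx; apply: contrapT => nU; apply: nex; exists x; split; first exact: r0x.
  move=> d; rewrite leNgt; apply/negP => lt_; apply: nU; exists d => //.
  exists (didx Q d x); last exact: dcell_self.
  by exists x; split.
(* If every point of [r0] were exceptional for some [d], the sum over [d] would give
   [nu r0 <= v / 2], although [v = nu r0 > 0]. *)
have := measure_sigma_subadditive nu mU (measurable_cubeset r0) cov.
apply/negP; rewrite -ltNge.
apply: (@le_lt_trans _ _ (v / 2)%:E); last by rewrite -(fineK fr0) lte_fin -/v; lra.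
apply: le_trans (epsilon_trick0 xpredT _); last by rewrite divr_ge0// ltW.
by apply: lee_nneseries => // d _; exact: Ubound.
Qed.

End Selection.

(** * Bounds on the pieces *)

Section LocalBounds.
Context (R : realType) (n : nat) (mu : {measure set (RnB R n) -> \bar R}).
Hypothesis hmu : lebesgue_on_cubes mu.
Variables (p0 : R) (q0 : \bar R) (Cp0 : R) (alpha beta : nat -> R).
Variable B : cube R n -> (RnB R n -> R) -> (RnB R n -> R).
Hypotheses (p01 : 1 <= p0) (pq : (p0%:E <= q0)%E).
Hypothesis hO : classO mu p0 q0 B Cp0 alpha beta.
Variable gamma : nat -> R.
Hypothesis hgamma : forall k, (1 <= k)%N -> mseq n p0 alpha beta k <= gamma k.
Implicit Types (Q P T : cube R n).
Local Notation m := (mseq n p0 alpha beta).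

Let p0_gt0 : 0 < p0. Proof. exact: lt_le_trans p01. Qed.

Let ha k : (2 <= k)%N -> 0 <= alpha k.
Proof. by case: hO => _ _ _ [[h _] _] _; exact: h. Qed.

Let hb k : 0 <= beta k.
Proof. by case: hO => _ _ _ _ [[h _] _]; exact: h. Qed.

Let m0 k : 0 <= m k. Proof. exact: mseq_ge0. Qed.

Section Functional.
Variable a : cube R n -> R.
Hypothesis a0 : forall Q, 0 <= a Q.

Let term0 P i : (1 <= i)%N -> (0 <= (gamma i * a (dil2 i P))%:E)%E.
Proof. by move=> i1; rewrite lee_fin mulr_ge0// (le_trans (m0 i)) ?hgamma. Qed.

Lemma atilde_term P k : (1 <= k)%N -> ((m k * a (dil2 k P))%:E <= atilde gamma a P)%E.
Proof.
move=> k1; apply: le_trans (series_term k1 (term0 P)).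
by rewrite lee_fin ler_wpM2r// hgamma.
Qed.

(** The shift [j] arises when the cube of an average is enclosed in a dilate of [P]. The index
    shifts of [alpha] and [beta] inside [m_k] pay for it. *)
Lemma atilde_series P (k0 j : nat) (e : nat -> \bar R) (c : R) : (1 <= k0 + j)%N -> 0 <= c ->
  (forall k, (k0 <= k)%N -> (0 <= e k)%E) ->
  (forall k, (k0 <= k)%N -> (e k <= (c * (m (k + j) * a (dil2 (k + j) P)))%:E)%E) ->
  (\sum_(k0 <= k <oo) e k <= c%:E * atilde gamma a P)%E.
Proof.
move=> kj c0 e0 he; pose F k : \bar R := (gamma k * a (dil2 k P))%:E.
have F0 i : (k0 + j <= i)%N -> (0 <= F i)%E by move=> h; apply: term0; exact: leq_trans h.
have F0' i : (k0 <= i)%N -> (0 <= F (i + j)%N)%E by move=> h; apply: F0; rewrite leq_add2r.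
apply: (@le_trans _ _ (\sum_(k0 <= k <oo) (c%:E * F (k + j)%N))%E).
  apply: series_le => // k hk; apply: (le_trans (he k hk)).
  rewrite -EFinM lee_fin ler_wpM2l// ler_wpM2r// hgamma//.
  by apply: leq_trans kj _; rewrite leq_add2r.
rewrite (series_scale _ F0') (series_shift F0).
apply: lee_wpmul2l => //; exact: (series_tail kj (term0 P)).
Qed.

Variables (f : RnB R n -> R) (Q : cube R n) (L Ks Kc : R) (x : 'rV[R]_n).
Hypothesis hf : locLp mu p0 f.
Hypothesis fa : forall (k : nat) P,
  (normavg mu p0%:E (cubeset (dil2 k P)) (B P f) <= (a (dil2 k P))%:E)%E.
Hypotheses (L0 : 0 < L) (Ks0 : 0 < Ks) (Kc0 : 0 < Kc).
Hypothesis hx : forall i, `|x 0 i - center Q i| <= side Q / 4.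
Hypothesis hT : forall d : nat,
  (atilde gamma a (tcube Q x d) <= (Ks * 2 `^ (d%:R * n%:R / p0) * L)%:E)%E.
Hypothesis hc : forall P, subcube P (dil2 1 Q) -> side (dil2 1 Q) <= 4 * side P ->
  (atilde gamma a P <= (Kc * L)%:E)%E.

Local Notation T := (tcube Q x 0).
Local Notation h := (B T f).
Local Notation avg k P u := (normavg mu p0%:E (cubeset (dil2 k P)) u).

Let mB P : measurable_fun setT (B P f).
Proof. by have [] := locLp_B hO P hf. Qed.

Lemma sideT : side T = 3 / 2 * side Q.
Proof. by rewrite side_tcube expr0 divr1. Qed.

Lemma avg_transfer P P' u (r : R) : 1 <= r -> measurable_fun setT u -> subcube P P' ->
  side P' <= r * side P ->
  (normavg mu p0%:E (cubeset P) u <= (r ^+ n)%:E * normavg mu p0%:E (cubeset P') u)%E.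
Proof. by move=> r1 mu_ PP'; apply: normavg_subset => //; exact: subcube_cubeset. Qed.

Lemma atildeT : (atilde gamma a T <= (Ks * L)%:E)%E.
Proof. by have := hT 0; rewrite mul0r mul0r powRr0 mulr1. Qed.

Lemma atildeQ : (atilde gamma a Q <= (Kc * L)%:E)%E.
Proof.
apply: hc; first exact: subcube_dil2.
by rewrite side_dil2 expr1 ler_wpM2r ?(ltW (side_gt0 Q))// ler_nat.
Qed.

Let xc i : - (side Q / 4) <= x 0 i - center Q i /\ x 0 i - center Q i <= side Q / 4.
Proof. by have := hx i; rewrite ler_norml => /andP[]. Qed.

(** Keeps [Q] itself from being bad at the initial level: [3Q] lies in [4T], of twice its side, and
    [m_2 >= 1] puts [a(4T)] into a~(T). *)
Lemma root_bound : (normavg mu p0%:E (cubeset (tri Q)) h <= (2 ^+ n * Ks * L)%:E)%E.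
Proof.
have sQ := side_gt0 Q.
apply: (@le_trans _ _ ((2 ^+ n)%:E * avg 2 T h)%E).
  apply: avg_transfer => //; first exact: ler1n.
    apply: subcube_center => i; rewrite center_tri center_dil2 center_tcube.
    rewrite side_dil2 side_tri sideT; have [] := xc i.
    by rewrite ler_norml => ? ?; apply/andP; split; lra.
  rewrite side_dil2 side_tri sideT; lra.
rewrite -mulrA EFinM; apply: lee_wpmul2l; first by rewrite lee_fin exprn_ge0.
apply: (le_trans (fa 2 T)); apply: le_trans atildeT.
apply: le_trans (atilde_term T (isT : (1 <= 2)%N)).
by rewrite lee_fin ler_peMl// mseq_2.
Qed.

Lemma avg_series_le u P (D : nat -> cube R n) (k0 j : nat) (r : R) (e : nat -> R) :
  measurable_fun setT u -> (1 <= k0 + j)%N -> 1 <= r ->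
  (forall k, (avg (k + j)%N P u <= (a (dil2 (k + j) P))%:E)%E) ->
  (forall k, (k0 <= k)%N -> 0 <= e k <= m (k + j)) ->
  (forall k, (k0 <= k)%N -> subcube (D k) (dil2 (k + j) P) /\
     side (dil2 (k + j) P) <= r * side (D k)) ->
  (\sum_(k0 <= k <oo) ((e k)%:E * normavg mu p0%:E (cubeset (D k)) u) <=
   (r ^+ n)%:E * atilde gamma a P)%E.
Proof.
move=> mu_ kj r1 ua he hD; have rn : 0 <= r ^+ n.
  by rewrite exprn_ge0// (le_trans ler01).
apply: (@atilde_series P k0 j) => // k hk; have /andP[e0 em] := he k hk.
  by rewrite mule_ge0 ?lee_fin// normavg_ge0.
have [sub hs] := hD k hk.
have hav : (normavg mu p0%:E (cubeset (D k)) u <= (r ^+ n * a (dil2 (k + j) P))%:E)%E.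
  apply: (le_trans (avg_transfer r1 mu_ sub hs)).
  by rewrite EFinM; apply: lee_wpmul2l; [rewrite lee_fin|exact: ua].
apply: (@le_trans _ _ ((e k)%:E * (r ^+ n * a (dil2 (k + j) P))%:E)%E).
  by apply: lee_wpmul2l; rewrite ?lee_fin.
by rewrite -EFinM lee_fin mulrCA; apply: ler_wpM2l => //; exact: ler_wpM2r.
Qed.

Let two_le k : (1 <= k)%N -> 2 * side Q <= 2 ^+ k * side Q.
Proof.
move=> k1; apply: ler_wpM2r; first exact: ltW (side_gt0 Q).
by rewrite -[leLHS]expr1 ler_eXn2l ?ltr1n.
Qed.

(** Here [2^k T] must be enclosed in [2^(k+1) Q], the function being [B_Q f]; so [alpha k] is paid
    for by [m_(k+1)]. *)
Lemma delta1_bound :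
  (normavg mu q0 (cubeset (dil2 1 T)) (opA B T (B Q f)) <= (4 * 2 ^+ n * Kc * L)%:E)%E.
Proof.
apply: (le_trans (normavg_A hmu p01 pq hO T (locLp_B hO Q hf))).
rewrite -!mulrA EFinM; apply: lee_wpmul2l; first by rewrite lee_fin.
apply: (@le_trans _ _ ((2 ^+ n)%:E * atilde gamma a Q)%E); last first.
  by rewrite EFinM; apply: lee_wpmul2l; [rewrite lee_fin exprn_ge0|exact: atildeQ].
apply: (@avg_series_le _ _ (fun k => dil2 k T) 2 1) => // [|k k2|k k2].
- exact: ler1n.
- by rewrite ha// addn1 alpha_le_mseqS.
have sQ := side_gt0 Q; have h2 := two_le (ltnW k2); rewrite !side_dil2 sideT addn1 exprS; split; last by lra.
apply: subcube_center => i; rewrite !center_dil2 center_tcube !side_dil2 sideT exprS.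
by have [] := xc i; rewrite ler_norml => ? ?; apply/andP; split; lra.
Qed.

(** No shift this time: [2^k Q] already lies in [2^k T], and [alpha k <= m_k]. *)
Lemma delta2_bound :
  (normavg mu q0 (cubeset (dil2 1 Q)) (opA B Q h) <= (4 * 2 ^+ n * Ks * L)%:E)%E.
Proof.
apply: (le_trans (normavg_A hmu p01 pq hO Q (locLp_B hO T hf))).
rewrite -!mulrA EFinM; apply: lee_wpmul2l; first by rewrite lee_fin.
apply: (@le_trans _ _ ((2 ^+ n)%:E * atilde gamma a T)%E); last first.
  by rewrite EFinM; apply: lee_wpmul2l; [rewrite lee_fin exprn_ge0|exact: atildeT].
apply: (@avg_series_le _ _ (fun k => dil2 k Q) 2 0) => // [|k k2|k k2].
- exact: ler1n.
- by rewrite ha// addn0 alpha_le_mseq.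
have sQ := side_gt0 Q; have h2 := two_le (ltnW k2); rewrite !side_dil2 sideT addn0; split; last by lra.
apply: subcube_center => i; rewrite !center_dil2 center_tcube !side_dil2 sideT.
by have [] := xc i; rewrite ler_norml => ? ?; apply/andP; split; lra.
Qed.

Lemma piece3_bound P :
  (avg 1 P (B P f) + alpha_sum mu p0 alpha P (B P f) <= 2%:E * atilde gamma a P)%E.
Proof.
have h1 : (avg 1 P (B P f) <= atilde gamma a P)%E.
  by apply: (le_trans (fa 1 P)); have := atilde_term P (leqnn 1); rewrite mseq_1 mul1r.
have h2 : (alpha_sum mu p0 alpha P (B P f) <= atilde gamma a P)%E.
  have := @avg_series_le (B P f) P (fun k => dil2 k P) 2 0 1 alpha (mB P).
  rewrite expr1n mul1e; apply=> // k k2; rewrite addn0.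
    by rewrite ha// alpha_le_mseq.
  by split; [exact: subcube_refl|rewrite mul1r].
have -> : (2%:E * atilde gamma a P = atilde gamma a P + atilde gamma a P)%E.
  by rewrite (_ : 2%:E = 1 + 1)%E// ge0_muleDl ?mul1e.
exact: leeD.
Qed.

Let mem_cell d k : (0 < d)%N -> cells Q (d, k) `<=` cubeset Q ->
  forall i, `|center (dcell Q d k) i - center Q i| <= (side Q - side Q / 2 ^+ d) / 2.
Proof. by move=> d0 sub i; have := subcube_centerP i (subcube_of_cubeset sub). Qed.

(** [B_P f] is controlled only on dilates of [P]. The dilate [P' = 2^d P] has the size of [Q] and
    lies in [2Q], so a~(P') is comparable to [L]; enclosing [2^(l+1) T] in [2^(l+3) P'] is what
    [beta_(k-2)] in [m_k] serves for. *)
Lemma piece2_bound d k : (0 < d)%N -> cells Q (d, k) `<=` cubeset Q ->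
  (\sum_(1 <= l <oo) ((beta l.+1)%:E * avg l.+1 T (B (dcell Q d k) f)) <=
   (3 ^+ n * Kc * L)%:E)%E.
Proof.
move=> d0 sub; have sQ := side_gt0 Q; set P := dcell Q d k.
have d2 : 0 < 2 ^+ d :> R by rewrite exprn_gt0.
have sP : 2 ^+ d * side P = side Q by rewrite side_dcell mulrC mulfVK// gt_eqF.
have sP0 : 0 < side Q / 2 ^+ d by rewrite divr_gt0.
have cP i : `|center P i - center Q i| <= side Q / 2.
  by apply: (le_trans (mem_cell d0 sub i)); lra.
pose P' := dil2 d P.
have aP' : (atilde gamma a P' <= (Kc * L)%:E)%E.
  apply: hc.
    apply: subcube_center => i; rewrite !center_dil2 !side_dil2 sP expr1.
    by apply: (le_trans (cP i)); lra.
  by rewrite !side_dil2 sP expr1; lra.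
apply: (@le_trans _ _ ((3 ^+ n)%:E * atilde gamma a P')%E); last first.
  rewrite -mulrA EFinM; apply: lee_wpmul2l => //; by rewrite lee_fin exprn_ge0.
apply: (@avg_series_le _ _ (fun l => dil2 l.+1 T) 1 3) => // [|l|l l1|l l1].
- exact: ler1n.
- by rewrite /P' dil2_dil2; exact: fa.
- by rewrite hb beta_le_mseq.
have e1 : side (dil2 (l + 3) P') = 8 * 2 ^+ l * side Q.
  by rewrite !side_dil2 sP exprD; ring.
have h2 := two_le l1; rewrite e1 side_dil2 sideT exprS; split; last by lra.
apply: subcube_center => i; rewrite e1 !center_dil2 center_tcube side_dil2 sideT exprS.
have [] := xc i; have := cP i.
by rewrite !ler_norml => /andP[? ?] ? ?; apply/andP; split; lra.
Qed.

Lemma alpha2_summable (S : R) : (\sum_(2 <= k <oo) (alpha k)%:E <= S%:E)%E ->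
  (\sum_(2 <= k <oo) (alpha2 alpha k)%:E <= (2 * S)%:E)%E.
Proof.
move=> hS; pose g k : \bar R := if (3 <= k)%N then (alpha k.-1)%:E else 0%E.
have al0 i : (2 <= i)%N -> (0 <= (alpha i)%:E)%E by move=> i2; rewrite lee_fin ha.
have g0 i : (2 <= i)%N -> (0 <= g i)%E.
  by move=> i2; rewrite /g; case: ifP => // i3; rewrite lee_fin ha// -ltnS prednK// ltnW.
have e1 i : (2 <= i)%N -> ((alpha2 alpha i)%:E <= (alpha i)%:E + g i)%E.
  by move=> _; rewrite /alpha2 /g; case: ifP => _; rewrite -EFinD.
have e0 i : (2 <= i)%N -> (0 <= (alpha2 alpha i)%:E)%E.
  by move=> i2; rewrite lee_fin (alpha2_ge0 hO).
apply: (le_trans (series_le e0 e1)); rewrite (series_add al0 g0).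
have -> : (2 * S)%:E = (S%:E + S%:E)%E by rewrite -EFinD; congr (_%:E); ring.
apply: leeD => //.
rewrite (series_split (isT : (2 <= 3)%N) g0) big_nat1 [g 2]/= add0e.
have -> : (\sum_(3 <= k <oo) g k = \sum_(2 <= k <oo) (alpha k)%:E)%E; last exact: hS.
rewrite -(@series_shift _ 2 1 g); last by move=> i i3; apply: g0; exact: ltnW.
apply: (@le_anti _ (\bar R)); apply/andP; split; apply: series_le => i i2.
- by apply: g0; rewrite addn1 ltnW.
- by rewrite /g addn1 ltnS i2.
- exact: al0.
- by rewrite /g addn1 ltnS i2.
Qed.

(** The dilates [2^l P] with [l <= d] lie in tripled good ancestors and cost [t]; the others are
    larger than [Q] and are compared with dilates of [T]. *)
Lemma piece1_bound (S t : R) d k : 0 <= S -> 0 <= t ->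
  (\sum_(2 <= k <oo) (alpha k)%:E <= S%:E)%E ->
  (0 < d)%N -> cells Q (d, k) `<=` cubeset Q ->
  (forall y, cells Q (d, k) y -> forall e, (e < d)%N -> ~ bad mu p0 Q h t e (didx Q e y)) ->
  (alpha2_sum mu p0 alpha (dcell Q d k) h <=
    (3 ^+ n * (2 * S) * t + 3 ^+ n * (2 * 2 `^ (4%:R * n%:R / p0)) * Ks * L)%:E)%E.
Proof.
move=> S0 t0 hS d0 sub anc; have sQ := side_gt0 Q; set P := dcell Q d k.
set c := 2 * 2 `^ (4%:R * n%:R / p0).
have c0 : 0 <= c by rewrite mulr_ge0// powR_ge0.
have d2 : 0 < 2 ^+ d :> R by rewrite exprn_gt0.
have three : 0 <= 3 ^+ n :> R by rewrite exprn_ge0.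
pose z := 2 `^ (d%:R * n%:R / p0) : R; have z0 : 0 < z by rewrite powR_gt0.
pose b1 l : \bar R := ((3 ^+ n * t)%:E * (alpha2 alpha l)%:E)%E.
(* Generation [d - 1]: the enclosing cube is [2^(l-d+1) T], which equals [2^l T_(d-1)]. *)
pose Td := tcube Q x d.-1.
pose b2 l : \bar R := ((3 ^+ n * c / z) * (m (l + 0) * a (dil2 (l + 0) Td)))%:E.
have al0 l : (2 <= l)%N -> 0 <= alpha2 alpha l by exact: (alpha2_ge0 hO).
have b10 l : (2 <= l)%N -> (0 <= b1 l)%E.
  by move=> l2; rewrite /b1 -EFinM lee_fin !mulr_ge0// al0.
have b20 l : (2 <= l)%N -> (0 <= b2 l)%E.
  by move=> _; rewrite lee_fin !mulr_ge0// invr_ge0 ltW.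
have cP i : `|center P i - center Q i| <= side Q / 2.
  have sP0 : 0 < side Q / 2 ^+ d by rewrite divr_gt0.
  by apply: (le_trans (mem_cell d0 sub i)); lra.
(* The ancestor of generation [d - l] has side [2^l l(P)], so its triple contains [2^l P] with side
   ratio 3. *)
have small l : (2 <= l)%N -> (l <= d)%N -> (avg l P h <= (3 ^+ n * t)%:E)%E.
  move=> l2 ld; have [y yP] := cell_nonempty Q (d, k).
  pose e := (d - l)%N; have ed : (e < d)%N by rewrite /e ltn_subrL d0 andbT (ltnW l2).
  have dE : d = (e + l)%N by rewrite /e subnK.
  have := anc y yP e ed => /negP; rewrite -leNgt => hb_.
  have := normavg_le_integral hmu p0_gt0 t0 hb_ => hN.
  rewrite EFinM; apply: le_trans (lee_wpmul2l _ hN); last by rewrite lee_fin.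
  set s := side Q / 2 ^+ d.
  have se : side Q / 2 ^+ e = 2 ^+ l * s.
    rewrite /s dE exprD; field; by rewrite !gt_eqF ?exprn_gt0.
  have s0 : 0 < s by rewrite divr_gt0.
  apply: avg_transfer => //; first exact: ler1n.
    have PE : subcube P (dcell Q e (didx Q e y)).
      rewrite /P; move: yP => /dcellP /= <-; apply: subcube_of_cubeset.
      by apply: dcell_subset; exact: ltnW.
    apply: subcube_center => i; rewrite center_dil2 center_tri side_tri side_dil2.
    have := subcube_centerP i PE; rewrite !side_dcell -/s se => hh.
    have ls : s <= 2 ^+ l * s by rewrite ler_peMl ?(ltW s0)// exprn_ege1// ler1n.
    by apply: (le_trans hh); lra.
  by rewrite side_tri side_dil2 !side_dcell -/s se.
have large l : (d < l)%N -> (avg l P h <= (3 ^+ n * a (dil2 l Td))%:E)%E.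
  move=> dl; pose r := (l - d.-1)%N.
  have lE : l = (r + d.-1)%N by rewrite /r subnK// (leq_trans (leq_pred d))// ltnW.
  have rE : (l - d).+1 = r by rewrite /r; clear -d0 dl; lia.
  have r1 : (1 <= l - d)%N by rewrite subn_gt0.
  rewrite EFinM lE dil2_tcube -lE.
  apply: (@le_trans _ _ ((3 ^+ n)%:E * avg r T h)%E); last first.
    by apply: lee_wpmul2l; [rewrite lee_fin|exact: fa].
  have p2 : 2 <= 2 ^+ (l - d) :> R by rewrite -[leLHS]expr1 ler_eXn2l ?ltr1n.
  have e1 : side (dil2 l P) = 2 ^+ (l - d) * side Q.
    rewrite side_dil2 side_dcell -[in 2 ^+ l](subnK (ltnW dl)) exprD.
    by field; rewrite gt_eqF.
  apply: avg_transfer => //; first exact: ler1n.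
    apply: subcube_center => i; rewrite e1 !center_dil2 center_tcube.
    rewrite side_dil2 sideT -rE exprS; have [] := xc i; have := cP i.
    rewrite !ler_norml => /andP[? ?] ? ?; have := ler_wpM2r (ltW sQ) p2.
    by move=> ?; apply/andP; split; lra.
  rewrite e1 side_dil2 sideT -rE exprS.
  by have := ler_wpM2r (ltW sQ) p2; lra.
have key l : (2 <= l)%N -> ((alpha2 alpha l)%:E * avg l P h <= b1 l + b2 l)%E.
  move=> l2; have [ld|dl] := leqP l d.
    rewrite -[leLHS]adde0; apply: leeD; last exact: b20.
    rewrite /b1 muleC; apply: lee_wpmul2r; [by rewrite lee_fin al0|exact: small].
  rewrite -[leLHS]add0e; apply: leeD; first exact: b10.
  apply: (@le_trans _ _ ((alpha2 alpha l)%:E * (3 ^+ n * a (dil2 l Td))%:E)%E).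
    by apply: lee_wpmul2l; [rewrite lee_fin al0|exact: large].
  rewrite /b2 addn0 -EFinM lee_fin.
  (* For [l > d] the weight [2^(ln/p0)] hidden in [m_l] is at least [z = 2^(dn/p0)]; this gain
     cancels the growth allowed for a~(T_(d-1)). *)
  have za : alpha2 alpha l <= c / z * m l.
    have hm := alpha2_le_mseq n beta p01 ha l2; rewrite -/c in hm.
    rewrite mulrAC ler_pdivlMr//; apply: (le_trans _ hm).
    rewrite [alpha2 alpha l * _]mulrC ler_wpM2r ?al0// /z; apply: ler_powR; first exact: ler1n.
    by rewrite ler_wpM2r ?invr_ge0 ?(ltW p0_gt0)// ler_wpM2r// ler_nat ltnW.
  have a3 : 0 <= 3 ^+ n * a (dil2 l Td) by rewrite mulr_ge0.
  apply: (le_trans (ler_wpM2r a3 za)).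
  by rewrite le_eqVlt; apply/orP; left; apply/eqP; ring.
have s0 l : (2 <= l)%N -> (0 <= (alpha2 alpha l)%:E * avg l P h)%E.
  by move=> l2; rewrite mule_ge0 ?lee_fin ?al0 ?avg_ge0.
apply: (le_trans (series_le s0 key)); rewrite (series_add b10 b20) EFinD.
apply: leeD.
  have a20 l : (2 <= l)%N -> (0 <= (alpha2 alpha l)%:E)%E by rewrite lee_fin; exact: al0.
  rewrite /b1 (series_scale _ a20) mulrAC [leRHS]EFinM; apply: lee_wpmul2l.
    by rewrite lee_fin mulr_ge0.
  exact: alpha2_summable.
have cz : 0 <= 3 ^+ n * c / z by rewrite divr_ge0 ?mulr_ge0// ltW.
apply: (@le_trans _ _ ((3 ^+ n * c / z)%:E * atilde gamma a Td)%E).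
  by apply: (@atilde_series Td 2 0).
apply: (@le_trans _ _ ((3 ^+ n * c / z)%:E * (Ks * z * L)%:E)%E); last first.
  rewrite -EFinM lee_fin le_eqVlt; apply/orP; left; apply/eqP; field.
  by rewrite gt_eqF.
apply: lee_wpmul2l; first by rewrite lee_fin.
apply: (le_trans (hT _)); rewrite lee_fin ler_wpM2r ?(ltW L0)// ler_wpM2l ?(ltW Ks0)//.
apply: ler_powR; first exact: ler1n.
by rewrite ler_wpM2r ?invr_ge0 ?(ltW p0_gt0)// ler_wpM2r// ler_nat leq_pred.
Qed.

End Functional.
End LocalBounds.

(** * The distributional estimate on one cube *)

Section WeakEstimate.
Context (R : realType) (n : nat) (mu : {measure set (RnB R n) -> \bar R}).
Hypothesis hmu : lebesgue_on_cubes mu.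
Hypothesis n0 : (0 < n)%N.
Variables (p0 q : R) (q0 : \bar R) (Cp0 : R) (alpha beta : nat -> R).
Variable B : cube R n -> (RnB R n -> R) -> (RnB R n -> R).
Hypotheses (p01 : 1 <= p0) (pq : p0 < q) (qq0 : (q%:E < q0)%E).
Hypothesis hO : classO mu p0 q0 B Cp0 alpha beta.
Variables (w : RnB R n -> R) (hw : weight mu w) (hRH : RH_conj mu q q0 w).
Variable gamma : nat -> R.
Hypothesis hgamma : forall k, (1 <= k)%N -> mseq n p0 alpha beta k <= gamma k.
Variable CD : R.
Hypothesis CD1 : 1 <= CD.
Variable nu : {measure set (RnB R n) -> \bar R}.
Hypothesis nuE : forall E, nu E = wmeas mu w E.
Implicit Types (Q P T : cube R n).

Let p0_gt0 : 0 < p0. Proof. exact: lt_le_trans p01. Qed.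
Let q_gt0 : 0 < q. Proof. exact: lt_trans pq. Qed.
Let pq0 : (p0%:E <= q0)%E.
Proof. by apply/ltW/(lt_trans _ qq0); rewrite lte_fin. Qed.
Let nuoo Q : (nu (cubeset Q) < +oo)%E.
Proof. by rewrite nuE; exact: wmeas_cube_fin. Qed.
Let nunull (E : set (RnB R n)) : measurable E -> mu E = 0%E -> nu E = 0%E.
Proof. by rewrite nuE; exact: wmeas_null. Qed.
Let dbl (K : R) : exists2 C : R, 1 <= C & forall Q P : cube R n,
  subcube Q P -> side P <= K * side Q -> (nu (cubeset P) <= C%:E * nu (cubeset Q))%E.
Proof.
have [a [b [a0 a1 b0 b1 small]]] := RH_conj_small hmu hw nuE q_gt0 qq0 hRH.
have [C C1 hC] := doubling hmu n0 nuoo a0 a1 b0 b1 small K.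
by exists C => // Q P [h1 h2]; exact: hC.
Qed.

Lemma weak_estimate : exists2 C : R, 0 < C &
  forall (f : RnB R n -> R) (a : cube R n -> R) Q (L t : R),
  locLp mu p0 f -> (forall P, 0 <= a P) ->
  (forall (k : nat) P,
    (normavg mu p0%:E (cubeset (dil2 k P)) (B P f) <= (a (dil2 k P))%:E)%E) ->
  Dq_with mu q w (atilde gamma a) CD ->
  (0 < nu (cubeset Q))%E -> 0 < L -> (atilde gamma a (dil2 1 Q) <= L%:E)%E -> 0 < t ->
  ((t `^ q)%:E * nu (cubeset Q `&` above (B Q f) t) <=
    (C * L `^ q)%:E * nu (cubeset Q))%E.
Proof.
have sums (x y z : R) : 0 <= x -> 0 <= y -> 0 <= z ->
    [/\ 0 < 1 + x + y + z, x <= 1 + x + y + z, y <= 1 + x + y + z & z <= 1 + x + y + z].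
  by move=> *; split; lra.
have quarter (s : R) : 0 < s -> s / 4 <= (3 / 2 * s - s) / 2 by move=> ?; lra.
have quarter2 (s : R) : 0 < s -> s / 4 <= (2 ^+ 2 * s - 2 ^+ 1 * (3 / 2 * s)) / 2.
  by move=> ?; lra.
have thirds (a b c s : R) : `|a| <= s / 3 -> `|b| <= s / 3 -> `|c| <= s / 3 ->
    `|a + (b - c)| <= s.
  move=> ha hb hc; have := ler_normD a (b - c); have := ler_normB b c; lra.
have [sa [sb [sa0 sa1 sb0 sb1 small]]] := RH_conj_small hmu hw nuE q_gt0 qq0 hRH.
have nuq0 := RH_conj_linear hmu hw nuE q_gt0 qq0 hRH.
have nucells := Ainfty_cells hmu sa0 sa1 sb0 sb1 small.
have [Ks Ks0 hKs] := selection nuE nuoo dbl q_gt0 CD1 p01 pq n0.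
have [Kc Kc0 hKc] := Dq_compare nuE nuoo dbl q_gt0 CD1 4.
have [Kd Kd0 hKd] := local_decomposition hmu p01 pq0 hO.
have [S S0 hS] := alpha_summable p01 hO.
have [Cw Cw0 hCw] := weak_bound hmu p01 pq nunull nuq0.
have [Cd Cd1 hCd] := dbl 4; have Cd0 : 0 < Cd by exact: lt_le_trans Cd1.
have CD0 : 0 < CD by exact: lt_le_trans CD1.
have two_n : 0 < 2 ^+ n :> R by rewrite exprn_gt0.
have three_n : 0 < 3 ^+ n :> R by rewrite exprn_gt0.
pose c4 : R := 3 ^+ n * (2 * 2 `^ (4 * n%:R / p0)).
have c40 : 0 < c4 by rewrite !mulr_gt0// powR_gt0.
(* The initial level is [Cl * L]: [2^n Ks] comes from [root_bound], and the 1 ensures [L <= s] at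
   every later level [s], so that bounds by [L] are bounds by [s]. *)
pose Cl := 1 + 2 ^+ n * Ks; have Cl0 : 0 < Cl by rewrite addr_gt0// mulr_gt0.
(* One constant for all three pieces of the local decomposition, in the order [v1], [v2], [v3]. *)
pose K1 := 1 + Kd * (3 ^+ n * (2 * S) + c4 * Ks) + 3 ^+ n * Kc + 2 * Kd.
have k1 : 0 <= Kd * (3 ^+ n * (2 * S) + c4 * Ks).
  by rewrite mulr_ge0// addr_ge0// ?mulr_ge0// ltW.
have k2 : 0 <= 3 ^+ n * Kc by rewrite mulr_ge0// ltW.
have Kd2 : 0 <= 2 * Kd by rewrite mulr_ge0.
have [K10 K1a K1b K1c] := sums _ _ _ k1 k2 Kd2; rewrite -/K1 in K10 K1a K1b K1c.
have [Cg Cg0 hCg] := good_lambda hmu p01 pq nuoo nunull nucells nuq0 K10.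
pose c5 := 4 * 2 ^+ n * (Kc + Ks); have c50 : 0 < c5 by rewrite !mulr_gt0// addr_gt0.
pose C1 := Cg * (Cl `^ q + (CD * Kc) `^ q).
pose C2 := Cw * c5 `^ q * Cd.
have C10 : 0 < C1 by rewrite mulr_gt0// addr_gt0// powR_gt0// mulr_gt0.
have C20 : 0 < C2 by rewrite !mulr_gt0// powR_gt0.
exists (3 `^ q * (C1 + C2 + C2)); first by rewrite mulr_gt0 ?powR_gt0// !addr_gt0.
move=> f a Q L t hf a0 fa hD nQ L0 aL t0.
have mQ := measurable_cubeset Q; have sQ := side_gt0 Q.
have [x [hx hT]] := hKs _ Q L hD nQ L0 aL.
have nQ2 : (0 < nu (cubeset (dil2 1 Q)))%E.
  apply: (lt_le_trans nQ); apply: measure_mono => //; first exact: measurable_cubeset.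
  exact: subcube_cubeset (subcube_dil2 1 Q).
have hc P : subcube P (dil2 1 Q) -> side (dil2 1 Q) <= 4 * side P ->
    (atilde gamma a P <= (Kc * L)%:E)%E.
  by move=> PQ sP; apply: (hKc _ (dil2 1 Q)) => //; exact: ltW.
set T := tcube Q x 0; set h := B T f.
have mB P : measurable_fun setT (B P f) by have [] := locLp_B hO P hf.
have fnQ : nu (cubeset Q) \is a fin_num by rewrite ge0_fin_numE.
pose y := fine (nu (cubeset Q)); have yE : nu (cubeset Q) = y%:E by rewrite fineK.
have a_fin P : (fine (atilde gamma a P))%:E = atilde gamma a P.
  by have [fin _] := hD; have [h1 h2] := fin P; rewrite fineK// ge0_fin_numE.
have QT : subcube Q T.
  apply: subcube_center => i; rewrite center_tcube distrC sideT.
  exact: (le_trans (hx i) (quarter _ sQ)).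
have hh : (((t / 3) `^ q)%:E * nu (cubeset Q `&` above h (t / 3)) <=
    (C1 * L `^ q * y)%:E)%E.
  have D0 : 0 <= (CD * (Kc * L)) `^ q * y by rewrite mulr_ge0 ?powR_ge0// fine_ge0.
  have lam0 : 0 < Cl * L by rewrite mulr_gt0.
  have t3 : 0 < t / 3 by rewrite divr_gt0.
  have := hCg Q h (fun d k => fine (atilde gamma a (dcell Q d k))) _ _ (mB T) lam0 D0.
  move=> /(_ _ _ _ _ t3) hg; apply: (le_trans (hg _ _ _)).
  - apply/negP; rewrite -leNgt dcell0; apply: integral_le_normavg => //; first exact: ltW.
    apply: (le_trans (root_bound hmu p01 hO hgamma a0 hf fa hx hT)).
    by rewrite lee_fin ler_wpM2r ?(ltW L0)// /Cl lerDr.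
  - move=> s d k ls d0 sub anc.
    have Ls : L <= s by apply: le_trans ls; rewrite ler_peMl ?(ltW L0)// /Cl lerDl mulr_ge0// ltW.
    have s0 : 0 < s by exact: lt_le_trans Ls.
    have PT : cubeset (dcell Q d k) `<=` cubeset T.
      by apply: subset_trans sub _; exact: subcube_cubeset.
    have [v1 [v2 [v3 [[mv1 mv2 mv3] hv n1 n2 n3]]]] := hKd _ _ _ PT hf.
    exists v1, v2, v3; split => //; split => //.
    + apply: (le_trans n1).
      have b1 := piece1_bound hmu p01 hO hgamma a0 hf fa L0 Ks0 hx hT S0 (ltW s0) hS d0 sub anc.
      have Kd0' : (0 <= Kd%:E)%E by rewrite lee_fin.
      apply: (le_trans (lee_wpmul2l Kd0' b1)); rewrite -EFinM lee_fin -/c4.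
      apply: (@le_trans _ _ (Kd * (3 ^+ n * (2 * S) + c4 * Ks) * s)).
        rewrite -[leRHS]mulrA; apply: ler_wpM2l => //; rewrite [leRHS]mulrDl lerD2l.
        by rewrite ler_wpM2l// mulr_ge0// ltW.
      by rewrite ler_wpM2r ?(ltW s0).
    + apply: (le_trans n2).
      apply: (le_trans (piece2_bound hmu p01 hO hgamma a0 hf fa hx hc d0 sub)).
      rewrite lee_fin; apply: (@le_trans _ _ (3 ^+ n * Kc * s)).
        by rewrite ler_wpM2l.
      by rewrite ler_wpM2r ?(ltW s0).
    + apply: (le_trans n3).
      have b3 := piece3_bound hmu p01 hO hgamma a0 hf fa (dcell Q d k).
      have Kd0' : (0 <= Kd%:E)%E by rewrite lee_fin.
      apply: (le_trans (lee_wpmul2l Kd0' b3)).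
      have A0 : 0 <= fine (atilde gamma a (dcell Q d k)).
        by rewrite -lee_fin a_fin; have [fin _] := hD; have [] := fin (dcell Q d k).
      by rewrite -a_fin -!EFinM lee_fin mulrA ler_wpM2r// [Kd * 2]mulrC.
  (* The level bound is [D_q] on the cells themselves, with a~(Q) bounded by [Kc * L]. *)
  - move=> F s s0 tF subF sF.
    have aQ := atildeQ hc.
    have KL0 : 0 <= Kc * L by rewrite mulr_ge0// ltW.
    have := @Dq_family _ _ _ w nu nuE q CD q_gt0 CD1 _ _ F (cells Q)
      (fun i => dcell Q i.1 i.2) Q 1 s (Kc * L) hD s0 ler01 KL0 aQ.
    rewrite mul1r yE -EFinM; apply.
    + exact: subF.
    + exact: tF.
    + by move=> i _; exact: measurable_cells.
    + by move=> i _; rewrite mul1e.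
    + by move=> i Fi; rewrite -a_fin lee_fin; exact: sF.
  - rewrite lee_fin -/y [(Cl * L) `^ q]powRM ?(ltW Cl0) ?(ltW L0)//.
    rewrite [CD * (Kc * L)]mulrA [(CD * Kc * L) `^ q]powRM ?mulr_ge0 ?(ltW CD0) ?(ltW Kc0) ?(ltW L0)//.
    by rewrite /C1 le_eqVlt; apply/orP; left; apply/eqP; ring.
have t3 : 0 < t / 3 by rewrite divr_gt0.
have cL0 : 0 < c5 * L by rewrite mulr_gt0.
have wk P u : measurable_fun setT u -> subcube Q P -> subcube P (dil2 2 Q) ->
    (normavg mu q0 (cubeset P) u <= (c5 * L)%:E)%E ->
    (((t / 3) `^ q)%:E * nu (cubeset Q `&` above u (t / 3)) <= (C2 * L `^ q * y)%:E)%E.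
  move=> mu_ QP PQ nu_; have mP := measurable_cubeset P.
  have mA := measurable_aboveR (t / 3) mu_.
  apply: (@le_trans _ _ (((t / 3) `^ q)%:E * nu (cubeset P `&` above u (t / 3)))%E).
    apply: lee_wpmul2l; first by rewrite lee_fin powR_ge0.
    apply: measure_mono; [exact: measurableI|exact: measurableI|].
    by move=> z [Qz uz]; split => //; exact: subcube_cubeset Qz.
  apply: (le_trans (hCw P u _ _ mu_ cL0 nu_ t3)).
  have nP : (nu (cubeset P) <= Cd%:E * nu (cubeset Q))%E.
    apply: (@le_trans _ _ (nu (cubeset (dil2 2 Q)))).
      apply: measure_mono => //; first exact: measurable_cubeset.
      exact: subcube_cubeset.
    apply: hCd; first exact: subcube_dil2.
    by rewrite side_dil2 le_eqVlt; apply/orP; left; apply/eqP; ring.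
  have cc : (0 <= (Cw * (c5 * L) `^ q)%:E)%E by rewrite lee_fin mulr_ge0 ?powR_ge0// ltW.
  apply: (le_trans (lee_wpmul2l cc nP)); rewrite yE -!EFinM lee_fin.
  rewrite [(c5 * L) `^ q]powRM ?(ltW c50) ?(ltW L0)// /C2 le_eqVlt; apply/orP; left.
  by apply/eqP; ring.
set e1 := opA B T (B Q f); set e2 := opA B Q h.
have me1 : measurable_fun setT e1 by have [] := locLp_A p01 hO T (locLp_B hO Q hf).
have me2 : measurable_fun setT e2 by have [] := locLp_A p01 hO Q (locLp_B hO T hf).
have w1 : (((t / 3) `^ q)%:E * nu (cubeset Q `&` above e1 (t / 3)) <= (C2 * L `^ q * y)%:E)%E.
  apply: (wk (dil2 1 T)) => //.
  - exact: subcube_trans QT (subcube_dil2 1 T).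
  - apply: subcube_center => i; rewrite !center_dil2 center_tcube !side_dil2 sideT.
    exact: (le_trans (hx i) (quarter2 _ sQ)).
  - apply: (le_trans (delta1_bound hmu p01 pq0 hO hgamma a0 hf fa hx hc)).
    rewrite lee_fin ler_wpM2r ?(ltW L0)// /c5 ler_wpM2l ?mulr_ge0 ?(ltW two_n)//.
    by rewrite lerDl ltW.
have w2 : (((t / 3) `^ q)%:E * nu (cubeset Q `&` above e2 (t / 3)) <= (C2 * L `^ q * y)%:E)%E.
  apply: (wk (dil2 1 Q)) => //.
  - exact: subcube_dil2.
  - by rewrite -(dil2_dil2 1 1); exact: subcube_dil2.
  - apply: (le_trans (delta2_bound hmu p01 pq0 hO hgamma a0 hf fa hx hT)).
    rewrite lee_fin ler_wpM2r ?(ltW L0)// /c5 ler_wpM2l ?mulr_ge0 ?(ltW two_n)//.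
    by rewrite lerDr ltW.
have hae := change_of_cube hO Q T hf.
pose F u s := cubeset Q `&` above u s : set (RnB R n).
have mF u s : measurable_fun setT u -> measurable (F u s).
  by move=> m; apply: measurableI => //; exact: measurable_aboveR.
have mh : measurable (F h (t / 3)) := mF _ _ (mB T).
have m1 : measurable (F e1 (t / 3)) := mF _ _ me1.
have m2 : measurable (F e2 (t / 3)) := mF _ _ me2.
have mU : measurable (F h (t / 3) `|` F e1 (t / 3) `|` F e2 (t / 3)).
  by apply: measurableU => //; exact: measurableU.
have mN : measurable (F (B Q f) t `\` (F h (t / 3) `|` F e1 (t / 3) `|` F e2 (t / 3))).
  by apply: measurableD => //; exact: (mF _ _ (mB Q)).
have N0 := ae_measure0 hae mN.
(* Where all three summands are at most [t / 3], the a.e. identity for [B Q f] rules out a value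
   above [t]. *)
have {}N0 : nu (F (B Q f) t `\` (F h (t / 3) `|` F e1 (t / 3) `|` F e2 (t / 3))) = 0%E.
  apply: nunull => //; apply: N0 => z [[Qz /= tz] nz] ez.
  have s1 : `|h z| <= t / 3.
    by rewrite leNgt; apply/negP => hz; apply: nz; left; left.
  have s2 : `|e1 z| <= t / 3.
    by rewrite leNgt; apply/negP => hz; apply: nz; left; right.
  have s3 : `|e2 z| <= t / 3.
    by rewrite leNgt; apply/negP => hz; apply: nz; right.
  have tz' : t < `|B Q f z| := tz.
  by move: tz'; rewrite ez ltNge thirds.
have nuB : (nu (F (B Q f) t) <= nu (F h (t / 3)%R) + nu (F e1 (t / 3)%R) + nu (F e2 (t / 3)%R))%E.
  have mE : measurable (F (B Q f) t) := mF _ _ (mB Q).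
  set U := (F h (t / 3) `|` F e1 (t / 3) `|` F e2 (t / 3)) in mU mN N0.
  apply: (@le_trans _ _ (nu U)).
    apply: (@le_trans _ _ (nu (F (B Q f) t `\` U) + nu U)%E); last by rewrite N0 add0e.
    apply: (@le_trans _ _ (nu ((F (B Q f) t `\` U) `|` U))); last exact: measureU2.
    apply: measure_mono => //; first exact: measurableU.
    by move=> z Fz; have [Uz|nz] := pselect (U z); [right|left].
  apply: (@le_trans _ _ (nu (F h (t / 3)%R `|` F e1 (t / 3)%R) + nu (F e2 (t / 3)%R))%E).
    by apply: measureU2 => //; exact: measurableU.
  by apply: leeD => //; exact: measureU2.
have tq : t `^ q = 3 `^ q * (t / 3) `^ q.
  by rewrite -powRM ?(ltW t3)// mulrC divfK// pnatr_eq0.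
apply: (@le_trans _ _ ((t `^ q)%:E * (nu (F h (t / 3)%R) + nu (F e1 (t / 3)%R) + nu (F e2 (t / 3)%R)))%E).
  by apply: lee_wpmul2l => //; rewrite lee_fin powR_ge0.
rewrite tq EFinM -muleA.
apply: (@le_trans _ _ ((3 `^ q)%:E * ((C1 * L `^ q * y)%:E +
  (C2 * L `^ q * y)%:E + (C2 * L `^ q * y)%:E))%E).
  apply: lee_wpmul2l; first by rewrite lee_fin powR_ge0.
  rewrite ge0_muleDr; [|exact: adde_ge0|exact: measure_ge0].
  rewrite ge0_muleDr; [|exact: measure_ge0|exact: measure_ge0].
  exact: leeD (leeD hh w1) w2.
rewrite yE -!EFinD -!EFinM lee_fin le_eqVlt; apply/orP; left; apply/eqP; ring.
Qed.

End WeakEstimate.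

(** * From distributional bounds to the weak norm *)

Section WeakNorm.
Context (R : realType) (n : nat) (mu : {measure set (RnB R n) -> \bar R}).
Variables (w : RnB R n -> R) (nu : {measure set (RnB R n) -> \bar R}).
Hypothesis nuE : forall E, nu E = wmeas mu w E.
Variable q : R.
Hypothesis q_gt0 : 0 < q.

Lemma weaknorm_le (Q : cube R n) g (C L : R) : 0 <= C -> 0 <= L ->
  measurable_fun setT g -> (nu (cubeset Q) < +oo)%E ->
  ((0 < nu (cubeset Q))%E -> forall t, 0 < t ->
    ((t `^ q)%:E * nu (cubeset Q `&` above g t) <= (C * L `^ q)%:E * nu (cubeset Q))%E) ->
  (weaknorm mu w q Q g <= (C `^ q^-1 * L)%:E)%E.
Proof.
move=> C0 L0 mg fQ h; have mQ := measurable_cubeset Q.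
have qi0 : 0 <= q^-1 by rewrite invr_ge0 ltW.
have CL0 : 0 <= C `^ q^-1 * L by rewrite mulr_ge0// powR_ge0.
apply: ge_ereal_sup => _ [t /= t0 <-]; rewrite -!nuE -/(above g t).
have mA : measurable (cubeset Q `&` above g t).
  by apply: measurableI => //; exact: measurable_aboveR.
have sub : (nu (cubeset Q `&` above g t) <= nu (cubeset Q))%E by exact: measure_mono.
have fnQ : nu (cubeset Q) \is a fin_num by rewrite ge0_fin_numE.
have fnA : nu (cubeset Q `&` above g t) \is a fin_num.
  by rewrite ge0_fin_numE// (le_lt_trans sub).
(* If [nu Q = 0] the numerator vanishes too, and the quotient is 0 by the convention
   [0 * +oo = 0]. *)
have [nQ|nQ] := leP (nu (cubeset Q)) 0%E.
  have -> : nu (cubeset Q `&` above g t) = 0%E.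
    by apply/le_anti; rewrite measure_ge0 andbT (le_trans sub).
  by rewrite mul0e poweR0r ?mule0 ?lee_fin// gt_eqF// invr_gt0.
have := h nQ t t0; rewrite -(fineK fnQ) -(fineK fnA) in nQ *.
set u := fine (nu (cubeset Q `&` _)); move: nQ; set v := fine _; rewrite lte_fin => v0.
rewrite -!EFinM lee_fin inver (gt_eqF v0) -[(u%:E * _)%E]EFinM poweR_EFin -EFinM lee_fin => hu.
have u0 : 0 <= u by rewrite fine_ge0.
have uv : 0 <= u / v by rewrite divr_ge0// ltW.
have tE : t = (t `^ q) `^ q^-1 by rewrite -powRrM divff ?gt_eqF// powRr1// ltW.
have LE : L = (L `^ q) `^ q^-1 by rewrite -powRrM divff ?gt_eqF// powRr1.
rewrite [X in X * _ <= _]tE [X in _ <= _ * X]LE -!powRM ?powR_ge0//.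
apply: powR_le => //; first by rewrite mulr_ge0 ?powR_ge0.
by rewrite mulrA ler_pdivrMr.
Qed.

End WeakNorm.

Theorem mainTheorem7 (R : realType) (n : nat) (p0 Cp0 : R)
  (alpha beta : nat -> R) :
  (0 < n)%N -> 1 <= p0 ->
  alpha_adm n p0 alpha -> beta_adm beta ->
  exists C0 : R, 0 < C0 /\
  forall (mu : {measure set (RnB R n) -> \bar R}), lebesgue_on_cubes mu ->
  forall (q : R) (q0 : \bar R), p0 < q -> (q%:E < q0)%E ->
  forall B : cube R n -> (RnB R n -> R) -> (RnB R n -> R),
  classO mu p0 q0 B Cp0 alpha beta ->
  forall w : RnB R n -> R, weight mu w -> RH_conj mu q q0 w ->
  forall gamma : nat -> R,
  (forall k, (1 <= k)%N -> C0 * mseq n p0 alpha beta k <= gamma k) ->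
  forall CD : R,
  exists C : R,
  forall (f : RnB R n -> R) (a : cube R n -> R),
    locLp mu p0 f ->
    (forall Q, 0 <= a Q) ->
    (forall (k : nat) (Q : cube R n),
       (normavg mu p0%:E (cubeset (dil2 k Q)) (B Q f) <= (a (dil2 k Q))%:E)%E) ->
    Dq_with mu q w (atilde gamma a) CD ->
    forall Q : cube R n,
      (weaknorm mu w q Q (B Q f) <= C%:E * atilde gamma a (dil2 1 Q))%E.
Proof.
(* [C0 = 1] works: the numbers [m_k] enter only through [m_k <= gamma k], and every other constant
   goes into [C]. *)
move=> n0 p01 _ _; exists 1; split => // mu hmu q q0 pq qq0 B hO w hw hRH gamma hg CD.
have hgamma k : (1 <= k)%N -> mseq n p0 alpha beta k <= gamma k.
  by move=> k1; have := hg k k1; rewrite mul1r.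
have q_gt0 : 0 < q by apply: lt_trans pq; exact: lt_le_trans p01.
(* [Dq_with] includes [1 <= CD]; for smaller [CD] the claim is vacuous. *)
have [CD1|CD1] := leP 1 CD; last first.
  by exists 0 => f a _ _ _ [_ [h _]]; exfalso; move: CD1; rewrite ltNge h.
have [nu nuE] : exists nu : {measure set (RnB R n) -> \bar R},
    forall E, nu E = wmeas mu w E.
  have w0 x : (0 <= (EFin \o w) x)%E by rewrite lee_fin; have [] := hw.
  exact: (density_measure mu (@measurable_weightE _ _ _ _ hw setT) w0).
have [C C0 hC] := weak_estimate hmu n0 p01 pq qq0 hO hw hRH hgamma CD1 nuE.
exists (C `^ q^-1) => f a hf a0 fa hD Q.
have [fin _] := hD; have [A0 Aoo] := fin (dil2 1 Q).
have fA : atilde gamma a (dil2 1 Q) \is a fin_num by rewrite ge0_fin_numE.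
set A := atilde gamma a (dil2 1 Q) in A0 Aoo fA *.
have Aq0 : 0 <= C `^ q^-1 by rewrite powR_ge0.
have mBf : measurable_fun setT (B Q f) by have [] := locLp_B hO Q hf.
have nuQ : (nu (cubeset Q) < +oo)%E by rewrite nuE; exact: wmeas_cube_fin hw Q.
(* The estimate requires [L > 0] while a~(2Q) may vanish, so it is applied with [L = fine A + e],
   and [e] then tends to 0. *)
have key (e : R) : 0 < e -> (weaknorm mu w q Q (B Q f) <= (C `^ q^-1 * (fine A + e))%:E)%E.
  move=> e0; have L0 : 0 < fine A + e by rewrite ltr_wpDl// fine_ge0.
  apply: (weaknorm_le nuE q_gt0 (ltW C0) (ltW L0) mBf nuQ) => nQ t t0.
  apply: (hC f a Q _ t hf a0 fa hD nQ L0 _ t0).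
  by rewrite EFinD fineK// leeDl// lee_fin ltW.
apply/lee_addgt0Pr => e e0.
have c1 : 0 < C `^ q^-1 + 1 by rewrite ltr_wpDl.
apply: (le_trans (key (e / (C `^ q^-1 + 1)) _)); first exact: divr_gt0.
rewrite -[in leRHS](fineK fA) -EFinM -EFinD lee_fin mulrDr lerD2l mulrA ler_pdivrMr//.
rewrite mulrC ler_wpM2l ?(ltW e0)//.
by rewrite lerDl.
Qed.
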